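(* Let $n\ge2$ and let $\mathbf{B}\subset\mathbb{R}^n$ be the unit ball. For any bounded Lipschitz domain $\Omega\subset\mathbb{R}^n$ we have $C_B(\Omega)\ge C_B(\mathbf{B})=n$. Moreover, for any $i\in\{1,\dots,n\}$ and $g\in\mathcal{K}_i(\mathbf{B})\cap L^2(\mathbf{B},\mathbb{R})$, the following implication holds: $$-\Delta w=g\ \text{ in }\mathbf{B},\quad w=0\ \text{ on }\partial\mathbf{B}\qquad\Longrightarrow\qquad\int_{\mathbf{B}}\left|\frac{\partial w}{\partial x_i}\right|^2dx\ge\frac1n\int_{\mathbf{B}}|\nabla w|^2\,dx.$$ Furthermore, for any $h\in\mathcal{C}(\mathbb{R},\mathbb{R})$, the following implication holds: $$-\Delta w_h=h\Big(\sum_{i=1}^nx_i\Big)\ \text{ in }\mathbf{B},\quad w_h=0\ \text{ on }\partial\mathbf{B}\qquad\Longrightarrow\qquad\sum_{1\le i<j\le n}\int_{\mathbf{B}}\partial_{x_i}w_h\,\partial_{x_j}w_h\,dx\ge0.$$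
   Context: $L^2_0(\Omega,\mathbb{R})$ is the space of zero-mean functions in $L^2(\Omega,\mathbb{R})$. The Bogovskii constant of $\Omega$ is $$C_B(\Omega)=\sup_{f\in L^2_0(\Omega,\mathbb{R}),\ \|f\|_{L^2(\Omega)}=1}\ \inf\Big\{\|\nabla v\|_{L^2(\Omega)}^2;\ v\in H^1_0(\Omega,\mathbb{R}^n),\ \nabla\cdot v=f\text{ in }\Omega\Big\}.$$ $\mathcal{K}_i(\mathbf{B})$ is the vector space of functions $g:\mathbf{B}\to\mathbb{R}$ that depend at most on the $i$-th variable, $g(x)=g(x_i)$. The functions $w,w_h\in H^1_0(\mathbf{B},\mathbb{R})$ are weak solutions of the Dirichlet problems. *)

(* Defs.v *)
From HB Require Import structures.
From mathcomp Require Import all_boot all_order all_algebra.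
From mathcomp Require Import all_classical all_reals all_analysis.

Set Implicit Arguments.
Unset Strict Implicit.
Unset Printing Implicit Defensive.

Import Order.TTheory GRing.Theory Num.Theory.
Import numFieldNormedType.Exports.

Local Open Scope classical_set_scope.
Local Open Scope ring_scope.

(* The product sigma-algebra on row vectors (for R it is the Borel one), set up
   as the library does for tuples. *)
Section measurable_rV.
Context {d} {T : sigmaRingType d} (n : nat).

Let coors : 'I_n -> 'rV[T]_n -> T := fun i x => x ord0 i.

Let rV_set0 : g_sigma_preimage coors set0.
Proof. exact: sigma_algebra0. Qed.

Let rV_setC A : g_sigma_preimage coors A -> g_sigma_preimage coors (~` A).
Proof. exact: sigma_algebraC. Qed.

Let rV_bigcup (F : _^nat) : (forall i, g_sigma_preimage coors (F i)) ->
  g_sigma_preimage coors (\bigcup_i (F i)).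
Proof. exact: sigma_algebra_bigcup. Qed.

HB.instance Definition _ := @isMeasurable.Build (measure_tuple_display d)
  'rV[T]_n (g_sigma_preimage coors) rV_set0 rV_setC rV_bigcup.

End measurable_rV.

Lemma measurable_coord_rV d (T : sigmaRingType d) n (i : 'I_n) :
  measurable_fun [set: 'rV[T]_n] (fun x : 'rV[T]_n => x ord0 i).
Proof.
move=> _ Y mY; rewrite setTI; apply: sub_sigma_algebra => /=.
rewrite -bigcup_seq/=; exists i => /=; first by rewrite mem_index_enum.
by exists Y => //; rewrite setTI.
Qed.

Lemma measurable_fun_rVP d1 d2 (T1 : measurableType d1) (T2 : measurableType d2)
    n (f : T1 -> 'rV[T2]_n) :
  measurable_fun [set: T1] f <->
  forall i, measurable_fun [set: T1] (fun x => f x ord0 i).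
Proof.
split=> [mf i|mf].
  exact: (measurableT_comp (@measurable_coord_rV _ _ _ i) mf).
pose G := \big[setU/set0]_(i < n)
  preimage_set_system setT (fun x : 'rV[T2]_n => x ord0 i) measurable.
apply: (@measurability _ _ _ _ setT f G) => // _ [A GA <-].
move: GA; rewrite /G -bigcup_seq => -[i _ [B mB <-]].
rewrite setTI; have := mf i measurableT B mB.
by rewrite !setTI.
Qed.

Section lebesgue_rV.
Context (R : realType).

Definition cons_rV n (p : R * 'rV[R]_n) : 'rV[R]_n.+1 :=
  row_mx (p.1%:M : 'rV[R]_1) p.2.

Lemma cons_rVE n (p : R * 'rV[R]_n) (i : 'I_n.+1) :
  cons_rV p ord0 i = if unlift ord0 i is Some j then p.2 ord0 j else p.1.
Proof.
case: unliftP => [j|] ->.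
  have -> : lift ord0 j = rshift 1 j by exact: val_inj.
  by rewrite [LHS]row_mxEr.
have -> : ord0 = lshift n (ord0 : 'I_1) :> 'I_n.+1 by exact: val_inj.
by rewrite [LHS]row_mxEl mxE eqxx mulr1n.
Qed.

Lemma measurable_cons_rV n :
  measurable_fun [set: R * 'rV[R]_n] (@cons_rV n).
Proof.
apply/measurable_fun_rVP => i.
under eq_fun do rewrite cons_rVE.
case: unliftP => [j|] _; last exact: measurable_fst.
exact: (measurableT_comp (@measurable_coord_rV _ _ _ j) measurable_snd).
Qed.

Definition uncons_rV n (x : 'rV[R]_n.+1) : R * 'rV[R]_n :=
  (x ord0 ord0, \row_j x ord0 (lift ord0 j)).

Lemma cons_rVK n : cancel (@cons_rV n) (@uncons_rV n).
Proof.
move=> [a x]; rewrite /uncons_rV cons_rVE unlift_none /=; congr pair.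
by apply/rowP => j; rewrite mxE cons_rVE liftK.
Qed.

Lemma measurable_uncons_rV n : measurable_fun setT (@uncons_rV n).
Proof.
apply/measurable_fun_pairP; split; first exact: measurable_coord_rV.
apply/measurable_fun_rVP => i /=.
by under eq_fun do rewrite mxE; exact: measurable_coord_rV.
Qed.

Section lebesgue_rVS.
Context (n : nat) (mu : {sigma_finite_measure set 'rV[R]_n -> \bar R}).

Definition lebesgue_rVS : set 'rV[R]_n.+1 -> \bar R :=
  pushforward (lebesgue_measure \x mu)%E (@cons_rV n).

Let mpre A : measurable A -> measurable (@cons_rV n @^-1` A).
Proof.
by move=> mA; rewrite -[X in measurable X]setTI; exact: measurable_cons_rV.
Qed.

Let push0 : lebesgue_rVS set0 = 0%E.
Proof. by rewrite /lebesgue_rVS /pushforward preimage_set0 measure0. Qed.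

Let push_ge0 A : (0 <= lebesgue_rVS A)%E.
Proof. by rewrite /lebesgue_rVS /pushforward; exact: measure_ge0. Qed.

Let push_sigma_additive : semi_sigma_additive lebesgue_rVS.
Proof.
move=> F mF tF mUF; rewrite /lebesgue_rVS /pushforward preimage_bigcup.
apply: measure_semi_sigma_additive.
- by move=> k; exact: mpre.
- apply/trivIsetP => /= i j _ _ ij; rewrite -preimage_setI.
  by move/trivIsetP : tF => /(_ _ _ _ _ ij) ->//; rewrite preimage_set0.
- by rewrite -preimage_bigcup; exact: mpre.
Qed.

HB.instance Definition _ := isMeasure.Build _ _ _ lebesgue_rVS
  push0 push_ge0 push_sigma_additive.

Let push_sigma_finite : sigma_finite setT lebesgue_rVS.
Proof.
have /sigma_finiteP[F [FT ndF Foo]] := sigma_finiteT (@lebesgue_measure R).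
have /sigma_finiteP[G [GT ndG Goo]] := sigma_finiteT mu.
exists (fun k => @uncons_rV n @^-1` (F k `*` G k)).
  rewrite -preimage_bigcup (_ : \bigcup_k _ = setT) ?preimage_setT//.
  apply/seteqP; split=> // -[a x] _.
  have [k _ Fka] : (\bigcup_k F k) a by rewrite -FT.
  have [l _ Glx] : (\bigcup_k G k) x by rewrite -GT.
  exists (maxn k l) => //; split.
    by move: a Fka; exact/subsetPset/ndF/leq_maxl.
  by move: x Glx; exact/subsetPset/ndG/leq_maxr.
move=> k; have [mF Fk] := Foo k; have [mG Gk] := Goo k; split.
  rewrite -[X in measurable X]setTI; apply: measurable_uncons_rV => //.
  exact: measurableX.
rewrite /lebesgue_rVS /pushforward -comp_preimage.
rewrite (_ : _ \o _ = id) ?preimage_id; last first.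
  by apply/funext => x /=; rewrite cons_rVK.
by rewrite product_measure1E// lte_mul_pinfty// ge0_fin_numE.
Qed.

HB.instance Definition _ := Measure_isSigmaFinite.Build _ _ _ lebesgue_rVS
  push_sigma_finite.

End lebesgue_rVS.

(* Lebesgue measure on R^n, as the n-fold product of the one on R. *)
Fixpoint lebesgue_rV n : {sigma_finite_measure set 'rV[R]_n -> \bar R} :=
  match n return {sigma_finite_measure set 'rV[R]_n -> \bar R} with
  | 0 => \d_(0 : 'rV[R]_0)
  | m.+1 => lebesgue_rVS (lebesgue_rV m)
  end.

End lebesgue_rV.
Arguments lebesgue_rV R n : clear implicits.

(* Vectors carry the library's sup norm, so [ball 0 1] is a cube. *)
Definition unit_ball (R : realType) (n : nat) : set 'rV[R]_n :=
  [set x | \sum_i x ord0 i ^+ 2 < 1].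
Arguments unit_ball R n : clear implicits.

Section domains.
Context (R : realType) (n : nat).
Implicit Types Omega : set 'rV[R]_n.

(* Near x, in the orthonormal coordinates z = y *m Q, Omega is the strict
   subgraph of a Lipschitz function of all coordinates of z but the k-th. *)
Definition lipschitz_boundary_at Omega (x : 'rV[R]_n) :=
  exists (Q : 'M[R]_n) (k : 'I_n) (gamma : 'rV[R]_n.-1 -> R),
    [/\ Q *m Q^T = 1%:M,
        [lipschitz gamma y | y in setT] &
        \forall y \near x,
          Omega y <-> (y *m Q) ord0 k < gamma (col' k (y *m Q))].

Definition bounded_lipschitz_domain Omega :=
  [/\ open Omega, connected Omega, Omega !=set0, bounded_set Omega &
      forall x, (closure Omega `\` Omega) x -> lipschitz_boundary_at Omega x].

End domains.

Section sobolev.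
Context (R : realType) (n : nat).
Local Notation lambda := (lebesgue_rV R n).
Implicit Types (Omega : set 'rV[R]_n) (u f g phi : 'rV[R]_n -> R).

Definition partial (i : 'I_n) f : 'rV[R]_n -> R :=
  fun x => 'D_(delta_mx ord0 i) f x.

Definition smooth f := forall s : seq 'I_n,
  let fs := foldr partial f s in
  continuous fs /\ forall (i : 'I_n) x, derivable fs x (delta_mx ord0 i).

Definition test_function Omega phi :=
  let supp := closure [set x | phi x != 0] in
  [/\ smooth phi, compact supp & supp `<=` Omega].

Definition sqnormL2 Omega f : \bar R :=
  (\int[lambda]_(x in Omega) (f x ^+ 2)%:E)%E.

Definition L2 Omega f :=
  measurable_fun Omega f /\ (sqnormL2 Omega f < +oo)%E.

(* Du is an L^2 weak gradient of u on Omega; it is determined up to a.e.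
   equality, so gradients are carried along relationally. *)
Definition weak_gradient Omega u (Du : 'rV[R]_n -> 'rV[R]_n) :=
  forall i : 'I_n, L2 Omega (fun x => Du x ord0 i) /\
    forall phi, test_function Omega phi ->
      \int[lambda]_(x in Omega) (u x * partial i phi x) =
      - \int[lambda]_(x in Omega) (Du x ord0 i * phi x).

Definition H1 Omega u Du := L2 Omega u /\ weak_gradient Omega u Du.

(* u is in H^1_0(Omega), the closure in H^1(Omega) of the test functions, and
   Du is its weak gradient. *)
Definition H10 Omega u Du := H1 Omega u Du /\
  exists2 phi : ('rV[R]_n -> R)^nat, forall m, test_function Omega (phi m) &
    sqnormL2 Omega (phi m \- u) @[m --> \oo] --> 0%E /\
    forall i : 'I_n,
      sqnormL2 Omega (fun x => partial i (phi m) x - Du x ord0 i) @[m --> \oo]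
        --> 0%E.

(* v is in H^1_0(Omega, R^n) with Jacobian matrix Dv (row j is the gradient of
   v_j), so that div v = \tr Dv. *)
Definition H10vec Omega (v : 'rV[R]_n -> 'rV[R]_n) (Dv : 'rV[R]_n -> 'M[R]_n) :=
  forall j : 'I_n, H10 Omega (fun x => v x ord0 j) (fun x => row j (Dv x)).

Definition bogovskii Omega : \bar R := ereal_sup
  [set ereal_inf
     [set E | exists v Dv, [/\ H10vec Omega v Dv,
        {ae lambda, forall x, Omega x -> \tr (Dv x) = f x} &
        E = (\int[lambda]_(x in Omega) (\sum_i \sum_j Dv x i j ^+ 2)%:E)%E]]
   | f in [set f | [/\ L2 Omega f, \int[lambda]_(x in Omega) f x = 0 &
                       sqnormL2 Omega f = 1%E]]].

(* w (with weak gradient Dw) is the weak solution of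
   - Laplacian w = g in Omega, w = 0 on the boundary of Omega. *)
Definition dirichlet_solution Omega g w Dw := H10 Omega w Dw /\
  forall u Du, H10 Omega u Du ->
    \int[lambda]_(x in Omega) (\sum_i Dw x ord0 i * Du x ord0 i) =
    \int[lambda]_(x in Omega) (g x * u x).

Definition depends_only_on Omega (i : 'I_n) g :=
  exists k : R -> R, forall x, Omega x -> g x = k (x ord0 i).

End sobolev.

(* Main.v *)
Require Import Defs.
From HB Require Import structures.
From mathcomp Require Import all_boot all_order all_algebra.
From mathcomp Require Import all_classical all_reals all_analysis.
From mathcomp Require Import measurable_realfun.
From mathcomp Require mpoly.
From mathcomp Require Import ring lra zify.
Import -(notations) mpoly.

(** Write rho = 1 - |x|^2, so that the ball B is the set where rho > 0, and
    write (u, v) and |u| for the inner product and the norm of L^2.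

    The lower bound n holds on every bounded nonempty open set Omega
    ([bogovskii_ge]).  Center the coordinates at the centroid, y_j = x_j - c_j,
    choose i so that |y_i| is maximal, and take f = s y_i of norm 1.  If v in
    H^1_0 has divergence f, integration by parts against y_i and y_j gives
    (f, y_i) = - int v_i and (d_j v_i, y_j) = - int v_i for all j.  Hence the
    sum over j of (d_j v_i, s y_j) is n, while the sum of the |s y_j|^2 is at
    most n, and Cauchy-Schwarz yields |grad v_i|^2 >= n.

    On the ball the bound n is reached by an explicit solution when f is a
    polynomial of mean zero ([polynomial_bogovskii]).  The map
    p |-> Lap (Lap (rho^2 p)) is injective on polynomials and does not raise the
    degree, so it is onto; hence f = Lap (rho^2 p) + h with h harmonic.
    Moreover h = 2 E with E = x . grad w and w harmonic, because h has mean
    zero.  The field v = grad (rho^2 p) - rho grad w vanishes on the sphere, its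
    divergence is f, and Green's formula gives, with F = Lap (rho^2 p),
      |Dv|^2    = |F|^2 + 8 |E|^2 + (4 n - 8) (w, E),
      n |f|^2   = n |F|^2 + 4 n |E|^2,
    so that the bound reduces to (w, E) <= |E|^2 ([I_euler_ge]), which follows
    from two more integrations by parts over harmonic polynomials.

    A general f of mean zero is the sum of a series of polynomials q_k of mean zero.  Choosing
    weights w_k of sum at most 1, with w_0 close to 1, and q_0 close to f, the
    sum of the |q_k|^2 / w_k exceeds |f|^2 by as little as desired
    ([telescoping_approximation]).  The weighted Cauchy-Schwarz inequality then
    bounds the energy of the sum of the polynomial solutions by the same
    quantity, times n, and also proves that this sum converges
    ([weighted_series_cvg], [bogovskii_solution]).  That the polynomial
    solutions lie in H^1_0 is shown with smooth cutoffs ([H10_rho]).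

    The two statements on the Dirichlet problem are one inequality: if
    - Lap w = g with g = k (a . x), then
      |a|^2 |grad w|^2 <= n |a . grad w|^2    ([dirichlet_energy]).
    Let v have divergence f = a . grad w and energy at most n |f|^2 + e.  A
    function G of a . x has a primitive Q of a . x with grad Q = G a, so
    integrating Q against the divergence-free field w a - v shows that
    |a|^2 w - a . v is orthogonal to g ([ip_ridge]).  Using w and the v_i as
    test functions in the weak equation,
      sum_j (d_j w, a . d_j v) = (g, a . v) = |a|^2 (g, w) = |a|^2 |grad w|^2,
    and Cauchy-Schwarz concludes.  The basis vector a = e_i gives the first
    statement; a = (1, ..., 1) gives the second, since then |a . grad w|^2 is
    |grad w|^2 plus twice the sum of the (d_i w, d_j w) with i < j. *)

Set Implicit Arguments.
Unset Strict Implicit.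
Unset Printing Implicit Defensive.

Import Order.TTheory GRing.Theory Num.Theory.
Import numFieldNormedType.Exports.

Local Open Scope classical_set_scope.
Local Open Scope ring_scope.

(** * Surjectivity of injective maps on a finite span *)

(** Rank-nullity without a finite-dimensional type: the vectors e i live in an
    arbitrary module (here the polynomials of bounded degree inside all
    polynomials) and need not be independent. *)
Section injective_finite.
Context (F : fieldType) (U : lmodType F) (I : finType) (e : I -> U).
Implicit Types (x y : U).

Let V x := exists c : I -> F, x = \sum_i c i *: e i.

Let V0 : V 0.
Proof. by exists (fun=> 0); rewrite big1 // => i _; rewrite scale0r. Qed.

Let VZ a x : V x -> V (a *: x).
Proof.
move=> [c ->]; exists (fun i => a * c i).
by rewrite scaler_sumr; apply: eq_bigr => i _; rewrite scalerA.
Qed.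

Let VD x y : V x -> V y -> V (x + y).
Proof.
move=> [c ->] [c' ->]; exists (fun i => c i + c' i).
by rewrite -big_split/=; apply: eq_bigr => i _; rewrite scalerDl.
Qed.

(** The #|I| + 1 iterates G^k y are linearly dependent.  In a dependency of
    lowest order the coefficient of y can be made nonzero by cancelling G, and
    then y is the image of a combination of iterates. *)
Lemma injective_finite_surjective (G : {linear U -> U}) :
  (forall x, V x -> V (G x)) -> (forall x, V x -> G x = 0 -> x = 0) ->
  forall y, V y -> exists2 x, V x & G x = y.
Proof.
move=> GV Ginj y Vy.
have Vit k : V (iter k G y) by elim: k => //= k; exact: GV.
have Vsum m (c : nat -> F) : V (\sum_(k < m) c k *: iter k G y).
  by elim/big_ind : _ => //= k _; exact/VZ/Vit.
have solve m : forall c : nat -> F, (exists2 k, (k < m)%N & c k != 0) ->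
    \sum_(k < m) c k *: iter k G y = 0 -> exists2 x, V x & G x = y.
  elim: m => [c [//]|m IH c [k km ck0]].
  rewrite big_ord_recl/=; set S := \sum_(i < m) c i.+1 *: iter i G y.
  have -> : \sum_(i < m) c (bump 0 i) *: G (iter i G y) = G S.
    by rewrite linear_sum; apply: eq_bigr => i _; rewrite linearZ.
  have [c0|c0] := eqVneq (c 0%N) 0; last first.
    move/eqP; rewrite addr_eq0 => /eqP E.
    exists (- (c 0%N)^-1 *: S); first exact/VZ/(Vsum m (fun i => c i.+1)).
    by rewrite linearZ/= scaleNr -scalerN -E scalerA mulVf // scale1r.
  rewrite c0 scale0r add0r => GS0.
  apply: (IH (fun i => c i.+1)); last by apply: Ginj => //; exact: (Vsum m (fun i => c i.+1)).
  by case: k km ck0 => [|k] km ck0; [rewrite c0 eqxx in ck0|exists k].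
(* More iterates than spanning vectors: their coordinates have a left kernel. *)
pose N := #|I|.
have [C HC] := choice Vit.
pose M : 'M[F]_(N.+1, N) := \matrix_(k, j) C k (enum_val j).
have kM : kermx M != 0.
  rewrite kermx_eq0 /row_free; apply/negP => /eqP rM.
  by have := rank_leq_col M; rewrite rM ltnn.
have /rowV0Pn [v /sub_kermxP vM v0] := kM.
apply: (solve N.+1 (fun k => v ord0 (inord k))).
  have /existsP[j vj] : [exists j, v ord0 j != 0].
    apply: contraNT v0 => /existsPn v0; apply/eqP/rowP => j.
    by rewrite mxE; apply/eqP/negbNE/v0.
  by exists j => //; rewrite inord_val.
transitivity (\sum_(k < N.+1) \sum_i (v ord0 k * C k i) *: e i).
  apply: eq_bigr => k _; rewrite inord_val HC scaler_sumr.
  by apply: eq_bigr => i _; rewrite scalerA.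
rewrite exchange_big big1 // => i _; rewrite -scaler_suml.
have /rowP/(_ (enum_rank i)) := vM; rewrite !mxE => E.
rewrite (_ : \sum_k _ = 0) ?scale0r // -[RHS]E.
by apply: eq_bigr => k _; rewrite mxE enum_rankK.
Qed.

End injective_finite.

(** * The divergence equation for polynomials *)
Section harmonic_decomposition.
Context (R : realFieldType) (n : nat).
Local Notation P := (mpoly n R).
Local Notation "'X i" := (mpolyX R (mnm1 i)) (at level 8, i at level 2).
Local Notation d := mderiv.
Implicit Types (f h p q u w y z : P).

Definition lap p : P := \sum_i d i (d i p).
Definition euler p : P := \sum_i 'X i * d i p.
Definition grad2 p q : P := \sum_i d i p * d i q.
Definition rho : P := 1 - \sum_i 'X i ^+ 2.

Lemma mderiv_sum i (J : finType) (f : J -> P) : d i (\sum_j f j) = \sum_j d i (f j).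
Proof. exact: raddf_sum. Qed.

Lemma mderiv_var i j : d i ('X j) = (i == j)%:R :> P.
Proof.
rewrite mderivX mnm1E eq_sym; case: eqVneq => [->|]; last by rewrite scale0r.
rewrite (_ : mnm_sub _ _ = mnm0) ?scale1r ?mpolyX0 //.
by apply/mnmP => k; rewrite mnmBE mnm0E subnn.
Qed.

Lemma mderiv_one i : d i (1 : P) = 0.
Proof. by rewrite -mpolyC1 mderivC. Qed.

Lemma mderiv_nat i k : d i (k%:R : P) = 0.
Proof. by rewrite mderivMn /= mderiv_one mul0rn. Qed.

Lemma mderiv_rho i : d i rho = - 2 * 'X i.
Proof.
have dX2 j : d i ('X j ^+ 2) = 2 * (i == j)%:R * 'X j.
  by rewrite expr2 mderivM mderiv_var; ring.
rewrite mderivB mderiv_one mderiv_sum (eq_bigr _ (fun j _ => dX2 j)).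
rewrite (bigD1 i) //= eqxx mulr1n big1 => [|j /negPf]; first by ring.
by rewrite eq_sym => ->; rewrite mulr0 mul0r.
Qed.

Definition mderiv_simp := (mderivD, mderivB, mderivN, mderivM, mderiv_rho,
  mderiv_var, mderiv_one, mderiv_nat).

Lemma euler_d i p : euler (d i p) = d i (euler p) - d i p.
Proof.
apply/eqP; rewrite eq_sym subr_eq; apply/eqP.
rewrite mderiv_sum /= (eq_bigr (fun j => 'X j * d j (d i p) + (i == j)%:R * d j p)).
  rewrite big_split/=; congr (_ + _); rewrite (bigD1 i) //= eqxx mul1r.
  by rewrite big1 ?addr0 // => j; rewrite eq_sym => /negPf ->; rewrite mul0r.
by move=> j _; rewrite mderivM mderiv_var (mderiv_comm j i); ring.
Qed.

Lemma d_euler i p : d i (euler p) = euler (d i p) + d i p.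
Proof. by rewrite euler_d subrK. Qed.

Lemma eulerD p q : euler (p + q) = euler p + euler q.
Proof. by rewrite -big_split; apply: eq_bigr => i _; rewrite mderivD mulrDr. Qed.

Lemma lapD p q : lap (p + q) = lap p + lap q.
Proof. by rewrite -big_split; apply: eq_bigr => i _; rewrite !mderivD. Qed.

Lemma lapZ a p : lap (a *: p) = a *: lap p.
Proof. by rewrite scaler_sumr; apply: eq_bigr => i _; rewrite !mderivZ. Qed.

Lemma eulerZ a p : euler (a *: p) = a *: euler p.
Proof.
by rewrite scaler_sumr; apply: eq_bigr => i _; rewrite mderivZ -scalerAr.
Qed.

Lemma lap_d i p : lap (d i p) = d i (lap p).
Proof.
rewrite mderiv_sum; apply: eq_bigr => j _.
by rewrite (mderiv_comm i j p) (mderiv_comm i j (d j p)).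
Qed.

Lemma lap_euler p : lap (euler p) = euler (lap p) + 2 * lap p.
Proof.
rewrite {1 3}/lap mulr_sumr (_ : euler (lap p) = \sum_i euler (d i (d i p))).
  rewrite -big_split/=; apply: eq_bigr => i _.
  by rewrite d_euler mderivD d_euler; ring.
rewrite /euler /lap exchange_big; apply: eq_bigr => i _.
by rewrite mderiv_sum mulr_sumr.
Qed.

Lemma lap_rhoM p : lap (rho * p) = rho * lap p - 4 * euler p - (n%:R * 2) * p.
Proof.
rewrite {1}/lap (eq_bigr (fun i => rho * d i (d i p) - 4 * ('X i * d i p) - 2 * p)).
  rewrite !big_split/= !sumrN -!mulr_sumr sumr_const card_ord.
  by rewrite -/(lap p) -/(euler p) -[_ *+ n]mulr_natl; ring.
by move=> i _; rewrite !mderiv_simp eqxx mulr1n; ring.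
Qed.

Lemma eulerX (m : multinom n) : euler (mpolyX R m) = (mdeg m)%:R *: mpolyX R m.
Proof.
rewrite mdegE natr_sum scaler_suml; apply: eq_bigr => i _.
rewrite mderivX -scalerAr; have [->|mi] := eqVneq (m i) 0%N.
  by rewrite !scale0r.
rewrite -mpolyXD addmC submK //; apply/mnm_lepP => l; rewrite mnm1E.
by case: eqP => //= <-; rewrite lt0n.
Qed.

(** The Euler operator multiplies a monomial by its degree, so it is invertible
    up to constants. *)
Lemma euler_inverse p : exists a u, p = mpolyC n a + euler u.
Proof.
elim/mpolyind: p => [|c m p _ _ [a [u ->]]].
  by exists 0, 0; by rewrite raddf0 add0r -(scale0r 0) eulerZ !scale0r.
have [m0|m0] := eqVneq (mdeg m) 0%N.
  move/eqP: m0; rewrite mdeg_eq0 => /eqP ->.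
  exists (c + a), u; rewrite mpolyX0 mpolyCD addrA; congr (_ + _ + _).
  by rewrite -mul_mpolyC mulr1.
exists a, ((c / (mdeg m)%:R) *: mpolyX R m + u).
by rewrite eulerD eulerZ eulerX scalerA divfK ?pnatr_eq0 // addrCA.
Qed.

Lemma mcoeff_euler (m : multinom n) p : mcoeff m (euler p) = (mdeg m)%:R * mcoeff m p.
Proof.
elim/mpolyind: p => [|c k p _ _ IH].
  by rewrite -(scale0r 0) eulerZ !scale0r mcoeff0 mulr0.
rewrite eulerD eulerZ eulerX !mcoeffD IH !mcoeffZ !mcoeffX mulrDr.
by case: eqVneq => [->|_]; rewrite ?mulr0 ?mulr1 // mulrC.
Qed.

(** On monomials of degree k the map is multiplication by k + 2. *)
Lemma euler2_inj p : euler p + 2 * p = 0 -> p = 0.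
Proof.
move=> /mpolyP E; apply/mpolyP => m; have := E m.
rewrite mcoeffD mulr_natl mcoeffMn mcoeff_euler mcoeff0 -[_ *+ 2]mulr_natl -mulrDl.
by move/eqP; rewrite mulf_eq0 -natrD pnatr_eq0 addn2 /= => /eqP.
Qed.

Lemma euler0 : euler 0 = 0.
Proof. by have := eulerZ 0 0; rewrite !scale0r. Qed.

Lemma lapC a : lap (mpolyC n a) = 0.
Proof. by rewrite /lap big1 // => i _; rewrite mderivC mderiv0. Qed.

Lemma meval_sum (J : finType) (f : J -> P) (x : 'I_n -> R) :
  meval x (\sum_j f j) = \sum_j meval x (f j).
Proof. exact: raddf_sum. Qed.

Lemma meval_rho (x : 'I_n -> R) : meval x rho = 1 - \sum_i x i ^+ 2.
Proof.
rewrite mevalB meval1 meval_sum; congr (_ - _); apply: eq_bigr => i _.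
by rewrite !expr2 mevalM mevalXU.
Qed.

Lemma rho_neq0 : rho != 0.
Proof.
apply: contra_eq_neq (meval_rho (fun=> 0)) => ->.
rewrite meval0 big1 ?subr0 1?eq_sym ?oner_eq0 // => i _.
by rewrite expr0n.
Qed.

(** I stands for integration over the unit ball.  All that the algebra needs is
    that I is positive definite and kills the derivatives of multiples of rho,
    which is the divergence theorem for functions vanishing on the sphere. *)
Section functional.
Variable I : {linear P -> R^o}.
Hypothesis I_sqr_ge0 : forall p, 0 <= I (p * p).
Hypothesis I_sqr_eq0 : forall p, I (p * p) = 0 -> p = 0.
Hypothesis I_mderiv_rho : forall i p, I (d i (rho * p)) = 0.
Hypothesis n_ge2 : (2 <= n)%N.

(** All integrations by parts below are instances of this lemma: their content
    is the field v, the rest is a polynomial identity. *)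
Lemma I_div v p q : q - p = \sum_i d i (rho * v i) -> I p = I q.
Proof.
move=> E; apply/esym/eqP; rewrite -subr_eq0 -linearB /= E linear_sum /=.
by rewrite big1.
Qed.

Lemma I_natmul k p : I (k%:R * p) = k%:R * I p.
Proof. by rewrite mulr_natl raddfMn /= mulr_natl. Qed.

(** The field is y grad u; its multiple by rho has divergence
    rho grad u . grad y - 2 y Eu when u is harmonic. *)
Lemma I_euler u y : lap u = 0 -> 2 * I (euler u * y) = I (rho * grad2 u y).
Proof.
move=> u0; rewrite -I_natmul; apply: (I_div (v := fun i => y * d i u)).
transitivity (rho * grad2 u y - 2 * (euler u * y) + rho * y * lap u).
  by rewrite u0 mulr0 addr0.
rewrite /lap /grad2 /euler !mulr_suml !mulr_sumr -sumrB -big_split /=.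
by apply: eq_bigr => i _; rewrite !mderiv_simp; ring.
Qed.

(** The same identity one order higher, with the field rho z grad z. *)
Lemma I_rho_euler z : lap z = 0 ->
  4 * I (rho * z * euler z) = \sum_i I ((rho * d i z) * (rho * d i z)).
Proof.
move=> z0; rewrite -I_natmul -linear_sum /=.
apply: (I_div (v := fun i => rho * (z * d i z))).
transitivity (\sum_i rho * d i z * (rho * d i z) - 4 * (rho * z * euler z) +
  rho * rho * z * lap z); first by rewrite z0 mulr0 addr0.
rewrite /lap /euler !mulr_sumr -sumrB -big_split /=.
by apply: eq_bigr => i _; rewrite !mderiv_simp; ring.
Qed.

(** By [I_euler], twice the difference is the integral of rho times the sum of
    the z_i (E z_i) over the derivatives z_i of u, as d_i (E u - u) = E z_i.
    Each z_i is harmonic, so [I_rho_euler] turns every term into a sum of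
    squares. *)
Lemma I_euler_ge u : lap u = 0 -> I (u * euler u) <= I (euler u * euler u).
Proof.
move=> u0; rewrite -subr_ge0 -linearB /= -mulrBl mulrC.
rewrite -(pmulr_rge0 _ (ltr0n _ 2)) I_euler // /grad2 mulr_sumr linear_sum /=.
apply: sumr_ge0 => i _; rewrite mderivB -euler_d mulrA.
rewrite -(pmulr_rge0 _ (ltr0n _ 4)) I_rho_euler ?lap_d ?u0 ?mderiv0 //.
by apply: sumr_ge0.
Qed.

(** Both boundary terms vanish because rho^2 p vanishes on the sphere together
    with its gradient. *)
Lemma I_green p q : I (lap (rho * rho * p) * q) = I (rho * rho * p * lap q).
Proof.
apply/esym; apply: (I_div (v := fun i =>
  q * (- 4 * 'X i * p + rho * d i p) - rho * p * d i q)).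
rewrite /lap mulr_suml mulr_sumr -sumrB; apply: eq_bigr => i _.
by rewrite !mderiv_simp eqxx mulr1n; ring.
Qed.

Lemma I_grad p q : \sum_i I (d i (rho * p) * d i q) = - I (rho * p * lap q).
Proof.
rewrite -linear_sum -linearN /=; apply/esym.
apply: (I_div (v := fun i => p * d i q)).
rewrite opprK /lap mulr_sumr -big_split; apply: eq_bigr => i _ /=.
by rewrite !mderiv_simp; ring.
Qed.

(** Integrate the divergence of (rho p)^2 x. *)
Lemma I_poincare p :
  n%:R * I ((rho * p) * (rho * p)) = - 2 * I (rho * p * euler (rho * p)).
Proof.
rewrite mulNr -!I_natmul -linearN /=; apply/esym.
apply: (I_div (v := fun i => 'X i * (rho * p * p))).
rewrite opprK -[n in n%:R]card_ord -sumr_const mulr_suml /euler !mulr_sumr -big_split.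
by apply: eq_bigr => i _ /=; rewrite !mderiv_simp eqxx mulr1n; ring.
Qed.

(** Uniqueness for the clamped plate: with phi = rho^2 p, Green's formula gives
    |Lap phi|^2 = (phi, Lap (Lap phi)) = 0; then the gradient of phi vanishes,
    and so does phi by [I_poincare]. *)
Lemma bilaplacian_inj p : lap (lap (rho * rho * p)) = 0 -> p = 0.
Proof.
set phi := rho * rho * p => L0.
have l0 : lap phi = 0.
  by apply: I_sqr_eq0; rewrite I_green L0 mulr0 linear0.
have d0 i : d i phi = 0.
  apply: I_sqr_eq0; have : \sum_i I (d i phi * d i phi) = 0.
    by rewrite {1}/phi -mulrA I_grad l0 mulr0 linear0 oppr0.
  by move/psumr_eq0P => /(_ (fun i _ => I_sqr_ge0 _)) ->.
have e0 : euler phi = 0 by rewrite /euler big1 // => i _; rewrite d0 mulr0.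
have : phi = 0.
  apply: I_sqr_eq0; have := I_poincare (rho * p).
  have -> : rho * (rho * p) = phi by rewrite mulrA.
  rewrite e0 mulr0.
  rewrite linear0 mulr0 => /eqP; rewrite mulf_eq0 pnatr_eq0 => /orP[/eqP n0|/eqP//].
  by have := n_ge2; rewrite [X in (_ <= X)%N]n0.
by move=> /eqP; rewrite !mulf_eq0 (negPf rho_neq0) /= => /eqP.
Qed.

Local Notation msize := (mmeasure (@mdeg n)).

Lemma msize_d i p : (msize (d i p) <= (msize p).-1)%N.
Proof.
rewrite [X in (X <= _)%N]msizeE; apply/bigmax_leqP_seq => m.
rewrite mcoeff_msupp mcoeff_deriv => mp _.
have : mnm_add m (mnm1 i) \in msupp p.
  by rewrite mcoeff_msupp; apply: contraNneq mp => ->; rewrite mul0rn.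
by move/msize_mdeg_lt; rewrite mdegD mdeg1 addn1; case: (msize p).
Qed.

Lemma msize_lap p : (msize (lap p) <= (msize p).-2)%N.
Proof.
apply: leq_trans (mmeasure_sum _ _ _ _) _; apply/bigmax_leqP => i _.
apply: leq_trans (msize_d _ _) _; rewrite -!subn1 leq_sub2r //.
by have := msize_d i p; rewrite -subn1.
Qed.

Lemma msize_rho : (msize rho <= 3)%N.
Proof.
apply: leq_trans (mmeasureD_le _ _ _) _; rewrite msize1 mmeasureN geq_max /=.
apply: leq_trans (mmeasure_sum _ _ _ _) _; apply/bigmax_leqP => i _.
by rewrite expr2 -mpolyXD msizeX mdegD mdeg1.
Qed.

(** rho^2 raises the degree by 4 and the two Laplacians lower it by 4. *)
Lemma msize_bilaplacian p : (msize (lap (lap (rho * rho * p)%R)) <= msize p)%N.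
Proof.
apply: leq_trans (msize_lap _) _.
have h : (msize (lap (rho * rho * p)%R) <= (msize (rho * rho * p)%R).-2)%N.
  exact: msize_lap.
have [->|p0] := eqVneq p 0.
  by have := lapZ 0 0; rewrite mulr0 !scale0r => l0; rewrite !l0 mmeasure0.
have r0 := rho_neq0; have r3 := msize_rho.
have r1 : (0 < msize rho)%N by rewrite lt0n mmeasure_poly_eq0.
have : (msize (rho * rho * p)%R <= (msize rho + msize rho + msize p).-2)%N.
  rewrite !msizeM ?mulf_neq0 //.
  by move: r1; move: (msize rho) (msize p) => a b; lia.
by move: h r3; do 4![move: (mmeasure _ _)] => a b c e; lia.
Qed.

(** Solve Lap (Lap (rho^2 p)) = Lap f: on polynomials of bounded degree an
    injective endomorphism is onto. *)
Lemma laplacian_decomposition f :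
  exists p, lap (f - lap (rho * rho * p)) = 0.
Proof.
have G_lin : linear (fun p : P => lap (lap (rho * rho * p))).
  by move=> a p q; rewrite mulrDr -scalerAr !lapD !lapZ.
pose G : {linear P -> P} := HB.pack (fun p : P => lap (lap (rho * rho * p)))
  (GRing.isLinear.Build _ _ _ _ _ G_lin).
pose k := msize (lap f).
pose e (m : bmultinom n k) : P := mpolyX R m.
have Vp p : (msize p <= k)%N -> exists c : _ -> R, p = \sum_m c m *: e m.
  by move=> pk; exists (fun m : bmultinom n k => mcoeff m p); exact: mpolywE.
have Vm p : (exists c : _ -> R, p = \sum_m c m *: e m) -> (msize p <= k)%N.
  move=> [c ->]; apply: leq_trans (mmeasure_sum _ _ _ _) _.
  apply/bigmax_leqP => m _; apply: leq_trans (mmeasureZ_le _ _ _) _.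
  by rewrite mmeasureX; exact: (bmdeg m).
have [p _ Gp] : exists2 p, (exists c : _ -> R, p = \sum_m c m *: e m) & G p = lap f.
  apply: injective_finite_surjective; last exact: Vp.
    by move=> p /Vm pk; apply: Vp; exact: leq_trans (msize_bilaplacian _) pk.
  by move=> p _; exact: bilaplacian_inj.
exists p; rewrite -scaleN1r lapD lapZ scaleN1r.
by move: Gp => /= ->; rewrite subrr.
Qed.

(** Write h = a + E u.  Since Lap (E u) = (E + 2) (Lap u), harmonicity of h
    passes to u; and E u has mean zero, which forces a = 0. *)
Lemma harmonic_potential h : lap h = 0 -> I h = 0 ->
  exists2 u, lap u = 0 & h = euler u.
Proof.
move=> h0 Ih; have [a [u hE]] := euler_inverse h.
have u0 : lap u = 0.
  by apply: euler2_inj; rewrite -lap_euler -h0 hE lapD lapC add0r.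
exists u => //; suff -> : h = mpolyC n 0 + euler u by rewrite raddf0 add0r.
rewrite {1}hE; congr (mpolyC n _ + _); apply: contra_eq Ih => a0.
have -> : I h = a * I 1.
  have : 2 * I (euler u * 1) = 0.
    rewrite I_euler // /grad2 big1 ?mulr0 ?linear0 // => i _.
    by rewrite mderiv_one mulr0.
  move/eqP; rewrite mulf_eq0 pnatr_eq0 mulr1 => /eqP Iu.
  by rewrite hE linearD /= Iu addr0 -[mpolyC n a]mulr1 mul_mpolyC linearZ.
rewrite mulf_neq0 //; apply/eqP => I1.
by have := @I_sqr_eq0 1; rewrite mulr1 => /(_ I1)/eqP; rewrite oner_eq0.
Qed.

(** With phi = rho^2 p the solution is grad phi - rho grad w.  Each component has
    Laplacian d_i K for the single polynomial K below, so that Green's formula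
    collapses the energy to (f, K); expanding f and K leaves only the harmonic
    inequality [I_euler_ge]. *)
Lemma polynomial_bogovskii f : I f = 0 ->
  exists v : 'I_n -> P, \sum_i d i (rho * v i) = f /\
    \sum_i \sum_j I (d j (rho * v i) * d j (rho * v i)) <= n%:R * I (f * f).
Proof.
move=> If; have [p hp] := laplacian_decomposition f.
set phi := rho * rho * p in hp *; set h := f - lap phi in hp *.
have Ilap : I (lap phi) = 0.
  by have := I_green p 1; rewrite mulr1 -mpolyC1 lapC mulr0 linear0.
have [|u u0 hE] := @harmonic_potential h hp.
  by rewrite linearB /= If Ilap subrr.
(* The potential is halved: div (- rho grad w) = 2 E w for w harmonic. *)
have w0 : lap (2^-1 *: u) = 0 by rewrite lapZ u0 scaler0.
move: hE; rewrite -[u](scalerKV (a := 2)) ?pnatr_eq0 // eulerZ.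
move: (2^-1 *: u) w0 => w w0 {u u0} hE.
have fE : f = lap phi + 2 * euler w.
  by rewrite -[LHS](subrK (lap phi)) -/h hE scaler_nat mulr_natl addrC.
(* v is the quotient of grad (rho^2 p) - rho grad w by rho. *)
pose v i := - 4 * 'X i * p + rho * d i p - d i w.
have vE i : rho * v i = d i phi - rho * d i w by rewrite /v /phi !mderiv_simp; ring.
have divE : \sum_i d i (rho * v i) = f.
  transitivity (lap phi + 2 * euler w - rho * lap w).
    rewrite /lap /euler !mulr_sumr -big_split -sumrB /=.
    by apply: eq_bigr => i _; rewrite vE !mderiv_simp; ring.
  by rewrite w0 mulr0 subr0 fE.
exists v; split => //.
pose K := lap phi + 4 * euler w + (2 * n%:R - 4) * w.
have lapE i : lap (rho * v i) = d i K.
  have -> : lap (rho * v i) = d i (lap phi) - lap (rho * d i w).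
    by rewrite vE -scaleN1r lapD lapZ scaleN1r lap_d.
  rewrite lap_rhoM lap_d w0 mderiv0 euler_d /K !mderiv_simp.
  by ring.
have -> : \sum_i \sum_j I (d j (rho * v i) * d j (rho * v i)) = I (f * K).
  under eq_bigr do rewrite I_grad lapE.
  rewrite -divE mulr_suml sumrN -linear_sum -linearN /=.
  apply: (I_div (v := fun i => v i * K)).
  rewrite opprK -big_split /=; apply: eq_bigr => i _.
  by rewrite [in RHS]mulrA [in RHS]mderivM.
have green q : lap q = 0 -> I (lap phi * q) = 0.
  by move=> q0; rewrite I_green q0 mulr0 linear0.
have gE : I (lap phi * euler w) = 0.
  by apply: green; rewrite lap_euler w0 euler0 mulr0 addr0.
have -> : I (f * K) = I (lap phi * lap phi) + 8 * I (euler w * euler w) +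
    (4 * n%:R - 8) * I (w * euler w).
  transitivity (I (lap phi * lap phi + 8%:R * (euler w * euler w) +
    4%:R * (n%:R * (w * euler w)) - 8%:R * (w * euler w) +
    6%:R * (lap phi * euler w) +
    2%:R * (n%:R * (lap phi * w)) - 4%:R * (lap phi * w))).
    by congr (I _); rewrite fE /K; ring.
  rewrite !(linearD, linearN) /= !I_natmul gE (green w) //.
  by ring.
have -> : I (f * f) = I (lap phi * lap phi) + 4 * I (euler w * euler w).
  transitivity (I (lap phi * lap phi + 4%:R * (euler w * euler w) +
    4%:R * (lap phi * euler w))).
    by congr (I _); rewrite fE; ring.
  rewrite !(linearD, linearN) /= !I_natmul gE.
  by ring.
have := I_euler_ge w0; have := I_sqr_ge0 (lap phi).
have : 2 <= n%:R :> R by rewrite ler_nat.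
move: (I _) (I _) (I _) => A B C n2 A0 BC.
by nra.
Qed.

End functional.

End harmonic_decomposition.

(** * Square-integrable functions *)

(** The product ip f g has its expected meaning only when f and g are
    square-integrable.  Functions are not quotiented by almost everywhere
    equality, so that equality in L^2 is expressed by a vanishing ip. *)
Section square_integrable.
Context d (T : measurableType d) (R : realType) (mu : {measure set T -> \bar R}).
Context (D : set T) (mD : measurable D).
Implicit Types (f g h : T -> R).

Definition sqint f :=
  measurable_fun D f /\ (\int[mu]_(x in D) (f x ^+ 2)%:E < +oo)%E.

Definition ip f g := \int[mu]_(x in D) (f x * g x).

Lemma sqint_integrable2 f : sqint f -> mu.-integrable D (EFin \o (fun x => f x ^+ 2)).
Proof.
move=> [mf ?]; apply/integrableP; split.
  by apply/measurable_EFinP; exact: measurable_funX.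
by under eq_integral => x _ do rewrite /= ger0_norm ?sqr_ge0//.
Qed.

Lemma sqintM f g : sqint f -> sqint g -> mu.-integrable D (EFin \o (fun x => f x * g x)).
Proof.
move=> f2 g2; have [mf _] := f2; have [mg _] := g2.
apply: (le_integrable mD) (integrableD mD (sqint_integrable2 f2) (sqint_integrable2 g2)).
  by apply/measurable_EFinP; exact: measurable_funM.
move=> x _; rewrite /= lee_fin [leRHS]ger0_norm ?addr_ge0 ?sqr_ge0 // normrM.
rewrite -(real_normK (num_real (f x))) -(real_normK (num_real (g x))).
by have := normr_ge0 (f x); have := normr_ge0 (g x); nra.
Qed.

Lemma integrable_sqint f :
  measurable_fun D f -> mu.-integrable D (EFin \o (fun x => f x * f x)) -> sqint f.
Proof.
move=> mf /integrableP[_ fo]; split => //; apply: le_lt_trans fo.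
by under [leRHS]eq_integral => x _ do rewrite /= ger0_norm -?expr2 ?sqr_ge0//.
Qed.

Lemma sqint_le f g : measurable_fun D f -> (forall x, D x -> `|f x| <= `|g x|) ->
  sqint g -> sqint f.
Proof.
move=> mf fg [mg ig]; split => //; apply: le_lt_trans ig.
apply: ge0_le_integral => //.
- by move=> x _; rewrite lee_fin sqr_ge0.
- by apply/measurable_EFinP; exact: measurable_funX.
- by apply/measurable_EFinP; exact: measurable_funX.
move=> x Dx; rewrite lee_fin -(real_normK (num_real (f x))).
by rewrite -(real_normK (num_real (g x))) lerXn2r ?nnegrE // fg.
Qed.

Lemma sqint_ext f g : (forall x, D x -> f x = g x) -> sqint f -> sqint g.
Proof.
move=> fg [mf ff]; split.
  by apply: eq_measurable_fun mf => x /set_mem; exact: fg.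
by rewrite (eq_integral (fun x => (f x ^+ 2)%:E)) // => x /set_mem /fg ->.
Qed.

Lemma sqintD f g : sqint f -> sqint g -> sqint (fun x => f x + g x).
Proof.
move=> f2 g2; have [mf _] := f2; have [mg _] := g2.
apply: integrable_sqint; first exact: measurable_funD.
have -> : EFin \o (fun x => (f x + g x) * (f x + g x)) =
   ((EFin \o (fun x => f x ^+ 2)%R) \+ (EFin \o (fun x => g x ^+ 2)%R)) \+
   (fun x => 2%:E * (EFin \o (fun x => f x * g x)%R) x)%E.
  by apply/funext => x /=; congr EFin; ring.
apply: integrableD => //; last by apply: integrableZl => //; exact: sqintM.
by apply: integrableD => //; exact: sqint_integrable2.
Qed.

Lemma sqintZ a f : sqint f -> sqint (fun x => a * f x).
Proof.
move=> f2; have [mf _] := f2; apply: integrable_sqint.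
  exact: measurable_funM.
have -> : EFin \o (fun x => a * f x * (a * f x)) =
   (fun x => (a ^+ 2)%:E * (EFin \o (fun x => f x ^+ 2)%R) x)%E.
  by apply/funext => x /=; congr EFin; ring.
by apply: integrableZl => //; exact: sqint_integrable2.
Qed.

Lemma sqintB f g : sqint f -> sqint g -> sqint (fun x => f x - g x).
Proof.
move=> f2 g2; apply: (sqint_ext (f := fun x => f x + -1 * g x)).
  by move=> x _; rewrite mulN1r.
by apply: sqintD => //; exact: sqintZ.
Qed.

Lemma sqint0 : sqint (fun=> 0).
Proof.
split; first exact: measurable_cst.
by under eq_integral => x _ do rewrite expr0n/=; rewrite integral0.
Qed.

Lemma sqint_sum (I : Type) (s : seq I) (F : I -> T -> R) :
  (forall i, sqint (F i)) -> sqint (fun x => \sum_(i <- s) F i x).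
Proof.
move=> F2; elim: s => [|i s IH].
  by apply: sqint_ext sqint0 => x _; rewrite big_nil.
apply: (sqint_ext (f := fun x => F i x + \sum_(j <- s) F j x)).
  by move=> x _; rewrite big_cons.
exact: sqintD.
Qed.

Lemma sqint_bounded M f : (mu D < +oo)%E -> measurable_fun D f ->
  (forall x, D x -> `|f x| <= M) -> sqint f.
Proof.
move=> Doo mf fM; apply: integrable_sqint => //.
apply: measurable_bounded_integrable => //; first exact: measurable_funM.
exists (M * M); split; first by rewrite num_real.
move=> y My x Dx; rewrite /= normrM; apply: le_trans (ltW My).
by apply: ler_pM => //; exact: fM.
Qed.

Lemma sqint_cst a : (mu D < +oo)%E -> sqint (fun=> a).
Proof. by move=> Doo; exact: (sqint_bounded (M := `|a|)). Qed.

Lemma sqint_integrable f : (mu D < +oo)%E -> sqint f -> mu.-integrable D (EFin \o f).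
Proof.
move=> Doo f2; have := sqintM f2 (sqint_cst 1 Doo).
by under [X in EFin \o X]eq_fun do rewrite mulr1.
Qed.

Lemma sqint_ipE f : sqint f -> (\int[mu]_(x in D) (f x ^+ 2)%:E = (ip f f)%:E)%E.
Proof.
move=> f2; rewrite /ip /Rintegral fineK; first by apply: eq_integral => x _; rewrite expr2.
exact/(integrable_fin_num mD)/sqintM.
Qed.

Lemma ipC f g : ip f g = ip g f.
Proof. by apply: eq_Rintegral => x _; rewrite mulrC. Qed.

Lemma eq_ip f f' g g' : (forall x, D x -> f x = f' x) ->
  (forall x, D x -> g x = g' x) -> ip f g = ip f' g'.
Proof. by move=> ff gg; apply: eq_Rintegral => x /set_mem Dx; rewrite ff ?gg. Qed.

Lemma ipDl f g h : sqint f -> sqint g -> sqint h ->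
  ip (fun x => f x + g x) h = ip f h + ip g h.
Proof.
move=> f2 g2 h2; rewrite /ip -RintegralD //; try exact: sqintM.
by apply: eq_Rintegral => x _; rewrite mulrDl.
Qed.

Lemma ipZl a f h : sqint f -> sqint h -> ip (fun x => a * f x) h = a * ip f h.
Proof.
move=> f2 h2; rewrite /ip -RintegralZl //; try exact: sqintM.
by apply: eq_Rintegral => x _; rewrite mulrA.
Qed.

Lemma ipBl f g h : sqint f -> sqint g -> sqint h ->
  ip (fun x => f x - g x) h = ip f h - ip g h.
Proof.
move=> f2 g2 h2; rewrite /ip -RintegralB //; try exact: sqintM.
by apply: eq_Rintegral => x _; rewrite mulrBl.
Qed.

Lemma ipDr f g h : sqint f -> sqint g -> sqint h ->
  ip h (fun x => f x + g x) = ip h f + ip h g.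
Proof. by move=> *; rewrite ipC ipDl // !(ipC h). Qed.

Lemma ipBr f g h : sqint f -> sqint g -> sqint h ->
  ip h (fun x => f x - g x) = ip h f - ip h g.
Proof. by move=> *; rewrite ipC ipBl // !(ipC h). Qed.

Lemma ipZr a f h : sqint f -> sqint h -> ip h (fun x => a * f x) = a * ip h f.
Proof. by move=> *; rewrite ipC ipZl // ipC. Qed.

Lemma ip0l h : ip (fun=> 0) h = 0.
Proof.
rewrite /ip; under eq_Rintegral do rewrite mul0r.
by rewrite Rintegral_cst // mul0r.
Qed.

Lemma ip_suml (I : Type) (s : seq I) (F : I -> T -> R) h :
  (forall i, sqint (F i)) -> sqint h ->
  ip (fun x => \sum_(i <- s) F i x) h = \sum_(i <- s) ip (F i) h.
Proof.
move=> F2 h2; elim: s => [|i s IH].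
  by rewrite big_nil -[RHS](ip0l h); apply: eq_ip => // x _; rewrite big_nil.
rewrite big_cons -IH -ipDl //; last exact: sqint_sum.
by apply: eq_ip => // x _; rewrite big_cons.
Qed.

Lemma ip_sumr (I : Type) (s : seq I) (F : I -> T -> R) h :
  (forall i, sqint (F i)) -> sqint h ->
  ip h (fun x => \sum_(i <- s) F i x) = \sum_(i <- s) ip h (F i).
Proof. by move=> *; rewrite ipC ip_suml //; apply: eq_bigr => i _; rewrite ipC. Qed.

Lemma ip_ge0 f : 0 <= ip f f.
Proof. by apply: Rintegral_ge0 => x _; rewrite -expr2 sqr_ge0. Qed.

Lemma cauchy_schwarz f g : sqint f -> sqint g -> ip f g ^+ 2 <= ip f f * ip g g.
Proof.
move=> f2 g2.
have q t : 0 <= ip f f + 2 * t * ip f g + t ^+ 2 * ip g g.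
  have tg2 := sqintZ t g2; have := ip_ge0 (fun x => f x + t * g x).
  rewrite ipDl ?ipDr ?ipZl ?ipZr //; try exact: sqintD.
  by rewrite (ipC g f) => /le_trans; apply; rewrite le_eqVlt; apply/orP; left; apply/eqP; ring.
have := ip_ge0 f; have := ip_ge0 g.
move: (ip f f) (ip g g) (ip f g) q => a b c q b0 a0.
have [b00|bn0] := eqVneq b 0.
  rewrite b00 mulr0 in q *; have [->|c0] := eqVneq c 0; first by rewrite expr0n.
  have := q (- (a + 1) / (2 * c)).
  have -> : a + 2 * (- (a + 1) / (2 * c)) * c + (- (a + 1) / (2 * c)) ^+ 2 * 0 = - 1.
    by field.
  by rewrite oppr_ge0 ler10.
have bp : 0 < b by rewrite lt_def bn0.
have := q (- c / b).
have -> : a + 2 * (- c / b) * c + (- c / b) ^+ 2 * b = (a * b - c ^+ 2) / b by field.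
by rewrite pmulr_lge0 ?invr_gt0 // subr_ge0.
Qed.

Lemma ip_eq0_ae f : sqint f -> ip f f = 0 -> {ae mu, forall x, D x -> f x = 0}.
Proof.
move=> f2 f0; have [mf _] := f2.
have : (\int[mu]_(x in D) `|(f x ^+ 2)%:E| = 0)%E.
  under eq_integral => x _ do rewrite gee0_abs ?lee_fin ?sqr_ge0//.
  by rewrite sqint_ipE // f0.
move/ae_eq_integral_abs => /(_ mD) h.
have : ae_eq mu D (fun x => (f x ^+ 2)%:E) (cst 0).
  by apply: h; apply/measurable_EFinP; exact: measurable_funX.
by apply: filterS => x /= hx /hx [] /eqP; rewrite sqrf_eq0 => /eqP.
Qed.

Lemma ip_sqrDle f g : sqint f -> sqint g ->
  ip (fun x => f x + g x) (fun x => f x + g x) <= 2 * ip f f + 2 * ip g g.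
Proof.
move=> f2 g2; have := ip_ge0 (fun x => f x - g x).
rewrite ipBl ?ipBr // ?ipDl ?ipDr // ?(ipC g f); try exact: sqintB; try exact: sqintD.
lra.
Qed.

Lemma sum_sqint_ipE (I : finType) (F : I -> T -> R) : (forall i, sqint (F i)) ->
  (\int[mu]_(x in D) (\sum_i F i x ^+ 2)%:E = (\sum_i ip (F i) (F i))%:E)%E.
Proof.
move=> F2; under eq_integral do rewrite -sumEFin.
rewrite ge0_integral_sum //; first by rewrite -sumEFin; apply: eq_bigr => i _; exact: sqint_ipE.
- by move=> i; have [mF _] := F2 i; apply/measurable_EFinP; exact: measurable_funX.
- by move=> i x _; rewrite lee_fin sqr_ge0.
Qed.

Lemma ae_eq_ip f g h : sqint f -> sqint g -> sqint h ->
  {ae mu, forall x, D x -> f x = g x} -> ip f h = ip g h.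
Proof.
move=> [mf _] [mg _] [mh _] fg; rewrite /ip /Rintegral; congr fine.
apply: ae_eq_integral => //.
- by apply/measurable_EFinP; exact: measurable_funM.
- by apply/measurable_EFinP; exact: measurable_funM.
- by apply: filterS fg => x fg /fg /= ->.
Qed.

Lemma Rintegral_sum_ip (I : finType) (F G : I -> T -> R) :
  (forall i, sqint (F i)) -> (forall i, sqint (G i)) ->
  \int[mu]_(x in D) (\sum_i F i x * G i x) = \sum_i ip (F i) (G i).
Proof.
move=> F2 G2.
suff : forall s : seq I, mu.-integrable D (EFin \o (fun x => \sum_(i <- s) F i x * G i x)) /\
    \int[mu]_(x in D) (\sum_(i <- s) F i x * G i x) = \sum_(i <- s) ip (F i) (G i).
  by move=> /(_ (index_enum _))[].
elim=> [|i s [IHi IH]].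
  rewrite big_nil; have -> : (fun x => \sum_(i <- [::]) F i x * G i x) = fun=> 0.
    by apply/funext => x; rewrite big_nil.
  split; last by rewrite -[RHS](ip0l (fun=> 0)); apply: eq_Rintegral => x _; rewrite mul0r.
  exact: integrable0.
have -> : (fun x => \sum_(j <- i :: s) F j x * G j x) =
    (fun x => F i x * G i x + \sum_(j <- s) F j x * G j x).
  by apply/funext => x; rewrite big_cons.
have FG := sqintM (F2 i) (G2 i).
rewrite big_cons RintegralD // IH; split => //.
exact: (integrableD mD FG IHi).
Qed.

Definition sqcvg (fn : (T -> R)^nat) f :=
  ip (fun x => fn m x - f x) (fun x => fn m x - f x) @[m --> \oo] --> (0 : R).

Lemma sqcvgE (fn : (T -> R)^nat) f : (forall m, sqint (fn m)) -> sqint f ->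
  sqcvg fn f <->
  (\int[mu]_(x in D) ((fn m x - f x) ^+ 2)%:E @[m --> \oo] --> 0)%E.
Proof.
move=> fn2 f2.
have -> : (fun m => \int[mu]_(x in D) ((fn m x - f x) ^+ 2)%:E)%E =
    EFin \o (fun m => ip (fun x => fn m x - f x) (fun x => fn m x - f x)).
  by apply/funext => m; rewrite /= -sqint_ipE //; exact: sqintB.
by split => [h|/fine_cvg//]; apply: cvg_EFin => //; exact: nearW.
Qed.

Lemma ip_cvg (fn : (T -> R)^nat) f g : (forall m, sqint (fn m)) -> sqint f -> sqint g ->
  sqcvg fn f -> ip (fn m) g @[m --> \oo] --> ip f g.
Proof.
move=> fn2 f2 g2 fnf; apply/cvgrPdistC_lt => /= e e0.
pose G := ip g g + 1.
have G0 : 0 < G by rewrite ltr_wpDl // ip_ge0.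
have e2G : 0 < e ^+ 2 / G by rewrite divr_gt0 ?exprn_gt0.
move/cvgr0Pnorm_lt : fnf => /(_ _ e2G); apply: filterS => m.
rewrite ger0_norm ?ip_ge0 // ltr_pdivlMr // => hm.
rewrite -ipBl // -ltr_sqr ?nnegrE ?(ltW e0) // real_normK ?num_real //.
apply: le_lt_trans hm; apply: le_trans (cauchy_schwarz _ g2) _; first exact: sqintB.
by rewrite ler_wpM2l ?ip_ge0 // lerDl.
Qed.

Lemma sqcvgD (fn gn : (T -> R)^nat) f g : (forall m, sqint (fn m)) ->
  (forall m, sqint (gn m)) -> sqint f -> sqint g ->
  sqcvg fn f -> sqcvg gn g ->
  sqcvg (fun m x => fn m x + gn m x) (fun x => f x + g x).
Proof.
move=> fn2 gn2 f2 g2 fnf gng; rewrite /sqcvg.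
have : 2 * ip (fun x => fn m x - f x) (fun x => fn m x - f x) +
   2 * ip (fun x => gn m x - g x) (fun x => gn m x - g x) @[m --> \oo] --> 2 * (0:R) + 2 * 0.
  by apply: cvgD; apply: cvgMl_tmp; [exact: fnf|exact: gng].
rewrite !mulr0 addr0; apply: squeeze_cvgr (cvg_cst 0).
near=> m; rewrite ip_ge0 /=.
apply: le_trans (ip_sqrDle (sqintB (fn2 m) f2) (sqintB (gn2 m) g2)).
rewrite le_eqVlt; apply/orP; left; apply/eqP; apply: eq_ip => x _; ring.
Unshelve. all: by end_near. Qed.

Lemma sqcvg_cst f : sqcvg (fun=> f) f.
Proof.
rewrite /sqcvg (_ : (fun _ : nat => _) = fun=> 0); first exact: cvg_cst.
apply/funext => _; rewrite -[RHS](ip0l (fun=> 0)).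
by apply: eq_ip => x _; rewrite subrr.
Qed.

Lemma sqcvg_dominated_ae (fn : (T -> R)^nat) f g :
  (forall m, measurable_fun D (fn m)) -> measurable_fun D f -> sqint g ->
  {ae mu, forall x, D x -> fn m x @[m --> \oo] --> f x} ->
  {ae mu, forall x, forall m, D x -> `|fn m x - f x| <= `|g x|} -> sqcvg fn f.
Proof.
move=> mfn mf g2 fnf fng.
have [] : [/\ mu.-integrable D (cst 0%E : T -> \bar R),
    (\int[mu]_(x in D) `|((fn m x - f x) ^+ 2)%:E - cst 0%E x| @[m --> \oo] --> 0)%E &
    (\int[mu]_(x in D) ((fn m x - f x) ^+ 2)%:E @[m --> \oo] -->
       \int[mu]_(x in D) cst 0%E x)%E]; last move=> _ _.
apply: (dominated_convergence mD (g := fun x => (g x ^+ 2)%:E)).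
- by move=> m; apply/measurable_EFinP; apply: measurable_funX; exact: measurable_funB.
- exact: measurable_cst.
- apply: filterS fnf => x fnf Dx; apply: cvg_EFin; first exact: nearW.
  rewrite [X in _ --> X](_ : _ = (f x - f x) ^+ 2); last by rewrite subrr expr0n.
  rewrite expr2; under [X in X @ _]eq_fun do rewrite /= expr2.
  by apply: cvgM; apply: cvgB; [exact: fnf|exact: cvg_cst|exact: fnf|exact: cvg_cst].
- exact: sqint_integrable2.
- apply: filterS fng => x fng m Dx; rewrite gee0_abs ?lee_fin ?sqr_ge0 //.
  rewrite -(real_normK (num_real (fn m x - f x))) -(real_normK (num_real (g x))).
  by rewrite lerXn2r ?nnegrE // fng.
rewrite integral0; move/fine_cvg.
rewrite /sqcvg /ip /Rintegral.
by under [X in _ -> X @ _ --> _]eq_fun do under eq_integral do rewrite -expr2.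
Qed.

Lemma sqcvg_dominated (fn : (T -> R)^nat) f g : (forall m, measurable_fun D (fn m)) ->
  measurable_fun D f -> sqint g -> (forall x, D x -> fn m x @[m --> \oo] --> f x) ->
  (forall m x, D x -> `|fn m x - f x| <= `|g x|) -> sqcvg fn f.
Proof.
move=> mfn mf g2 fnf fng; apply: sqcvg_dominated_ae g2 _ _ => //.
  by apply: aeW => x; exact: fnf.
by apply: aeW => x m; exact: fng.
Qed.

Lemma sqcvg_unique (fn : (T -> R)^nat) f g : (forall m, sqint (fn m)) ->
  sqint f -> sqint g -> sqcvg fn f -> sqcvg fn g ->
  ip (fun x => f x - g x) (fun x => f x - g x) = 0.
Proof.
move=> fn2 f2 g2 fnf fng; apply/eqP; rewrite eq_le ip_ge0 andbT.
apply/ler_addgt0Pl => e e0; rewrite addr0; have e4 : 0 < e / 4 by rewrite divr_gt0.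
move/cvgr0Pnorm_le : fnf => /(_ _ e4) hf; move/cvgr0Pnorm_le : fng => /(_ _ e4) hg.
have [m [hfm hgm]] : exists m, `|ip (fun x => fn m x - f x) (fun x => fn m x - f x)| <= e / 4
   /\ `|ip (fun x => fn m x - g x) (fun x => fn m x - g x)| <= e / 4.
  by have [m] := filter_ex (filterI hf hg); exists m.
rewrite ger0_norm ?ip_ge0 // in hfm; rewrite ger0_norm ?ip_ge0 // in hgm.
have := ip_sqrDle (sqintB f2 (fn2 m)) (sqintB (fn2 m) g2).
have -> : ip (fun x => f x - fn m x) (fun x => f x - fn m x) =
  ip (fun x => fn m x - f x) (fun x => fn m x - f x).
  by apply: eq_Rintegral => x _; ring.
have -> : ip (fun x => f x - fn m x + (fn m x - g x)) (fun x => f x - fn m x + (fn m x - g x)) =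
  ip (fun x => f x - g x) (fun x => f x - g x).
  by apply: eq_Rintegral => x _; ring.
lra.
Qed.

Lemma sqcvg_sum (I : Type) (s : seq I) (F : I -> (T -> R)^nat) (f : I -> T -> R) :
  (forall i m, sqint (F i m)) -> (forall i, sqint (f i)) -> (forall i, sqcvg (F i) (f i)) ->
  sqcvg (fun m x => \sum_(i <- s) F i m x) (fun x => \sum_(i <- s) f i x).
Proof.
move=> F2 f2 Ff; elim: s => [|i s IH].
  rewrite (_ : (fun m x => _) = fun=> fun=> 0); last first.
    by apply/funext => m; apply/funext => x; rewrite big_nil.
  rewrite (_ : (fun x => \sum_(i <- [::]) f i x) = fun=> 0); last first.
    by apply/funext => x; rewrite big_nil.
  exact: sqcvg_cst.
rewrite (_ : (fun m x => _) = fun m x => F i m x + \sum_(j <- s) F j m x); last first.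
  by apply/funext => m; apply/funext => x; rewrite big_cons.
rewrite (_ : (fun x => \sum_(j <- i :: s) f j x) =
    fun x => f i x + \sum_(j <- s) f j x); last first.
  by apply/funext => x; rewrite big_cons.
by apply: sqcvgD => //; [move=> m; exact: sqint_sum|exact: sqint_sum].
Qed.

Lemma ip_cvg_sqr (fn : (T -> R)^nat) f : (forall m, sqint (fn m)) -> sqint f ->
  sqcvg fn f -> ip (fn m) (fn m) @[m --> \oo] --> ip f f.
Proof.
move=> fn2 f2 fnf; have h := ip_cvg fn2 f2 f2 fnf.
have : ip (fun x => fn m x - f x) (fun x => fn m x - f x) + 2 * ip (fn m) f - ip f f
    @[m --> \oo] --> 0 + 2 * ip f f - ip f f.
  apply: cvgB; last exact: cvg_cst.
  by apply: cvgD; [exact: fnf|apply: cvgMl_tmp; exact: h].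
rewrite (_ : 0 + 2 * ip f f - ip f f = ip f f); last by ring.
apply: cvg_trans; apply: near_eq_cvg; apply: nearW => m /=.
by rewrite ipBl ?ipBr // ?(ipC f (fn m)); [ring|exact: sqintB].
Qed.

(** Used to replace approximants by approximants of approximants. *)
Lemma sqcvg_near (fn gn : (T -> R)^nat) f : (forall m, sqint (fn m)) ->
  (forall m, sqint (gn m)) -> sqint f -> sqcvg fn f ->
  (forall m, ip (fun x => gn m x - fn m x) (fun x => gn m x - fn m x) <= m.+1%:R^-1) ->
  sqcvg gn f.
Proof.
move=> fn2 gn2 f2 fnf gnfn; rewrite /sqcvg.
have : 2 * harmonic m + 2 * ip (fun x => fn m x - f x) (fun x => fn m x - f x)
    @[m --> \oo] --> 2 * (0 : R) + 2 * 0.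
  by apply: cvgD; apply: cvgMl_tmp; [exact: cvg_harmonic|exact: fnf].
rewrite !mulr0 addr0; apply: squeeze_cvgr (cvg_cst 0).
apply: nearW => m; rewrite ip_ge0 /=.
have := ip_sqrDle (sqintB (gn2 m) (fn2 m)) (sqintB (fn2 m) f2).
have -> : ip (fun x => gn m x - fn m x + (fn m x - f x)) (fun x => gn m x - fn m x + (fn m x - f x))
  = ip (fun x => gn m x - f x) (fun x => gn m x - f x).
  by apply: eq_Rintegral => x _; ring.
have := gnfn m; rewrite -[m.+1%:R^-1]/(harmonic m : R).
by move: (harmonic m : R) => r; lra.
Qed.

(** Cauchy-Schwarz for functions with values in a Euclidean space, obtained by
    summing the inequalities 0 <= |c_i z_j - c_j z_i|^2. *)
Lemma ip_lincomb_le (I : finType) (c : I -> R) (z : I -> T -> R) : (forall i, sqint (z i)) ->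
  ip (fun x => \sum_i c i * z i x) (fun x => \sum_i c i * z i x) <=
  (\sum_i c i ^+ 2) * (\sum_i ip (z i) (z i)).
Proof.
move=> z2; have cz2 i := sqintZ (c i) (z2 i).
rewrite ip_suml //; last exact: sqint_sum.
have -> : \sum_i ip (fun x => c i * z i x) (fun x => \sum_j c j * z j x) =
    \sum_i \sum_j c i * c j * ip (z i) (z j).
  apply: eq_bigr => i _; rewrite ip_sumr //; apply: eq_bigr => j _.
  by rewrite ipZl // ipZr // mulrA.
rewrite -(ler_pM2l (_ : 0 < 2)) //.
apply: (@le_trans _ _ (\sum_i \sum_j (c i ^+ 2 * ip (z j) (z j) + c j ^+ 2 * ip (z i) (z i)))).
  rewrite mulr_sumr; apply: ler_sum => i _; rewrite mulr_sumr; apply: ler_sum => j _.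
  have := ip_ge0 (fun x => c i * z j x - c j * z i x).
  have h1 := sqintZ (c i) (z2 j); have h2 := sqintZ (c j) (z2 i).
  rewrite ipBl ?ipBr //; [|exact: sqintB].
  by rewrite !ipZl // !ipZr // (ipC (z j) (z i)); nra.
rewrite le_eqVlt; apply/orP; left; apply/eqP.
under eq_bigr do rewrite big_split /= -mulr_sumr -mulr_suml.
by rewrite big_split /= -mulr_suml -mulr_sumr; ring.
Qed.

Lemma ip_subZ_sqr f g a : sqint f -> sqint g ->
  ip (fun x => f x - a * g x) (fun x => f x - a * g x) =
  ip f f - 2 * a * ip f g + a ^+ 2 * ip g g.
Proof.
move=> f2 g2; have ag := sqintZ a g2.
by rewrite ipBl ?ipBr ?ipZl ?ipZr // ?(ipC g f); [ring|exact: sqintB].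
Qed.

(** The weights serve two purposes.  They bound the square of a sum by the sum of
    the squares divided by the weights, with constant 1; and they make the
    series converge almost everywhere under an integrable envelope. *)
Section weighted_series.
Variables (g : (T -> R)^nat) (w : R^nat) (S : R).
Hypothesis g2 : forall k, sqint (g k).
Hypothesis w_gt0 : forall k, 0 < w k.
Hypothesis w_sum : forall m, \sum_(k < m) w k <= 1.
Hypothesis gw_sum : forall m, \sum_(k < m) ip (g k) (g k) / w k <= S.

Lemma weighted_cauchy_schwarz (a : R^nat) m :
  (\sum_(k < m) a k) ^+ 2 <= (\sum_(k < m) w k) * (\sum_(k < m) a k ^+ 2 / w k).
Proof.
elim: m => [|m IH]; first by rewrite !big_ord0 expr0n mul0r.
rewrite !big_ord_recr /=.
have P0 : 0 <= \sum_(k < m) w k by apply: sumr_ge0 => k _; exact: ltW.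
have Q0 : 0 <= \sum_(k < m) a k ^+ 2 / w k.
  by apply: sumr_ge0 => k _; rewrite divr_ge0 ?sqr_ge0 // ltW.
move: (\sum_(k < m) a k) (\sum_(k < m) w k) (\sum_(k < m) a k ^+ 2 / w k) IH P0 Q0.
move=> A P Q APQ P0 Q0; have := w_gt0 m; move: (a m) (w m) => b v v0.
have vn0 : v != 0 by rewrite gt_eqF.
have -> : (P + v) * (Q + b ^+ 2 / v) = P * Q + (P * b ^+ 2 / v + v * Q) + b ^+ 2.
  by field.
have X0 : 0 <= P * b ^+ 2 / v.
  by apply: divr_ge0; [apply: mulr_ge0 => //; exact: sqr_ge0|exact: ltW].
have Y0 : 0 <= v * Q by apply: mulr_ge0 => //; exact: ltW.
have XY : (A * b) ^+ 2 <= (P * b ^+ 2 / v) * (v * Q).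
  rewrite (_ : _ * (v * Q) = P * Q * b ^+ 2); last by field.
  by rewrite exprMn ler_wpM2r ?sqr_ge0.
move: (P * b ^+ 2 / v) (v * Q) X0 Y0 XY => x y x0 y0 xy.
have : (2 * (A * b)) ^+ 2 <= (x + y) ^+ 2 by have := sqr_ge0 (x - y); nra.
rewrite -(real_normK (num_real (2 * (A * b)))) ler_sqr ?nnegrE ?addr_ge0 // => h.
have := le_trans (ler_norm _) h; nra.
Qed.

(* The envelope: it bounds the squares of all partial sums. *)
Let W (x : T) : \bar R := (\sum_(0 <= k <oo) (g k x ^+ 2 / w k)%:E)%E.

Let term_ge0 k x : (0 <= (g k x ^+ 2 / w k)%:E)%E.
Proof. by rewrite lee_fin divr_ge0 ?sqr_ge0 // ltW. Qed.

Let mterm k : measurable_fun D (fun x => (g k x ^+ 2 / w k)%:E).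
Proof.
apply/measurable_EFinP; apply: measurable_funM => //.
by apply: measurable_funX; case: (g2 k).
Qed.

Let mW : measurable_fun D W.
Proof. by apply: ge0_emeasurable_sum => // k x _ _; exact: term_ge0. Qed.

Let W_ge0 x : (0 <= W x)%E.
Proof. by apply: nneseries_ge0 => k _ _; exact: term_ge0. Qed.

Let intW : (\int[mu]_(x in D) W x <= S%:E)%E.
Proof.
rewrite integral_nneseries //; apply: lime_le.
  by apply: is_cvg_nneseries => k _ _; apply: integral_ge0 => x _; exact: term_ge0.
apply: nearW => m; rewrite big_mkord.
rewrite (eq_bigr (fun k : 'I_m => (ip (g k) (g k) / w k)%:E)).
  by rewrite sumEFin lee_fin; exact: gw_sum.
move=> k _; under eq_integral do rewrite EFinM muleC.
rewrite ge0_integralZl //.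
- by rewrite sqint_ipE // -EFinM mulrC.
- by apply/measurable_EFinP; apply: measurable_funX; case: (g2 k).
- by move=> x _; rewrite lee_fin sqr_ge0.
- by rewrite lee_fin invr_ge0 ltW.
Qed.

Let W_fin : {ae mu, forall x, D x -> W x \is a fin_num}.
Proof.
apply: integrable_ae => //; apply/integrableP; split => //.
under eq_integral do rewrite gee0_abs //.
by apply: le_lt_trans intW _; rewrite ltry.
Qed.

Let partial_le m x : W x \is a fin_num -> \sum_(k < m) g k x ^+ 2 / w k <= fine (W x).
Proof.
move=> Wx; rewrite -lee_fin fineK // -sumEFin -(big_mkord xpredT (fun k => (g k x ^+ 2 / w k)%:E)).
by apply: nneseries_lim_ge => k _ _; exact: term_ge0.
Qed.

Let sum_le m x : W x \is a fin_num -> (\sum_(k < m) g k x) ^+ 2 <= fine (W x).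
Proof.
move=> Wx; apply: le_trans (weighted_cauchy_schwarz (g ^~ x) m) _.
apply: le_trans (partial_le m Wx); rewrite ler_piMl // sumr_ge0 // => k _.
by rewrite divr_ge0 ?sqr_ge0 // ltW.
Qed.

(* Absolute convergence: |b| <= v + b^2 / v for every v > 0. *)
Let cvg_sum x : W x \is a fin_num -> cvg (\sum_(k < m) g k x @[m --> \oo]).
Proof.
move=> Wx.
have -> : (fun m => \sum_(k < m) g k x) = series (fun k => g k x).
  by apply/funext => m; rewrite /series /= big_mkord.
apply: normed_cvg; apply: nondecreasing_is_cvgn.
  by apply: nondecreasing_series => k _ _ /=.
exists (1 + fine (W x)) => _ [m _ <-].
rewrite /normed_series_of seriesEord /=.
apply: le_trans (lerD (w_sum m) (partial_le m Wx)).
rewrite -big_split /=; apply: ler_sum => k _.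
have := w_gt0 k; move: (w k) (g k x) => v b v0.
rewrite -(real_normK (num_real b)); have := normr_ge0 b; move: `|b| => a a0.
have -> : v + a ^+ 2 / v = a + (v - a + (a ^+ 2 / v)) by ring.
rewrite lerDl (_ : v - a + a ^+ 2 / v = (v ^+ 2 - a * v + a ^+ 2) / v); last first.
  by field; rewrite gt_eqF.
by rewrite divr_ge0 // ?ltW //; have := sqr_ge0 (v - a); nra.
Qed.

(** Apply [ip_lincomb_le] to g_k = sqrt(w_k) (g_k / sqrt(w_k)). *)
Lemma weighted_series_le m :
  ip (fun x => \sum_(k < m) g k x) (fun x => \sum_(k < m) g k x) <=
  \sum_(k < m) ip (g k) (g k) / w k.
Proof.
have s0 k : Num.sqrt (w k) != 0 by rewrite gt_eqF // sqrtr_gt0.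
have gE : (fun x => \sum_(k < m) g k x) =
    (fun x => \sum_(k < m) Num.sqrt (w k) * ((Num.sqrt (w k))^-1 * g k x)).
  by apply/funext => x; apply: eq_bigr => k _; rewrite mulVKf.
rewrite gE; apply: (@le_trans _ _ ((\sum_(k < m) Num.sqrt (w k) ^+ 2) *
    \sum_(k < m) ip (fun x => (Num.sqrt (w k))^-1 * g k x)
      (fun x => (Num.sqrt (w k))^-1 * g k x))).
  by apply: (ip_lincomb_le (fun k : 'I_m => Num.sqrt (w k))) => k; exact: sqintZ.
apply: (@le_trans _ _ (1 * \sum_(k < m) ip (g k) (g k) / w k)); last by rewrite mul1r.
apply: ler_pM.
- by apply: sumr_ge0 => k _; exact: sqr_ge0.
- by apply: sumr_ge0 => k _; exact: ip_ge0.
- by under eq_bigr => k _ do rewrite sqr_sqrtr ?(ltW (w_gt0 k))//.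
apply: ler_sum => k _; have kg := sqintZ (Num.sqrt (w k))^-1 (g2 k).
rewrite ipZl // ipZr // mulrA -invfM -expr2 sqr_sqrtr; first by rewrite mulrC.
exact: ltW.
Qed.

(** The partial sums converge where the envelope W is finite, hence almost
    everywhere, and their squares are below W, so dominated convergence
    applies. *)
Lemma weighted_series_cvg : exists2 f, sqint f & sqcvg (fun m x => \sum_(k < m) g k x) f.
Proof.
pose E := D `&` [set x | W x \is a fin_num].
pose h m x := (\sum_(k < m) g k x) * \1_E x.
have EP x : E x -> \1_E x = 1 :> R by move=> ?; rewrite indicE mem_set.
have EN x : ~ E x -> \1_E x = 0 :> R by move=> ?; rewrite indicE memNset.
have hc x : cvg (h m x @[m --> \oo]).
  have [Ex|Ex] := pselect (E x).
    rewrite /h EP //; under eq_fun do rewrite mulr1.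
    by apply: cvg_sum; case: Ex.
  by rewrite /h EN //; under eq_fun do rewrite mulr0; exact: is_cvg_cst.
pose f x := lim (h m x @[m --> \oo]).
have hf x : h m x @[m --> \oo] --> f x by exact: hc.
have mE : measurable E by exact: emeasurable_fin_num.
have mh m : measurable_fun D (h m).
  apply: measurable_funM; last exact: measurable_indic.
  by have [] := sqint_sum (index_enum 'I_m) (fun k : 'I_m => g2 k).
have mf : measurable_fun D f.
  by apply: (measurable_fun_cvg mh) => x _; exact: hf.
have h_le m x : h m x ^+ 2 <= fine (W x).
  have [Ex|Ex] := pselect (E x).
    by rewrite /h EP // mulr1; apply: sum_le; case: Ex.
  by rewrite /h EN // mulr0 expr0n /=; exact: fine_ge0.
have f_le x : f x ^+ 2 <= fine (W x).
  have c : h m x * h m x @[m --> \oo] --> f x * f x by apply: cvgM; exact: hf.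
  rewrite expr2; apply: (ler_cvg_to c (cvg_cst _)); apply: nearW => m.
  by rewrite -expr2.
have f_leW x : ((f x ^+ 2)%:E <= W x)%E.
  have [Wx|Wx] := boolP (W x \is a fin_num).
    by rewrite -[leRHS]fineK // lee_fin.
  by move: Wx; rewrite ge0_fin_numE // -leNgt leye_eq => /eqP ->; rewrite leey.
have if2 : (\int[mu]_(x in D) (f x ^+ 2)%:E <= S%:E)%E.
  apply: le_trans intW; apply: ge0_le_integral => //.
  - by move=> x _; rewrite lee_fin sqr_ge0.
  - by apply/measurable_EFinP; exact: measurable_funX.
have f2 : sqint f by split => //; apply: le_lt_trans if2 _; rewrite ltry.
exists f => //.
apply: (sqcvg_dominated_ae (g := fun x => 2 * Num.sqrt (fine (W x)))) => //.
- by move=> m; have [] := sqint_sum (index_enum 'I_m) (fun k : 'I_m => g2 k).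
- apply: sqintZ; split.
    apply: measurableT_comp; last exact: measurableT_comp.
    by apply: continuous_measurable_fun; exact: sqrt_continuous.
  apply: (@le_lt_trans _ _ S%:E); last by rewrite ltry.
  apply: le_trans intW; apply: ge0_le_integral => //.
  + apply/measurable_EFinP/measurable_funX.
    apply: measurableT_comp; last exact: measurableT_comp.
    by apply: continuous_measurable_fun; exact: sqrt_continuous.
  + move=> x _; rewrite sqr_sqrtr ?fine_ge0 //.
    have [Wx|] := boolP (W x \is a fin_num); first by rewrite fineK.
    by rewrite ge0_fin_numE // -leNgt leye_eq => /eqP ->; rewrite leey.
- apply: filterS W_fin => x Wx Dx.
  have Ex : E x by split => //; exact: Wx.
  have := hf x; rewrite /h EP //.
  by under eq_fun do rewrite mulr1.
- apply: filterS W_fin => x Wx m Dx.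
  have Ex : E x by split => //; exact: Wx.
  have W0 : 0 <= fine (W x) by exact: fine_ge0.
  have sq a : a ^+ 2 <= fine (W x) -> `|a| <= Num.sqrt (fine (W x)).
    by move=> ha; rewrite -sqrtr_sqr ler_wsqrtr.
  rewrite [leRHS]ger0_norm ?mulr_ge0 ?sqrtr_ge0 //.
  have := ler_normB (\sum_(k < m) g k x) (f x).
  have := sq _ (f_le x); have := sq _ (sum_le m (Wx Dx)).
  by lra.
Qed.

End weighted_series.

End square_integrable.

(** * Lebesgue measure on row vectors *)

Section lebesgue_rV_theory.
Context (R : realType).

Lemma ball_rVE n (c : 'rV[R]_n) r : 0 < r ->
  ball c r = [set x | forall i, `|c ord0 i - x ord0 i| < r].
Proof.
move=> r0; apply/seteqP; split=> [x [_ cx] i|x cx]; first exact: cx.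
by split => // i j; rewrite !ord1; exact: cx.
Qed.

Lemma measurable_ball_rV n (c : 'rV[R]_n) r : 0 < r -> measurable (ball c r).
Proof.
move=> r0; have -> : ball c r = \bigcap_(i in [set: 'I_n])
    ((fun x : 'rV[R]_n => x ord0 i) @^-1` ball (c ord0 i) r).
  rewrite ball_rVE //; apply/seteqP; split => x /= h i; first by move=> _; exact: h.
  exact: (h i I).
apply: fin_bigcap_measurable; first exact: finite_finset.
move=> i _; rewrite -[X in measurable X]setTI.
by apply: measurable_coord_rV => //; exact: measurable_ball.
Qed.

(** An open set is the union of the balls with rational center and radius
    1/(k+1) that it contains, and there are countably many of these. *)
Lemma open_measurable_rV n (U : set 'rV[R]_n) : open U -> measurable U.
Proof.
move=> oU.
pose F (p : {ffun 'I_n -> rat} * nat) : set 'rV[R]_n :=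
  ball (\row_i ratr (p.1 i) : 'rV[R]_n) p.2.+1%:R^-1.
have -> : U = \bigcup_k if unpickle k is Some p then
    (if `[< F p `<=` U >] then F p else set0) else set0.
  apply/seteqP; split=> [x Ux|x [k _]]; last first.
    by case: (unpickle k) => // p; case: ifPn => // /asboolP; exact.
  have /nbhs_ballP[e /= e0 eU] : nbhs x U by exact: open_nbhs_nbhs.
  pose k := Num.truncn (e / 2)^-1; pose r : R := k.+1%:R^-1.
  have r0 : 0 < r by rewrite invr_gt0.
  have re : r < e / 2.
    by rewrite -[e / 2]invrK ltf_pV2 ?posrE ?invr_gt0 ?divr_gt0// truncnS_gt.
  have /choice[q xq] : forall i, exists q, `|x ord0 i - ratr q| < r.
    move=> i; have /rat_in_itvoo[q] : x ord0 i - r < x ord0 i + r by lra.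
    rewrite in_itv /= => /andP[q1 q2]; exists q.
    by rewrite ltr_norml; apply/andP; split; lra.
  pose p : {ffun 'I_n -> rat} * nat := ([ffun i => q i], k).
  exists (pickle p) => //; rewrite pickleK.
  have -> : `[< F p `<=` U >] = true.
    apply/asboolP => y; rewrite /F /= ball_rVE // => /= hy; apply: eU.
    rewrite ball_rVE // => i /=; have := xq i; have := hy i.
    rewrite mxE ffunE => h1 h2.
    have -> : x ord0 i - y ord0 i = (x ord0 i - ratr (q i)) + (ratr (q i) - y ord0 i).
      by ring.
    by apply: le_lt_trans (ler_normD _ _) _; rewrite -/r in h1; lra.
  rewrite /F /= ball_rVE // => i /=; rewrite mxE ffunE distrC; exact: xq.
apply: bigcupT_measurable => k; case: (unpickle k) => // p.
by case: ifPn => // _; apply: measurable_ball_rV; rewrite invr_gt0.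
Qed.

Lemma continuous_measurable_rV n (f : 'rV[R]_n -> R) : continuous f ->
  measurable_fun setT f.
Proof.
move=> cf; apply: (measurability _ (RGenOpens.measurableE R)).
move=> _ [_ [a [b ->] <-]]; rewrite setTI; apply: open_measurable_rV.
by move/continuousP : cf; apply; exact: interval_open.
Qed.

Lemma lebesgue_ball_rV n (c : 'rV[R]_n) r : 0 < r ->
  lebesgue_rV R n (ball c r) = ((r *+ 2) ^+ n)%:E.
Proof.
move=> r0; elim: n c => [|n IH] c.
  rewrite expr0 /= diracE mem_set // ball_rVE //= => -[].
  by case.
have mb := @measurable_ball_rV n (\row_j c ord0 (lift ord0 j)) r r0.
have -> : lebesgue_rV R n.+1 (ball c r) = (lebesgue_measure \x lebesgue_rV R n)%E
    (ball (c ord0 ord0) r `*` ball (\row_j c ord0 (lift ord0 j)) r).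
  rewrite /= /lebesgue_rVS /pushforward; congr (_ _).
  rewrite !ball_rVE //; apply/seteqP; split=> [[t x]/= h|[t x]/= [ht hx] i].
    split=> [|i]; first by have := h ord0; rewrite cons_rVE unlift_none.
    by have := h (lift ord0 i); rewrite cons_rVE liftK mxE.
  rewrite cons_rVE; case: unliftP => [j|] ->; last exact: ht.
  by have := hx j; rewrite mxE.
rewrite product_measure1E //; last exact: measurable_ball.
rewrite exprS EFinM; congr (_ * _)%E; last exact: IH.
exact: (lebesgue_measure_ball _ (ltW r0)).
Qed.

Let leb : {sigma_finite_measure set (measurableTypeR R) -> \bar R} := lebesgue_measure.

Let prodm n : {measure set (measurableTypeR R * 'rV[R]_n) -> \bar R} :=
  (leb \x lebesgue_rV R n)%E.

Lemma integral_cons_rV n (f : 'rV[R]_n.+1 -> \bar R) : measurable_fun setT f ->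
  (prodm n).-integrable setT (f \o @cons_rV R n) ->
  (\int[lebesgue_rV R n.+1]_x f x = \int[prodm n]_z f (cons_rV z))%E.
Proof.
move=> mf fi.
exact: (@integral_pushforward _ _ (measurableTypeR R * 'rV[R]_n)%type _ _ _
  (@measurable_cons_rV R n)
  (prodm n) setT f mf fi measurableT).
Qed.

Lemma integrable_bounded_support d (T : measurableType d)
    (mu : {measure set T -> \bar R}) (S : set T) (f : T -> R) M :
  measurable S -> (mu S < +oo)%E -> measurable_fun setT f ->
  (forall x, `|f x| <= M) -> (forall x, f x != 0 -> S x) ->
  mu.-integrable setT (EFin \o f).
Proof.
move=> mS Soo mf fM fS.
have -> : EFin \o f = (EFin \o f) \_ S.
  apply/funext => x; rewrite patchE; case: ifPn => //= /negP xS.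
  by congr EFin; apply: contra_notP xS => /eqP /fS ?; exact/mem_set.
apply/(integrable_mkcond _ mS).1; apply: measurable_bounded_integrable => //.
  exact: measurable_funTS.
exists M; split; first exact: num_real.
by move=> y My x _; exact: le_trans (fM x) (ltW My).
Qed.

Lemma Rintegral_eq0 d (T : measurableType d) (mu : {measure set T -> \bar R})
    (f : T -> R) : mu.-integrable setT (EFin \o f) -> \int[mu]_x f x = 0 ->
  (\int[mu]_x (f x)%:E = 0)%E.
Proof.
move=> fi; rewrite /Rintegral => f0; rewrite -[LHS]fineK ?f0 //.
exact: integrable_fin_num fi.
Qed.

(** Fubini.  By induction on the dimension the first coordinate is integrated
    separately: either it is the direction i, or every slice satisfies the same
    hypotheses in one dimension less. *)
Lemma Rintegral_lines_eq0 n (i : 'I_n) (f : 'rV[R]_n -> R) M : 0 < M ->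
  measurable_fun setT f -> (forall x, `|f x| <= M) ->
  (forall x, f x != 0 -> ball 0 M x) ->
  (forall x, \int[leb]_t f (x + t *: delta_mx ord0 i) = 0) ->
  \int[lebesgue_rV R n]_x f x = 0.
Proof.
move=> M0; elim: n i f => [[]//|n IH] i f mf fM fS f0.
have ball0 k (x : 'rV[R]_k) : ball 0 M x <-> forall j, `|x ord0 j| < M.
  rewrite ball_rVE //=; split=> h j; have := h j; by rewrite mxE sub0r normrN.
have mg : measurable_fun setT (f \o @cons_rV R n).
  by apply: measurableT_comp => //; exact: measurable_cons_rV.
have gS t x : f (cons_rV (t, x)) != 0 -> ball 0 M t /\ ball 0 M x.
  move=> /fS /ball0 h; split.
    by have := h ord0; rewrite cons_rVE unlift_none /ball /= sub0r normrN.
  by apply/ball0 => j; have := h (lift ord0 j); rewrite cons_rVE liftK.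
have gi : (prodm n).-integrable setT (EFin \o (f \o @cons_rV R n)).
  apply: (@integrable_bounded_support _ _ (prodm n) (ball 0 M `*` ball 0 M)
    (f \o @cons_rV R n) M) => //.
  - by apply: measurableX; [exact: measurable_ball|exact: measurable_ball_rV].
  - rewrite /prodm [X in (X < _)%E]product_measure1E; last 2 first.
      exact: measurable_ball.
      exact: measurable_ball_rV.
    rewrite [X in (X * _)%E](lebesgue_measure_ball _ (ltW M0)).
    by rewrite lebesgue_ball_rV // -EFinM ltry.
  - by move=> z; exact: fM.
  - by move=> [t x] /= /gS.
have ge : (\int[lebesgue_rV R n.+1]_x (f x)%:E = \int[prodm n]_z (f (cons_rV z))%:E)%E.
  by apply: integral_cons_rV => //; exact/measurable_EFinP.
rewrite /Rintegral ge; case: (unliftP ord0 i) f0 => [j|] ->  f0.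
  rewrite -(@integral12_prod_meas1 _ _ _ _ _ leb (lebesgue_rV R n) _ gi).
  rewrite (eq_integral (cst 0%E)) ?integral0 // => t _; rewrite /fubini_F /=.
  have mt : measurable_fun setT (fun x => f (cons_rV (t, x))).
    by apply: measurableT_comp mg _; exact: measurable_pair1.
  apply: (@Rintegral_eq0 _ _ (lebesgue_rV R n) (fun x => f (cons_rV (t, x)))).
    apply: (@integrable_bounded_support _ _ (lebesgue_rV R n) (ball 0 M)
      (fun x => f (cons_rV (t, x))) M) => //.
    - exact: measurable_ball_rV.
    - by rewrite [X in (X < _)%E]lebesgue_ball_rV // ltry.
    - by move=> x /gS[].
  apply: (IH j) => //; first by move=> x /gS[].
  move=> x; rewrite -[RHS](f0 (cons_rV (t, x))); apply: eq_Rintegral => s _.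
  congr f; apply/rowP => k; rewrite [RHS]mxE !cons_rVE; case: unliftP => [l|] ->.
    by rewrite !mxE /= (inj_eq lift_inj).
  by rewrite !mxE mulr0 addr0.
rewrite -(@integral21_prod_meas1 _ _ _ _ _ leb (lebesgue_rV R n) _ gi).
rewrite (eq_integral (cst 0%E)) ?integral0 // => x _; rewrite /fubini_G /=.
have mt : measurable_fun setT (fun t => f (cons_rV (t, x))).
  by apply: measurableT_comp mg _; exact: measurable_pair2.
apply: (@Rintegral_eq0 _ _ leb (fun t => f (cons_rV (t, x)))).
  apply: (@integrable_bounded_support _ _ leb (ball 0 M)
    (fun t => f (cons_rV (t, x))) M) => //.
  - exact: measurable_ball.
  - by rewrite [X in (X < _)%E](lebesgue_measure_ball _ (ltW M0)) ltry.
  - by move=> t /gS[].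
rewrite -[RHS](f0 (cons_rV (0, x))); apply: eq_Rintegral => s _.
congr f; apply/rowP => k; rewrite [RHS]mxE !cons_rVE; case: unliftP => [l|] ->.
  by rewrite !mxE mulr0 addr0.
by rewrite !mxE mulr1 add0r.
Qed.

End lebesgue_rV_theory.

(** * Directional derivatives *)

Section directional_derivative.
Context (R : realType).

(** Reduces derivatives along v to derivatives of functions of one variable. *)
Lemma is_derive_line (V : normedModType R) (f : V -> R) (x v : V) (t df : R) :
  is_derive (x + t *: v) v f df <-> is_derive t 1 (fun s => f (x + s *: v)) df.
Proof.
have E : (fun h : R => h^-1 *: ((f \o shift (x + t *: v)) (h *: v) - f (x + t *: v))) =
    (fun h : R => h^-1 *: (((fun s => f (x + s *: v)) \o shift t) (h *: (1:R)) -
                      f (x + t *: v))).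
  apply/funext => h /=; rewrite [h *: 1]mulr1 scalerDl.
  by congr (_ *: (f _ - _)); rewrite addrCA.
by split=> -[h1 h2]; split; move: h1 h2; rewrite /derivable /derive E.
Qed.

Lemma is_derive_line0 (V : normedModType R) (f : V -> R) (x v : V) (df : R) :
  is_derive x v f df <-> is_derive (0 : R) 1 (fun s => f (x + s *: v)) df.
Proof. by rewrite -is_derive_line scale0r addr0. Qed.

Lemma is_derive_chain (V : normedModType R) (g : R -> R) (f : V -> R) (x v : V) (df dg : R) :
  is_derive x v f df -> is_derive (f x) 1 g dg ->
  is_derive x v (fun y => g (f y)) (dg * df).
Proof.
move=> /is_derive_line0 hf hg; apply/is_derive_line0.
apply: (@is_derive1_comp _ g (fun s => f (x + s *: v))) hf.
by rewrite scale0r addr0.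
Qed.

Lemma is_derive_mulr (V : normedModType R) (f g : V -> R) (x v : V) (df dg : R) :
  is_derive x v f df -> is_derive x v g dg ->
  is_derive x v (fun y => f y * g y) (f x * dg + g x * df).
Proof. by move=> hf hg; exact: (is_deriveM hf hg). Qed.

End directional_derivative.

(** * Polynomial functions *)
Section polynomial_functions.
Context (R : realType) (n : nat).
Implicit Types (p q : mpoly n R) (x : 'rV[R]_n).
Local Notation e i := (delta_mx ord0 i : 'rV[R]_n).

Definition peval p x := meval (fun i => x ord0 i) p.

Lemma peval0 x : peval 0 x = 0. Proof. exact: meval0. Qed.
Lemma peval1 x : peval 1 x = 1. Proof. exact: meval1. Qed.
Lemma pevalC a x : peval (mpolyC n a) x = a. Proof. exact: mevalC. Qed.
Lemma pevalX i x : peval (mpolyX R (mnm1 i)) x = x ord0 i. Proof. exact: mevalXU. Qed.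
Lemma pevalD p q x : peval (p + q) x = peval p x + peval q x. Proof. exact: mevalD. Qed.
Lemma pevalB p q x : peval (p - q) x = peval p x - peval q x. Proof. exact: mevalB. Qed.
Lemma pevalN p x : peval (- p) x = - peval p x. Proof. exact: mevalN. Qed.
Lemma pevalM p q x : peval (p * q) x = peval p x * peval q x. Proof. exact: mevalM. Qed.
Lemma pevalZ a p x : peval (a *: p) x = a * peval p x. Proof. exact: mevalZ. Qed.
Lemma peval_sum (J : Type) (s : seq J) (F : J -> mpoly n R) x :
  peval (\sum_(j <- s) F j) x = \sum_(j <- s) peval (F j) x.
Proof. exact: raddf_sum. Qed.

Lemma pevalXn p k x : peval (p ^+ k) x = peval p x ^+ k.
Proof. by elim: k => [|k IH]; rewrite ?expr0 ?peval1 // !exprS pevalM IH. Qed.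

Lemma mpoly_elim (Q : mpoly n R -> Prop) :
  (forall a, Q (mpolyC n a)) -> (forall i, Q (mpolyX R (mnm1 i))) ->
  (forall p q, Q p -> Q q -> Q (p + q)) -> (forall p q, Q p -> Q q -> Q (p * q)) ->
  forall p, Q p.
Proof.
move=> QC QX QD QM p; elim/mpolyind: p => [|c m p _ _ Qp].
  by rewrite -mpolyC0; exact: QC.
apply: (QD _ _ _ Qp); rewrite -mul_mpolyC; apply: (QM _ _ (QC _)).
rewrite mpolyXE_id; elim/big_ind : _ => [||i _].
- by rewrite -mpolyC1; exact: QC.
- exact: QM.
elim: (m _) => [|k IH]; first by rewrite expr0 -mpolyC1; exact: QC.
by rewrite exprS; exact: QM.
Qed.

Lemma is_derive_coord x v i : is_derive x v (fun y : 'rV[R]_n => y ord0 i) (v ord0 i).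
Proof.
apply/is_derive_line0.
rewrite (_ : (fun s => _) = cst (x ord0 i) \+ (v ord0 i \*: id)); last first.
  by apply/funext => s; rewrite /= !mxE mulrC.
apply: (is_derive_eq
  (is_deriveD (is_derive_cst _ _ _) (is_deriveZ _ (is_derive_id _ _)))).
by rewrite add0r [_ *: _]mulr1.
Qed.

Lemma is_derive_peval i p x : is_derive x (e i) (peval p) (peval (mderiv i p) x).
Proof.
elim/mpoly_elim: p => [a|j|p q hp hq|p q hp hq].
- rewrite mderivC peval0 (_ : peval _ = cst a); first exact: is_derive_cst.
  by apply/funext => y; rewrite pevalC.
- rewrite (_ : peval _ = fun y : 'rV[R]_n => y ord0 j); last by apply/funext => y; rewrite pevalX.
  rewrite mderiv_var (_ : peval _ x = (e i) ord0 j); first exact: is_derive_coord.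
  by rewrite mxE eqxx eq_sym /= -mpolyC_nat pevalC.
- rewrite mderivD pevalD (_ : peval _ = peval p \+ peval q).
    exact: is_deriveD.
  by apply/funext => y; rewrite pevalD.
- rewrite mderivM pevalD !pevalM.
  rewrite (_ : peval _ = fun y => peval p y * peval q y); last by apply/funext => y; rewrite pevalM.
  rewrite addrC [X in _ + X]mulrC; exact: is_derive_mulr.
Qed.

Lemma partial_peval i p : partial i (peval p) = peval (mderiv i p).
Proof. by apply/funext => x; rewrite /partial; have [_ ->] := is_derive_peval i p x. Qed.

Lemma continuous_coord i : continuous (fun x : 'rV[R]_n => x ord0 i).
Proof. exact: coord_continuous. Qed.

Lemma continuous_peval p : continuous (peval p).
Proof.
elim/mpoly_elim: p => [a|j|p q hp hq|p q hp hq].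
- rewrite (_ : peval _ = cst a); first exact: cst_continuous.
  by apply/funext => y; rewrite pevalC.
- rewrite (_ : peval _ = fun y : 'rV[R]_n => y ord0 j); first exact: continuous_coord.
  by apply/funext => y; rewrite pevalX.
- rewrite (_ : peval _ = peval p \+ peval q); last by apply/funext => y; rewrite pevalD.
  by move=> x; apply: continuousD; [exact: hp|exact: hq].
- rewrite (_ : peval _ = peval p \* peval q); last by apply/funext => y; rewrite pevalM.
  by move=> x; apply: continuousM; [exact: hp|exact: hq].
Qed.

Lemma measurable_peval D p : measurable_fun D (peval p).
Proof. by apply: measurable_funTS; apply: continuous_measurable_rV; exact: continuous_peval. Qed.

Lemma peval_bounded p M : exists C : R, forall x, ball 0 M x -> `|peval p x| <= C.
Proof.
elim/mpoly_elim: p => [a|j|p q [C hp] [C' hq]|p q [C hp] [C' hq]].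
- by exists `|a| => x _; rewrite pevalC.
- exists M => x -[_ /(_ ord0 j)]; rewrite pevalX /ball /= mxE sub0r normrN.
  by move/ltW.
- exists (C + C') => x Bx; rewrite pevalD; apply: le_trans (ler_normD _ _) _.
  by apply: lerD; [exact: hp|exact: hq].
- exists (C * C') => x Bx; rewrite pevalM normrM.
  by apply: ler_pM => //; [exact: hp|exact: hq].
Qed.

End polynomial_functions.

(** * Test functions and integration by parts *)
Section compact_support.
Context (R : realType) (n : nat).
Local Notation e i := (delta_mx ord0 i : 'rV[R]_n).
Local Notation lambda := (lebesgue_rV R n).
Implicit Types (f g : 'rV[R]_n -> R) (Omega : set 'rV[R]_n).

Definition C1 f := continuous f /\ forall i, continuous (partial i f) /\
  forall x, derivable f x (e i).

Definition compactly_supported f := exists2 M : R, 0 < M & forall x, f x != 0 -> ball 0 M x.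

Lemma C1_mul f g : C1 f -> C1 g -> C1 (fun x => f x * g x) /\
  forall i, partial i (fun x => f x * g x) =
     (fun x => f x * partial i g x + g x * partial i f x).
Proof.
move=> [cf df] [cg dg].
have h i x : is_derive x (e i) (fun x => f x * g x)
    (f x * partial i g x + g x * partial i f x).
  apply: is_derive_mulr; apply: derivableP; [exact: (df i).2|exact: (dg i).2].
have pE i : partial i (fun x => f x * g x) =
    (fun x => f x * partial i g x + g x * partial i f x).
  by apply/funext => x; rewrite /partial; have [_ ->] := h i x.
split=> //; split; first by move=> x; apply: continuousM; [exact: cf|exact: cg].
move=> i; split; last by move=> x; have [] := h i x.
rewrite pE => x.
apply: (@continuousD _ _ _ (f \* partial i g) (g \* partial i f)); apply: continuousM.
- exact: cf.
- exact: (dg i).1.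
- exact: cg.
- exact: (df i).1.
Qed.

Lemma C1_peval p : C1 (peval p).
Proof.
split; first exact: continuous_peval.
move=> i; rewrite partial_peval; split; first exact: continuous_peval.
by move=> x; have [] := is_derive_peval i p x.
Qed.

Lemma is_derive_near0 (V : normedModType R) (f : V -> R) (x v : V) :
  (\forall y \near x, f y = 0) -> is_derive x v f 0.
Proof.
move=> f0; have [->|v0] := eqVneq v 0.
  apply/is_derive_line0; rewrite (_ : (fun s => _) = cst (f x)).
    exact: is_derive_cst.
  by apply/funext => s; rewrite scaler0 addr0.
apply: (near_eq_is_derive _ (is_derive_cst 0 x v)).
by apply: filterS f0 => y ->.
Qed.

(** The support only grows by the margin 1, which is there because the open ball
    of radius M need not contain the closure of the nonzero set of f. *)
Lemma partial_supported f M i : (forall y, f y != 0 -> ball 0 M y) ->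
  forall x, partial i f x != 0 -> ball 0 (M + 1) x.
Proof.
move=> fM x; apply: contra_neqP => xM; rewrite /partial.
suff f0 : \forall y \near x, f y = 0 by have [] := is_derive_near0 (e i) f0.
apply/nbhs_ballP; exists 1 => //= y xy; apply/eqP; apply: contra_notT xM => /fM yM.
by have := ball_triangle yM (ball_sym xy).
Qed.

(** The fundamental theorem of calculus on a segment whose ends are beyond the
    support: |x_i + t| >= M as soon as |t| >= A. *)
Lemma C1_lines f i (x : 'rV[R]_n) : C1 f -> compactly_supported f ->
  \int[lebesgue_measure]_t partial i f (x + t *: e i) = 0.
Proof.
move=> [cf /(_ i)[cdf df]] [M M0 fM].
pose A := M + 1 + `|x ord0 i|.
have A0 : 0 < A by rewrite ltr_wpDr // ltr_wpDr.
pose F t := f (x + t *: e i).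
have F0 (t : R) : A <= `|t| -> F t = 0.
  move=> At; apply/eqP; apply: contraTT isT => /fM.
  rewrite ball_rVE // => /(_ i).
  rewrite /= !mxE !eqxx /= mulr1 sub0r normrN => h.
  have : `|t| <= `|x ord0 i + t| + `|x ord0 i|.
    rewrite -[X in `|X| <= _](addrK (x ord0 i)) [t + _]addrC.
    exact: ler_normB.
  by rewrite /A in At; lra.
have dF (t : R) : is_derive t (1 : R) F (partial i f (x + t *: e i)).
  exact: (is_derive_line f x (e i) t _).1 (derivableP (df _)).
have cF : continuous F.
  move=> t; apply: differentiable_continuous; apply/derivable1_diffP.
  by have [] := dF t.
have dF0 (t : R) : A < `|t| -> partial i f (x + t *: e i) = 0.
  move=> At; have [_ <-] := dF t.
  apply/derive_val/is_derive_near0.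
  apply/nbhs_ballP; exists (`|t| - A); first by rewrite /= subr_gt0.
  move=> s; rewrite /ball /= => ts; apply: F0.
  have := ler_normB (t - s) (- s); rewrite opprK subrK normrN; lra.
have -> : \int[lebesgue_measure]_t partial i f (x + t *: e i) =
    \int[lebesgue_measure]_(t in `[- A, A]) partial i f (x + t *: e i).
  rewrite [RHS]Rintegral_mkcond; apply: eq_Rintegral => t _.
  rewrite patchE; case: ifPn => // /negP tA; apply: dF0.
  rewrite ltNge; apply: contra_notN tA => tA.
  by apply/mem_set; rewrite /= in_itv /= -ler_norml.
have FA : F A = 0 by apply: F0; rewrite ger0_norm // ltW.
have FNA : F (- A) = 0 by apply: F0; rewrite normrN ger0_norm // ltW.
rewrite /Rintegral (@continuous_FTC2 _ _ F).
- by rewrite FA FNA /= subrr.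
- by rewrite (lt_trans _ A0) // oppr_lt0.
- apply: continuous_subspaceT => t.
  have cl : {for t, continuous (fun s : R => x + s *: e i)}.
    by apply: continuousD; [exact: cst_continuous|exact: scalel_continuous].
  have h : {for t, continuous (partial i f \o (fun s : R => x + s *: e i))}.
    by apply: continuous_comp => //; exact: cdf.
  exact: h.
- split; first by move=> t _; have [] := dF t.
  + by apply: cvg_at_right_filter; exact: cF.
  + by apply: cvg_at_left_filter; exact: cF.
- by move=> t _; rewrite derive1E; have [_ ->] := dF t.
Qed.

Lemma continuous_supported_bounded f : continuous f -> compactly_supported f ->
  exists2 M : R, 0 < M & forall x, `|f x| <= M.
Proof.
move=> cf [M M0 fM].
pose K := [set x : 'rV[R]_n | forall i, x ord0 i \in `[- M, M]].
have cK : compact K.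
  apply: (@rV_compact _ _ (fun=> `[- M, M]%classic)) => i.
  exact: segment_compact.
have : bounded_set (f @` K).
  apply: compact_bounded; apply: continuous_compact => //.
  exact: continuous_subspaceT.
move=> [C [_ fC]]; exists (`|C| + 1); first by rewrite ltr_wpDl.
move=> x; have [->|/fM fx] := eqVneq (f x) 0; first by rewrite normr0 addr_ge0.
apply: fC; first by rewrite ltr_pwDr // ler_norm.
exists x => // i; move: fx; rewrite ball_rVE // => /(_ i).
by rewrite !mxE sub0r normrN in_itv /= -ler_norml => /ltW.
Qed.

(** Fubini with the line of integration in direction i innermost. *)
Lemma integral_partial f i : C1 f -> compactly_supported f ->
  \int[lambda]_x partial i f x = 0.
Proof.
move=> f1 fs; have [M M0 fM] := fs; have [cf /(_ i)[cdf _]] := f1.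
have dfM := @partial_supported f M i fM.
have M1 : 0 < M + 1 by rewrite addr_gt0.
have [C C0 dfC] := continuous_supported_bounded cdf (ex_intro2 _ _ (M + 1) M1 dfM).
apply: (@Rintegral_lines_eq0 _ _ i _ (M + 1 + C)) => //.
- by rewrite addr_gt0.
- exact: continuous_measurable_rV.
- by move=> x; apply: le_trans (dfC x) _; rewrite lerDr ltW.
- move=> x /dfM; apply: le_ball; by rewrite lerDl ltW.
- by move=> x; exact: C1_lines.
Qed.

Lemma test_C1 Omega f : test_function Omega f -> C1 f.
Proof.
move=> [sf _ _]; split; first by have [] := sf [::].
by move=> i; split; [have [] := sf [:: i]|exact: (sf [::]).2].
Qed.

Lemma test_supported Omega f : test_function Omega f -> compactly_supported f.
Proof.
move=> [_ /compact_bounded [M [_ fM]] _].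
exists (`|M| + 2); first by rewrite ltr_wpDl.
move=> x fx; have : `|x| <= `|M| + 1.
  apply: fM; first by rewrite ltr_pwDr // ler_norm.
  exact: subset_closure.
by rewrite mx_norm_ball /ball_ /= sub0r normrN => /le_lt_trans; apply; lra.
Qed.

Lemma test_outside Omega f x : test_function Omega f -> ~ Omega x -> f x = 0.
Proof.
move=> [_ _ fO] Ox; apply/eqP; apply: contra_notT Ox => fx.
exact/fO/subset_closure.
Qed.

Lemma partial_outside Omega i f x : test_function Omega f -> ~ Omega x ->
  partial i f x = 0.
Proof.
move=> [_ _ fO] Ox; suff f0 : \forall y \near x, f y = 0.
  by have [] := is_derive_near0 (e i) f0.
apply: contrapT => nf0; apply/Ox/fO => B Bx; apply: contrapT => h; apply: nf0.
apply: filterS Bx => y By; apply/eqP; apply: contra_notT h => fy.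
by exists y.
Qed.

Lemma test_measurable Omega f D : test_function Omega f -> measurable_fun D f.
Proof.
move=> /test_C1[cf _].
by apply: measurable_funTS; exact: continuous_measurable_rV.
Qed.

Lemma partial_measurable Omega i f D : test_function Omega f ->
  measurable_fun D (partial i f).
Proof.
move=> /test_C1[_ /(_ i)[cf _]].
by apply: measurable_funTS; exact: continuous_measurable_rV.
Qed.

Lemma test_bounded Omega f : test_function Omega f ->
  exists2 M : R, 0 < M & forall x, `|f x| <= M.
Proof.
move=> tf; apply: continuous_supported_bounded (test_supported tf).
by have [] := test_C1 tf.
Qed.

Lemma partial_bounded Omega i f : test_function Omega f ->
  exists2 M : R, 0 < M & forall x, `|partial i f x| <= M.
Proof.
move=> tf; apply: continuous_supported_bounded.
  by have [_ /(_ i)[]] := test_C1 tf.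
have [M M0 fM] := test_supported tf.
by exists (M + 1); [rewrite addr_gt0|exact: partial_supported].
Qed.

(** The product with the test function f is compactly supported whatever g
    does at the boundary, so polynomials are allowed as g. *)
Lemma test_by_parts Omega f g i : test_function Omega f -> C1 g ->
  \int[lambda]_(x in Omega) (f x * partial i g x + g x * partial i f x) = 0.
Proof.
move=> tf g1; have [fg1 fgE] := C1_mul (test_C1 tf) g1.
have [M M0 fM] := test_supported tf.
have := integral_partial i fg1; rewrite fgE => h.
rewrite -[RHS]h; last first.
  by exists M => // x; rewrite mulf_eq0 negb_or => /andP[/fM].
rewrite Rintegral_mkcond; apply: eq_Rintegral => x _; rewrite patchE.
case: ifPn => // /negP xO; have {}xO : ~ Omega x by move=> /mem_set.
by rewrite (test_outside tf xO) (partial_outside i tf xO) mulr0 mul0r addr0.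
Qed.

End compact_support.

(** * The space H^1_0 *)
Section sobolev_theory.
Context (R : realType) (n : nat).
Local Notation e i := (delta_mx ord0 i : 'rV[R]_n).
Local Notation lambda := (lebesgue_rV R n).
Context (Omega : set 'rV[R]_n) (mO : measurable Omega).
Hypothesis bO : exists M, Omega `<=` ball 0 M.
Implicit Types (u v f g : 'rV[R]_n -> R) (Du Dv : 'rV[R]_n -> 'rV[R]_n).

Local Notation sqint := (sqint lambda Omega).
Local Notation ip := (ip lambda Omega).
Local Notation sqcvg := (sqcvg lambda Omega).

Lemma bounded_finite : (lambda Omega < +oo)%E.
Proof.
have [M OM] := bO; have OM1 : Omega `<=` ball 0 (`|M| + 1).
  apply: subset_trans OM _; apply: le_ball.
  by rewrite (le_trans (ler_norm _)) // lerDl.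
have M1 : 0 < `|M| + 1 by rewrite ltr_wpDl.
apply: (@le_lt_trans _ _ (lambda (ball 0 (`|M| + 1)))).
  by apply: le_measure; rewrite ?inE //; exact: measurable_ball_rV.
by rewrite [X in (X < _)%E]lebesgue_ball_rV // ltry.
Qed.

Lemma sqint_peval p : sqint (peval p).
Proof.
have [M OM] := bO; have [C pC] := peval_bounded p M.
apply: (sqint_bounded mO bounded_finite (M := C)).
  exact: measurable_peval.
by move=> x /OM; exact: pC.
Qed.

Lemma sqint_test f : test_function Omega f -> sqint f.
Proof.
move=> tf; have [C _ fC] := test_bounded tf.
apply: (sqint_bounded mO bounded_finite (M := C)) => //.
exact: test_measurable tf.
Qed.

Lemma sqint_partial i f : test_function Omega f -> sqint (partial i f).
Proof.
move=> tf; have [C _ fC] := partial_bounded i tf.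
apply: (sqint_bounded mO bounded_finite (M := C)) => //.
exact: partial_measurable tf.
Qed.

Lemma H10_elim u Du : H10 Omega u Du -> [/\ sqint u,
  forall i, sqint (fun x => Du x ord0 i) &
  exists2 phi : ('rV[R]_n -> R)^nat, forall m, test_function Omega (phi m) &
    sqcvg phi u /\ forall i, sqcvg (fun m => partial i (phi m)) (fun x => Du x ord0 i)].
Proof.
move=> [[u2 Du2] [phi tphi [phiu phiDu]]].
have Du2' i : sqint (fun x => Du x ord0 i) by have [] := Du2 i.
split=> //; exists phi => //; split.
  exact/(sqcvgE mO (fun m => sqint_test (tphi m)) u2).
move=> i; apply/(sqcvgE mO (fun m => sqint_partial i (tphi m)) (Du2' i)).
exact: phiDu.
Qed.

Lemma test_by_parts_ip f g i : test_function Omega f -> C1 g -> sqint g ->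
  sqint (partial i g) -> ip (partial i f) g = - ip f (partial i g).
Proof.
move=> tf g1 g2 dg2; have := test_by_parts i tf g1.
have f2 := sqint_test tf; have df2 := sqint_partial i tf.
rewrite RintegralD //; try exact: sqintM.
move=> /eqP; rewrite addrC addr_eq0 => /eqP E.
by rewrite ipC [LHS]E.
Qed.

(** Limits of test functions automatically have the limit of the gradients as
    weak gradient, since integration by parts passes to the limit. *)
Lemma H10_intro u Du (phi : ('rV[R]_n -> R)^nat) : sqint u ->
  (forall i, sqint (fun x => Du x ord0 i)) ->
  (forall m, test_function Omega (phi m)) -> sqcvg phi u ->
  (forall i, sqcvg (fun m => partial i (phi m)) (fun x => Du x ord0 i)) ->
  H10 Omega u Du.
Proof.
move=> u2 Du2 tphi phiu phiDu; split; last first.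
  exists phi => //; split.
    exact/(sqcvgE mO (fun m => sqint_test (tphi m)) u2).
  move=> i; apply/(sqcvgE mO (fun m => sqint_partial i (tphi m)) (Du2 i)).
  exact: phiDu.
split=> // i; split=> [|psi tpsi]; first exact: Du2.
have psi2 := sqint_test tpsi; have dpsi2 := sqint_partial i tpsi.
have h1 := ip_cvg mO (fun m => sqint_test (tphi m)) u2 dpsi2 phiu.
have h2 := ip_cvg mO (fun m => sqint_partial i (tphi m)) (Du2 i) psi2 (phiDu i).
have h3 : ip (phi m) (partial i psi) @[m --> \oo] -->
    - ip (fun x => Du x ord0 i) psi.
  rewrite (_ : (fun m => _) = - (fun m => ip (partial i (phi m)) psi)).
    exact: cvgN.
  apply/funext => m; transitivity (- ip (partial i (phi m)) psi) => //.
  by rewrite test_by_parts_ip ?opprK //; exact: test_C1 tpsi.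
exact: (norm_cvg_unique h1 h3).
Qed.

Lemma H10_by_parts u Du p i : H10 Omega u Du ->
  ip (fun x => Du x ord0 i) (peval p) = - ip u (peval (mderiv i p)).
Proof.
move=> /H10_elim[u2 Du2 [phi tphi [phiu phiDu]]].
have h1 := ip_cvg mO (fun m => sqint_test (tphi m)) u2 (sqint_peval (mderiv i p)) phiu.
have h2 := ip_cvg mO (fun m => sqint_partial i (tphi m)) (Du2 i) (sqint_peval p) (phiDu i).
have h3 : ip (partial i (phi m)) (peval p) @[m --> \oo] -->
    - ip u (peval (mderiv i p)).
  rewrite (_ : (fun m => _) = - (fun m => ip (phi m) (peval (mderiv i p)))).
    exact: cvgN.
  apply/funext => m; transitivity (- ip (phi m) (peval (mderiv i p))) => //.
  rewrite -partial_peval test_by_parts_ip //.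
  - exact: C1_peval.
  - exact: sqint_peval.
  - by rewrite partial_peval; exact: sqint_peval.
exact: (norm_cvg_unique h2 h3).
Qed.

(** A diagonal argument: replace the m-th term by a test function at distance
    at most 1/(m+1). *)
Lemma H10_closed (un : ('rV[R]_n -> R)^nat) (Dun : ('rV[R]_n -> 'rV[R]_n)^nat) u Du :
  (forall m, H10 Omega (un m) (Dun m)) -> sqint u ->
  (forall i, sqint (fun x => Du x ord0 i)) -> sqcvg un u ->
  (forall i, sqcvg (fun m x => Dun m x ord0 i) (fun x => Du x ord0 i)) ->
  H10 Omega u Du.
Proof.
move=> hun u2 Du2 unu Dunu.
have un2 m : sqint (un m) by have [] := H10_elim (hun m).
have Dun2 m i : sqint (fun x => Dun m x ord0 i) by have [] := H10_elim (hun m).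
have /choice[phi hphi] : forall m, exists f, [/\ test_function Omega f,
    ip (fun x => f x - un m x) (fun x => f x - un m x) <= m.+1%:R^-1 &
    forall i, ip (fun x => partial i f x - Dun m x ord0 i)
      (fun x => partial i f x - Dun m x ord0 i) <= m.+1%:R^-1].
  move=> m; have [_ _ [psi tpsi [psiu psiDu]]] := H10_elim (hun m).
  have m0 : (0 : R) < m.+1%:R^-1 by rewrite invr_gt0.
  have h1 : \forall k \near \oo,
      `|ip (fun x => psi k x - un m x) (fun x => psi k x - un m x)| <= m.+1%:R^-1.
    exact: ((cvgr0Pnorm_le _).1 psiu _ m0).
  have h2 : \forall k \near \oo, forall i : 'I_n,
      `|ip (fun x => partial i (psi k) x - Dun m x ord0 i)
        (fun x => partial i (psi k) x - Dun m x ord0 i)| <= m.+1%:R^-1.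
    apply: filter_forall => i; exact: ((cvgr0Pnorm_le _).1 (psiDu i) _ m0).
  have [k [hk1 hk2]] := filter_ex (filterI h1 h2).
  exists (psi k); split => //.
    by move: hk1; rewrite /= ger0_norm // ip_ge0.
  by move=> i; have := hk2 i; rewrite ger0_norm // ip_ge0.
have tphi m : test_function Omega (phi m) by case: (hphi m).
apply: (H10_intro u2 Du2 tphi).
  apply: (sqcvg_near mO un2 _ u2 unu) => m; first exact: sqint_test.
  by case: (hphi m).
move=> i; apply: (sqcvg_near mO (fun m => Dun2 m i) _ (Du2 i) (Dunu i)) => m.
  exact: sqint_partial.
by case: (hphi m).
Qed.

End sobolev_theory.

(** * Flat functions *)

Section flat_functions.
Context (R : realType).
Implicit Types (q : {poly R}) (s y : R).

(** For q = 1 this is the classical smooth function exp(-1/s) on s > 0, flat at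
    0.  Carrying a polynomial in 1/s makes the family closed under derivation,
    by [is_derive_flat]. *)
Definition flat q s := if 0 < s then q.[s^-1] * expR (- s^-1) else 0.

Lemma poly_expR_bound q k : exists2 C, 0 <= C &
  forall y, 0 <= y -> `|q.[y]| * y ^+ k * expR (- y) <= C.
Proof.
elim/poly_ind: q k => [|q c IH] k.
  by exists 0 => // y _; rewrite horner0 normr0 !mul0r.
have [C C0 hC] := IH k.+1.
exists (C + `|c| * k`!%:R); first by rewrite addr_ge0 // mulr_ge0.
move=> y y0; rewrite !hornerE.
have e0 := expR_gt0 (- y); have yk : 0 <= y ^+ k by exact: exprn_ge0.
apply: (@le_trans _ _ ((`|q.[y]| * y + `|c|) * y ^+ k * expR (- y))).
  rewrite ler_pM2r // ler_wpM2r // (le_trans (ler_normD _ _)) // normrM.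
  by rewrite (ger0_norm y0).
rewrite mulrDl mulrDl; apply: lerD; first by rewrite -[_ * y * _]mulrA -exprS; exact: hC.
rewrite -mulrA ler_wpM2l // expRN ler_pdivrMr ?expR_gt0 //.
case: k {hC yk} => [|k].
  by rewrite expr0 fact0 mul1r; have := expR_ge1Dx y; lra.
rewrite -ler_pdivrMl ?ltr0n ?fact_gt0 // mulrC.
by have := expR_ge1Dxn k y0; lra.
Qed.

Lemma flat_bound q : exists2 C, 0 <= C & forall s, `|flat q s| <= C * s ^+ 2.
Proof.
have [C C0 hC] := poly_expR_bound q 2; exists C => // s; rewrite /flat.
case: ifPn => [s0|_]; last by rewrite normr0 mulr_ge0 // sqr_ge0.
have si : 0 <= s^-1 by rewrite invr_ge0 ltW.
rewrite normrM (ger0_norm (expR_ge0 _)) -ler_pdivrMr ?exprn_gt0 // -exprVn.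
by rewrite mulrAC; exact: hC.
Qed.

(** At 0 the quadratic bound [flat_bound] makes the difference quotient
    vanish. *)
Lemma is_derive_flat q s : is_derive s 1 (flat q) (flat ('X^2 * (q - q^`())) s).
Proof.
have [s0|s0|s0] := ltgtP s 0.
- rewrite {2}/flat lt_gtF //; apply: is_derive_near0.
  near=> t; rewrite /flat lt_gtF //.
  by near: t; exact: lt_nbhsl.
- rewrite {2}/flat s0.
  have dV : is_derive s (1 : R) (fun t : R => t^-1) (- s^-1 ^+ 2).
    apply: is_derive_eq; first by apply: is_deriveV; rewrite gt_eqF.
    by rewrite [LHS]mulr1 exprVn.
  have dq : is_derive s (1 : R) (fun t : R => q.[t^-1]) (q^`().[s^-1] * (- s^-1 ^+ 2)).
    by apply: (is_derive_chain dV).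
  have de : is_derive s (1 : R) (fun t : R => expR (- t^-1)) (expR (- s^-1) * - (- s^-1 ^+ 2)).
    by apply: (@is_derive_chain _ _ expR (fun t : R => - t^-1)); exact: is_deriveN.
  have := is_derive_mulr dq de; rewrite /= => h; apply: (near_eq_is_derive _ (is_derive_eq h _)).
    by near=> t; rewrite /flat ifT //; near: t; exact: lt_nbhsr.
  by rewrite hornerM hornerXn hornerD hornerN; ring.
- have [C C0 hC] := flat_bound q.
  have F0 : flat q 0 = 0 by rewrite /flat ltxx.
  have -> : flat ('X^2 * (q - q^`())) s = 0 by rewrite s0 /flat ltxx.
  rewrite s0.
  have h : (fun h : R => h^-1 *: ((flat q \o shift 0) (h *: 1) - flat q 0)) @ 0^' --> (0 : R).
    apply/cvgr0Pnorm_le => e e0 /=.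
    near=> h; rewrite F0 subr0 addr0 [h *: 1]mulr1.
    have hn0 : h != 0 by near: h; exact: nbhs_dnbhs_neq.
    rewrite normrM normfV mulrC ler_pdivrMr ?normr_gt0 //.
    apply: le_trans (hC h) _; rewrite -real_normK ?num_real // expr2 mulrA.
    rewrite ler_pM2r ?normr_gt0 //.
    have : `|h| < e / (C + 1).
      near: h; apply: dnbhs0_lt; rewrite divr_gt0 // ltr_wpDl //.
    rewrite ltr_pdivlMr ?ltr_wpDl //.
    have := normr_ge0 h; nra.
  by split; [apply/cvg_ex; exists 0|exact/cvg_lim].
Unshelve. all: by end_near. Qed.

Lemma continuous_flat q : continuous (flat q).
Proof.
move=> s; apply: differentiable_continuous; apply/derivable1_diffP.
by have [] := is_derive_flat q s.
Qed.

End flat_functions.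

Section flat_combinations.
Context (R : realType) (n : nat).
Local Notation e i := (delta_mx ord0 i : 'rV[R]_n).
Variable (sigma : mpoly n R).
Implicit Types (l : seq ({poly R} * mpoly n R)).

(** A family of functions containing the cutoffs below and stable under partial
    derivatives: [dflat_comb] lists the terms of the derivative.  Smoothness of
    its members is an induction on the list of derivatives. *)
Definition flat_comb l (x : 'rV[R]_n) :=
  \sum_(c <- l) flat c.1 (peval sigma x) * peval c.2 x.

Definition dflat_comb i l := flatten [seq [:: ('X^2 * (c.1 - c.1^`()), mderiv i sigma * c.2);
  (c.1, mderiv i c.2)] | c <- l].

Lemma is_derive_flat_comb i l x : is_derive x (e i) (flat_comb l) (flat_comb (dflat_comb i l) x).
Proof.
elim: l => [|[q p] l IH].
  rewrite (_ : flat_comb [::] = cst 0).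
    exact: is_derive_cst.
  by apply/funext => y; rewrite /flat_comb big_nil.
have -> : flat_comb ((q, p) :: l) =
    (fun y => flat q (peval sigma y) * peval p y) \+ flat_comb l.
  by apply/funext => y; rewrite /flat_comb big_cons.
have -> : flat_comb (dflat_comb i ((q, p) :: l)) x =
    (flat q (peval sigma x) * peval (mderiv i p) x + peval p x *
     (flat ('X^2 * (q - q^`())) (peval sigma x) * peval (mderiv i sigma) x))
     + flat_comb (dflat_comb i l) x.
  by rewrite /flat_comb /dflat_comb /= !big_cons pevalM; ring.
apply: is_deriveD IH; apply: is_derive_mulr; last exact: is_derive_peval.
apply: is_derive_chain; [exact: is_derive_peval|exact: is_derive_flat].
Qed.

Lemma partial_flat_comb i l : partial i (flat_comb l) = flat_comb (dflat_comb i l).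
Proof. by apply/funext => x; have [_ <-] := is_derive_flat_comb i l x. Qed.

Lemma continuous_flat_comb l : continuous (flat_comb l).
Proof.
elim: l => [|[q p] l IH].
  rewrite (_ : flat_comb [::] = cst 0); first exact: cst_continuous.
  by apply/funext => y; rewrite /flat_comb big_nil.
have -> : flat_comb ((q, p) :: l) = ((flat q \o peval sigma) \* peval p) \+ flat_comb l.
  by apply/funext => y; rewrite /flat_comb big_cons.
move=> x; apply: continuousD; last exact: IH.
apply: continuousM; last exact: continuous_peval.
by apply: continuous_comp; [exact: continuous_peval|exact: continuous_flat].
Qed.

Lemma smooth_flat_comb l : smooth (flat_comb l).
Proof.
move=> s; have [l' ->] : exists l', foldr (@partial R n) (flat_comb l) s = flat_comb l'.
  elim: s => [|i s [l' /= ->]]; first by exists l.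
  by exists (dflat_comb i l'); rewrite partial_flat_comb.
split; first exact: continuous_flat_comb.
by move=> i x; have [] := is_derive_flat_comb i l' x.
Qed.

End flat_combinations.

(** * Multiples of rho belong to H^1_0 of the ball *)
Section unit_ball_theory.
Context (R : realType) (n : nat).
Local Notation e i := (delta_mx ord0 i : 'rV[R]_n).
Local Notation B := (unit_ball R n).
Local Notation lambda := (lebesgue_rV R n).
Local Notation rho := (rho R n).
Implicit Types (p : mpoly n R) (x : 'rV[R]_n).

Lemma peval_rho x : peval rho x = 1 - \sum_i x ord0 i ^+ 2.
Proof. exact: meval_rho. Qed.

Lemma unit_ballE x : B x <-> 0 < peval rho x.
Proof. by rewrite peval_rho subr_gt0. Qed.

Lemma unit_ball_bounded : B `<=` ball 0 1.
Proof.
move=> x Bx; rewrite ball_rVE // => i; rewrite mxE sub0r normrN.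
rewrite -(@expr_lt1 _ 2) // real_normK ?num_real //; apply: le_lt_trans Bx.
by rewrite (bigD1 i) //= lerDl sumr_ge0 // => j _; exact: sqr_ge0.
Qed.

Lemma unit_ball_open : open B.
Proof.
rewrite (_ : B = peval rho @^-1` [set t | 0 < t]).
  by apply: open_comp => [x _|]; [exact: continuous_peval|exact: open_gt].
by apply/seteqP; split => x /unit_ballE.
Qed.

Lemma unit_ball_measurable : measurable B.
Proof. by apply: open_measurable_rV; exact: unit_ball_open. Qed.

Lemma unit_ball0 : B 0.
Proof. by rewrite /unit_ball /= big1 // => i _; rewrite mxE expr0n. Qed.

Lemma rho_le1 x : peval rho x <= 1.
Proof. by rewrite peval_rho gerBl sumr_ge0 // => i _; exact: sqr_ge0. Qed.

Section cutoff.
Variables (r p : mpoly n R) (d : R).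
Hypothesis d0 : 0 < d.

(** With s = (rho - d) / d the cutoff of rho p is exp(-1/s) (rho - d) p.  The
    factor rho - d, small where the cutoff varies, keeps the gradient bounded
    uniformly in d. *)
Definition cutoff_arg : mpoly n R := d^-1 *: (r - mpolyC n d).
Definition cutoff := flat_comb cutoff_arg [:: (1%:P, (r - mpolyC n d) * p)].

Lemma cutoff_argE x : peval cutoff_arg x = (peval r x - d) / d.
Proof. by rewrite pevalZ pevalB pevalC mulrC. Qed.

Lemma cutoffE x :
  cutoff x = flat 1%:P ((peval r x - d) / d) * (peval r x - d) * peval p x.
Proof.
by rewrite /cutoff /flat_comb big_seq1 /= cutoff_argE pevalM pevalB pevalC mulrA.
Qed.

Lemma cutoff_support x : peval r x < d -> cutoff x = 0.
Proof.
move=> rd; rewrite cutoffE /flat ifF ?mul0r //; apply/negbTE; rewrite -leNgt.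
by rewrite ler_pdivrMr // mul0r subr_le0 ltW.
Qed.

(** The derivative of exp(-1/s) is exp(-1/s) / s^2 and rho - d = s d, which
    cancels the factor 1/d of the chain rule and leaves exp(-1/s) / s, the flat
    function of 'X, bounded by 1. *)
Lemma partial_cutoffE i x : partial i cutoff x =
  flat 'X ((peval r x - d) / d) * peval (mderiv i r * p) x +
  flat 1%:P ((peval r x - d) / d) *
    (peval (mderiv i r * p) x + (peval r x - d) * peval (mderiv i p) x).
Proof.
rewrite /cutoff partial_flat_comb /flat_comb /dflat_comb /= !big_cons big_nil /= cutoff_argE addr0.
have dn0 : d != 0 by rewrite gt_eqF.
rewrite derivC subr0 mulr1 mderivM mderivB mderivC subr0 /cutoff_arg.
rewrite mderivZ mderivB mderivC subr0 !(pevalM, pevalD, pevalN, pevalZ, pevalC).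
congr (_ + _); rewrite /flat; case: ifPn => [s0|_]; last by rewrite !mul0r.
rewrite hornerXn hornerX.
set s := (peval r x - d) / d in s0 *.
have -> : peval r x - d = s * d by rewrite divfK.
have sn0 : s != 0 by rewrite gt_eqF.
by field; rewrite sn0 dn0.
Qed.

End cutoff.

Lemma test_cutoff p d : 0 < d -> test_function B (cutoff rho p d).
Proof.
move=> d0; set S := [set x | cutoff rho p d x != 0].
have SK : closure S `<=` [set x | d <= peval rho x].
  have -> : [set x | d <= peval rho x] = closure [set x | d <= peval rho x].
    apply/closure_id; rewrite (_ : [set x | _] = peval rho @^-1` [set t | d <= t]) //.
    by apply: closed_comp => [x _|]; [exact: continuous_peval|exact: closed_ge].
  apply: closureS => x; rewrite /S /=; apply: contra_neqT; rewrite -ltNge.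
  exact: cutoff_support.
have SB : closure S `<=` B.
  by move=> x /SK /= dx; apply/unit_ballE; exact: lt_le_trans dx.
split; first exact: smooth_flat_comb.
- apply: bounded_closed_compact; last exact: closed_closure.
  exists 1; split; first exact: num_real.
  move=> y y1 x /SB /unit_ball_bounded; rewrite mx_norm_ball /ball_ /= sub0r normrN.
  by move=> x1; apply/ltW; exact: lt_trans y1.
- exact: SB.
Qed.

Lemma flat1_le s : `|flat (1%:P : {poly R}) s| <= 1.
Proof.
rewrite /flat; case: ifPn => [s0|_]; last by rewrite normr0.
rewrite hornerC mul1r ger0_norm ?expR_ge0 // -[leRHS]expR0 ler_expR.
by rewrite oppr_le0 invr_ge0 ltW.
Qed.

Lemma flatX_le s : `|flat ('X : {poly R}) s| <= 1.
Proof.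
rewrite /flat; case: ifPn => [s0|_]; last by rewrite normr0.
have si : 0 <= s^-1 by rewrite invr_ge0 ltW.
rewrite hornerX ger0_norm ?mulr_ge0 ?expR_ge0 // expRN ler_pdivrMr ?expR_gt0 //.
by have := expR_ge1Dx s^-1; lra.
Qed.

(* The levels d of the cutoffs. *)
Let level (m : nat) : R := m.+1%:R^-1.

Let level_gt0 m : 0 < level m. Proof. by rewrite invr_gt0. Qed.
Let level_le1 m : level m <= 1. Proof. by rewrite invf_le1 // ler1n. Qed.
Let level_cvg : level m @[m --> \oo] --> (0 : R). Proof. exact: cvg_harmonic. Qed.

(** With s = (r - d) / d the argument 1/s tends to 0 as d does. *)
Lemma flat_cvg (q : {poly R}) (r : R) : 0 < r ->
  flat q ((r - level m) / level m) @[m --> \oo] --> q.[0].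
Proof.
move=> r0.
have h : (level m / (r - level m)) @[m --> \oo] --> (0 : R).
  rewrite -[X in _ --> X](mul0r (r - 0)^-1); apply: cvgM; first exact: level_cvg.
  apply: cvgV; first by rewrite subr0 gt_eqF.
  by apply: cvgB; [exact: cvg_cst|exact: level_cvg].
have h2 : q.[level m / (r - level m)] * expR (- (level m / (r - level m))) @[m --> \oo] --> q.[0].
  rewrite -[X in _ --> X]mulr1 -expR0 -[X in expR X]oppr0; apply: cvgM.
    by apply: continuous_cvg => //; exact: continuous_horner.
  apply: continuous_cvg; first exact: continuous_expR.
  exact: cvgN.
apply: cvg_trans h2; apply: near_eq_cvg; near=> m.
have dr : level m < r.
  by near: m; apply: (cvgr_lt _ level_cvg).
rewrite /flat ifT; last by rewrite divr_gt0 // subr_gt0.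
by rewrite invf_div.
Unshelve. all: by end_near. Qed.

Definition pgrad p (x : 'rV[R]_n) : 'rV[R]_n := \row_i peval (mderiv i p) x.

(** The cutoffs at levels 1/(m+1) and their partial derivatives are uniformly
    bounded and converge pointwise, so dominated convergence applies. *)
Lemma H10_rho p : H10 B (peval (rho * p)) (pgrad (rho * p)).
Proof.
have mB := unit_ball_measurable.
have bB : exists M : R, B `<=` ball 0 M by exists 1; exact: unit_ball_bounded.
have gE i : (fun x => pgrad (rho * p) x ord0 i) = peval (mderiv i (rho * p)).
  by apply/funext => x; rewrite mxE.
pose phi m := cutoff rho p (level m).
have tphi m : test_function B (phi m) by exact: test_cutoff.
have rE x : peval (rho * p) x = peval rho x * peval p x by exact: pevalM.
have drE i x : peval (mderiv i (rho * p)) x =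
    peval (mderiv i rho * p) x + peval rho x * peval (mderiv i p) x.
  by rewrite mderivM (pevalD (mderiv i rho * p)) (pevalM rho).
have bnd q : exists C : R, forall x, B x -> `|peval q x| <= C.
  have [C hC] := peval_bounded q 1; exists C => x /unit_ball_bounded; exact: hC.
apply: (H10_intro mB bB (phi := phi)) => //.
- exact: sqint_peval.
- by move=> i; rewrite gE; exact: sqint_peval.
- have [C hC] := bnd p.
  apply: (sqcvg_dominated mB (g := fun=> 2 * C)).
  + by move=> m; exact: test_measurable (tphi m).
  + exact: measurable_peval.
  + by apply: sqint_cst => //; exact: bounded_finite.
  + move=> x /unit_ballE r0; rewrite rE /phi.
    under eq_fun do rewrite cutoffE //.
    have -> : peval rho x * peval p x = (1%:P : {poly R}).[0] * (peval rho x - 0) * peval p x.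
      by rewrite hornerC subr0 mul1r.
    apply: cvgM; last exact: cvg_cst.
    apply: cvgM; first exact: flat_cvg.
    by apply: cvgB; [exact: cvg_cst|exact: level_cvg].
  + move=> m x Bx; have := hC _ Bx; rewrite /phi cutoffE // rE.
    have r0 := (unit_ballE x).1 Bx; have r1 := rho_le1 x.
    have := flat1_le ((peval rho x - level m) / level m).
    have := level_gt0 m; have := level_le1 m.
    set s := (_ / _); set F := flat 1%:P s.
    move: {s} F (peval rho x) (peval p x) (level m) r0 r1 => F r q d r0 r1 d1 d0 F1 qC.
    rewrite -mulrBl normrM (ger0_norm (_ : 0 <= 2 * C)); last first.
      by rewrite mulr_ge0 // (le_trans (normr_ge0 _) qC).
    apply: ler_pM => //; apply: le_trans (ler_normB _ _) _; rewrite normrM.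
    rewrite -[2]/(1 + 1) lerD //; last by rewrite ger0_norm // ltW.
    rewrite -[1]mulr1; apply: ler_pM => //.
    by rewrite ler_norml; apply/andP; split; lra.
- move=> i; rewrite gE.
  have [C1 hC1] := bnd (mderiv i rho * p).
  have [C2 hC2] := bnd (mderiv i p).
  apply: (sqcvg_dominated mB (g := fun=> 3 * C1 + 2 * C2)).
  + by move=> m; exact: partial_measurable (tphi m).
  + exact: measurable_peval.
  + by apply: sqint_cst => //; exact: bounded_finite.
  + move=> x /unit_ballE r0; rewrite /phi.
    under eq_fun do rewrite partial_cutoffE //.
    have -> : peval (mderiv i (rho * p)) x =
        ('X : {poly R}).[0] * peval (mderiv i rho * p) x + (1%:P : {poly R}).[0] *
        (peval (mderiv i rho * p) x + (peval rho x - 0) * peval (mderiv i p) x).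
      by rewrite drE hornerC hornerX subr0; ring.
    apply: cvgD; apply: cvgM; try exact: flat_cvg; try exact: cvg_cst.
    apply: cvgD; first exact: cvg_cst.
    apply: cvgM; last exact: cvg_cst.
    by apply: cvgB; [exact: cvg_cst|exact: level_cvg].
  + move=> m x Bx; have := hC1 _ Bx; have := hC2 _ Bx; rewrite /phi partial_cutoffE //.
    have r0 := (unit_ballE x).1 Bx; have r1 := rho_le1 x.
    have := flat1_le ((peval rho x - level m) / level m).
    have := flatX_le ((peval rho x - level m) / level m).
    have := level_gt0 m; have := level_le1 m.
    rewrite drE.
    set s := (_ / _); set G := flat 'X s; set F := flat 1%:P s.
    move: {s} G F (peval rho x) (peval (_ * p) x) (peval (mderiv i p) x) (level m) r0 r1.
    move=> G F r a b d r0 r1 d1 d0 G1 F1 bC aC.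
    have a0 := normr_ge0 a; have b0 := normr_ge0 b.
    rewrite [leRHS]ger0_norm; last by lra.
    have -> : G * a + F * (a + (r - d) * b) - (a + r * b) =
      G * a + (F * a + (F * ((r - d) * b) + (- a + - (r * b)))) by ring.
    have le1 (s t : R) : `|s| <= 1 -> `|s * t| <= `|t|.
      by move=> s1; rewrite normrM ler_piMl.
    have rd1 : `|r - d| <= 1 by rewrite ler_norml; apply/andP; split; lra.
    have r1' : `|r| <= 1 by rewrite ger0_norm // ltW.
    have h1 := le1 G a G1; have h2 := le1 F a F1.
    have h3 := le_trans (le1 F ((r - d) * b) F1) (le1 (r - d) b rd1).
    have h4 := le1 r b r1'.
    apply: le_trans (ler_normD _ _) _.
    have := ler_normD (F * a) (F * ((r - d) * b) + (- a + - (r * b))).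
    have := ler_normD (F * ((r - d) * b)) (- a + - (r * b)).
    have := ler_normD (- a) (- (r * b)); rewrite !normrN; lra.
Qed.

End unit_ball_theory.

(** * Polynomial steps *)

Section power_step.
Context (R : realType).
Implicit Types (u s : R).

Lemma bernoulli_ge u m : 0 <= u -> 1 + m%:R * u <= (1 + u) ^+ m.
Proof.
move=> u0; elim: m => [|m IH]; first by rewrite mul0r addr0 expr0.
rewrite exprS; apply: (@le_trans _ _ ((1 + u) * (1 + m%:R * u))).
  have m0 : (0 : R) <= m%:R by [].
  by rewrite -natr1; nra.
by rewrite ler_wpM2l // addr_ge0.
Qed.

Lemma bernoulli_le u m : 0 <= u -> u <= 1 -> 1 - m%:R * u <= (1 - u) ^+ m.
Proof.
move=> u0 u1; elim: m => [|m IH]; first by rewrite mul0r subr0 expr0.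
rewrite exprS; apply: (@le_trans _ _ ((1 - u) * (1 - m%:R * u))).
  have m0 : (0 : R) <= m%:R by [].
  by rewrite -natr1; nra.
by rewrite ler_wpM2l // subr_ge0.
Qed.

(** A polynomial with values in [0, 1] tending to 1 when s < 1/2 and to 0 when
    s >= 1/2.  The exponents are those of the proof of the Stone-Weierstrass
    theorem by Brosowski and Deutsch: with N = m 2^m, the product N s^m is
    m (2 s)^m, which tends to 0 in the first case and is at least m in the
    second. *)
Definition pstep m s := (1 - s ^+ m) ^+ (m * 2 ^ m).

Lemma pstep_itv m s : 0 <= s -> s <= 1 -> 0 <= pstep m s <= 1.
Proof.
move=> s0 s1; have sm0 : 0 <= s ^+ m by exact: exprn_ge0.
have sm1 : s ^+ m <= 1 by exact: exprn_ile1.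
by apply/andP; split; [apply: exprn_ge0|apply: exprn_ile1]; lra.
Qed.

(** Bernoulli's inequality for (1 + h)^m with 1 + h = z^(-1/2), squared. *)
Lemma natr_geometric_cvg0 (z : R) : 0 <= z -> z < 1 -> m%:R * z ^+ m @[m --> \oo] --> (0 : R).
Proof.
move=> z0 z1; have [->|zn0] := eqVneq z 0.
  apply: cvg_near_cst; exists 1%N => // -[//|m] _; by rewrite /= expr0n mulr0.
have zp : 0 < z by rewrite lt_def zn0.
pose h := (Num.sqrt z)^-1 - 1.
have sz : 0 < Num.sqrt z by rewrite sqrtr_gt0.
have h0 : 0 < h by rewrite subr_gt0 invf_gt1 // -sqrtr1 ltr_sqrt.
have : (h ^+ 2)^-1 * harmonic m @[m --> \oo] --> (h ^+ 2)^-1 * (0:R).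
  by apply: cvgMl_tmp; exact: cvg_harmonic.
rewrite mulr0 => hc; rewrite -cvg_shiftS; move: hc; apply: squeeze_cvgr (cvg_cst 0).
apply: nearW => m; rewrite mulr_ge0 ?exprn_ge0 //=.
have h1E : 1 + h = (Num.sqrt z)^-1 by rewrite /h; ring.
have := @bernoulli_ge h m.+1 (ltW h0); rewrite h1E => hb.
have zE : z ^+ m.+1 = ((Num.sqrt z)^-1 ^+ m.+1) ^- 2.
  by rewrite !exprVn invrK -exprM mulnC exprM sqr_sqrtr.
have mh : m.+1%:R * h <= (Num.sqrt z)^-1 ^+ m.+1 by lra.
have mp : 0 < m.+1%:R * h by rewrite mulr_gt0.
rewrite zE ler_pdivrMr ?exprn_gt0 ?invr_gt0 // /harmonic.
apply: (@le_trans _ _ ((h ^+ 2)^-1 * m.+1%:R^-1 * (m.+1%:R * h) ^+ 2)).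
  have c0 : (m.+1%:R : R) != 0 by rewrite pnatr_eq0.
  have hn0 : h != 0 by rewrite gt_eqF.
  rewrite le_eqVlt; apply/orP; left; apply/eqP.
  by move: (m.+1%:R : R) c0 => c c0; field; rewrite c0 hn0.
by rewrite ler_wpM2l ?mulr_ge0 ?invr_ge0 ?sqr_ge0 // lerXn2r // nnegrE ltW // (lt_le_trans mp).
Qed.

(** Bernoulli from below in the first case; in the second,
    (1 - u)^N (1 + u)^N <= 1 and (1 + u)^N >= 1 + N u >= m. *)
Lemma pstep_cvg s : 0 <= s -> s <= 1 ->
  pstep m s @[m --> \oo] --> ((s < 2^-1)%R%:R : R).
Proof.
move=> s0 s1.
have E m : (m * 2 ^ m)%:R * s ^+ m = m%:R * (2 * s) ^+ m :> R.
  by rewrite natrM natrX exprMn mulrA.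
have [s2|s2] := ltP s 2^-1.
  have c : 1 - m%:R * (2 * s) ^+ m @[m --> \oo] --> (1 - 0 : R).
    by apply: cvgB; [exact: cvg_cst|apply: natr_geometric_cvg0; lra].
  rewrite subr0 in c.
  change (pstep m s @[m --> \oo] --> (1 : R)).
  apply: (squeeze_cvgr (h := fun=> 1) _ c); last exact: cvg_cst.
  apply: nearW => m.
  have /andP[_ ->] := pstep_itv m s0 s1; rewrite andbT -E.
  by apply: bernoulli_le; [exact: exprn_ge0|exact: exprn_ile1].
change (pstep m s @[m --> \oo] --> (0 : R)); rewrite -cvg_shiftS.
have := @cvg_harmonic R; apply: squeeze_cvgr (cvg_cst 0); apply: nearW => m.
have /andP[-> _] := pstep_itv m.+1 s0 s1; rewrite /harmonic /=.
set N := (m.+1 * 2 ^ m.+1)%N; set u := s ^+ m.+1.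
have u0 : 0 <= u by exact: exprn_ge0.
have u1 : u <= 1 by exact: exprn_ile1.
have Nu : m.+1%:R <= N%:R * u.
  rewrite E -[leLHS]mulr1 ler_wpM2l // exprn_ege1 //; lra.
have P0 : 0 <= (1 - u) ^+ N by apply: exprn_ge0; lra.
have : (1 - u) ^+ N * (1 + u) ^+ N <= 1.
  by rewrite -exprMn; apply: exprn_ile1; nra.
have := @bernoulli_ge u N u0; rewrite /pstep -/N -/u.
move: ((1 - u) ^+ N) ((1 + u) ^+ N) P0 => a b a0 hb hab.
rewrite -[leRHS]mul1r ler_pdivlMr ?ltr0n //.
have m1 : (0 : R) <= m.+1%:R by [].
by nra.
Qed.

End power_step.

Import HBNNSimple.

(** * Density of an algebra of functions in L^2 *)

(** Alg is an algebra of functions on T' and X a measurable map into T'; the aim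
    is to approximate k \o X by elements of Alg composed with X, for every
    measurable k.  Two instances are needed: X the identity of R^n, and X a
    linear form, where only functions of that form are approximated. *)
Section density.
Context d (T : measurableType d) (R : realType) (mu : {measure set T -> \bar R}).
Context (D : set T) (mD : measurable D) (Dfin : (mu D < +oo)%E).
Context d' (T' : measurableType d') (X : T -> T') (mX : measurable_fun D X).
Variable Alg : set (T' -> R).
Hypothesis Alg1 : Alg (fun=> 1).
Hypothesis AlgD : forall f g, Alg f -> Alg g -> Alg (fun y => f y + g y).
Hypothesis AlgM : forall f g, Alg f -> Alg g -> Alg (fun y => f y * g y).
Hypothesis AlgZ : forall a f, Alg f -> Alg (fun y => a * f y).
Hypothesis Alg_sqint : forall f, Alg f -> sqint mu D (f \o X).
Hypothesis Alg_meas : forall f, Alg f -> measurable_fun setT f.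

Local Notation sqint := (sqint mu D).
Local Notation ip := (ip mu D).
Local Notation dist f g := (ip (fun x => f x - g x) (fun x => f x - g x)).

(** Approximants with values in [0, 1] can be multiplied without losing control
    of the error, which gives stability under intersection. *)
Definition unit_approximable (A : set T') := measurable A /\ forall e, 0 < e ->
  exists2 p, Alg p & (forall x, D x -> 0 <= p (X x) <= 1) /\
    dist (\1_A \o X) (p \o X) <= e.

Lemma AlgB f g : Alg f -> Alg g -> Alg (fun y => f y - g y).
Proof.
move=> Af Ag; have := AlgD Af (AlgZ (-1) Ag).
by under [X in Alg X]eq_fun do rewrite mulN1r.
Qed.

Lemma Alg_exp f k : Alg f -> Alg (fun y => f y ^+ k).
Proof.
move=> Af; elim: k => [|k IH].
  by under [X in Alg X]eq_fun do rewrite expr0.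
by under [X in Alg X]eq_fun do rewrite exprS; exact: AlgM.
Qed.

Lemma sqint_indic A : measurable A -> sqint (\1_A \o X : T -> R).
Proof.
move=> mA; apply: (sqint_bounded mD Dfin (M := 1)).
  by apply: measurableT_comp mX.
move=> x _; rewrite /= indicE; case: (_ \in _); rewrite ?normr1 ?normr0 //.
Qed.

Lemma dist_triangle f g h : sqint f -> sqint g -> sqint h ->
  dist f h <= 2 * dist f g + 2 * dist g h.
Proof.
move=> f2 g2 h2; apply: le_trans (ip_sqrDle mD (sqintB mD f2 g2) (sqintB mD g2 h2)).
rewrite le_eqVlt; apply/orP; left; apply/eqP; apply: eq_ip => x _; ring.
Qed.

Lemma ip_le f g : sqint f -> sqint g -> (forall x, D x -> `|f x| <= `|g x|) ->
  ip f f <= ip g g.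
Proof.
move=> f2 g2 fg; apply: le_Rintegral => //; try exact: sqintM.
move=> x Dx; rewrite -!expr2 -(real_normK (num_real (f x))).
by rewrite -(real_normK (num_real (g x))) lerXn2r ?nnegrE // fg.
Qed.

Lemma unit_approximable_setC A : unit_approximable A -> unit_approximable (~` A).
Proof.
move=> [mA gA]; split; first exact: measurableC.
move=> e /gA[p Ap [p01 pe]]; exists (fun y => 1 - p y); first exact: AlgB.
split; first by move=> x /p01 /=; lra.
apply: le_trans pe; apply: ip_le.
- by apply: sqintB; [exact: mD|apply/sqint_indic/measurableC|exact/Alg_sqint/AlgB].
- by apply: sqintB; [exact: mD|apply/sqint_indic|exact/Alg_sqint].
move=> x _; rewrite -normrN /= !indicE in_setC.
by case: (_ \in A); rewrite le_eqVlt; apply/orP; left; apply/eqP; congr `|_|; rewrite /=; ring.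
Qed.

(** Split 1_A 1_A' - p q as (1_A - p) 1_A' + (1_A' - q) p. *)
Lemma unit_approximable_setI A A' :
  unit_approximable A -> unit_approximable A' -> unit_approximable (A `&` A').
Proof.
move=> [mA gA] [mA' gA']; split; first exact: measurableI.
move=> e e0; have e4 : 0 < e / 4 by rewrite divr_gt0.
have [p Ap [p01 pe]] := gA _ e4; have [q Aq [q01 qe]] := gA' _ e4.
exists (fun y => p y * q y); first exact: AlgM.
split; first by move=> x Dx; have := p01 x Dx; have := q01 x Dx; nra.
have s1 := sqintB mD (sqint_indic mA) (Alg_sqint Ap).
have s2 := sqintB mD (sqint_indic mA') (Alg_sqint Aq).
have m1 : measurable_fun D (fun x => (\1_A (X x) - p (X x)) * \1_A' (X x)).
  apply: measurable_funM; first by case: s1.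
  by case: (sqint_indic mA').
have m2 : measurable_fun D (fun x => (\1_A' (X x) - q (X x)) * p (X x)).
  apply: measurable_funM; first by case: s2.
  by case: (Alg_sqint Ap).
have b1 x : D x -> `|(\1_A (X x) - p (X x)) * \1_A' (X x)| <= `|\1_A (X x) - p (X x)|.
  move=> _; rewrite normrM ler_piMr // indicE.
  by case: (_ \in _); rewrite ?normr1 ?normr0.
have b2 x : D x -> `|(\1_A' (X x) - q (X x)) * p (X x)| <= `|\1_A' (X x) - q (X x)|.
  move=> Dx; rewrite normrM ler_piMr //; have := p01 x Dx.
  by move=> /andP[p0 p1]; rewrite ger0_norm.
have t1 := sqint_le mD m1 b1 s1; have t2 := sqint_le mD m2 b2 s2.
have := ip_sqrDle mD t1 t2.
have := ip_le t1 s1 b1; have := ip_le t2 s2 b2.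
have -> : dist (\1_(A `&` A') \o X) ((fun y => p y * q y) \o X) =
  ip (fun x => (\1_A (X x) - p (X x)) * \1_A' (X x) + (\1_A' (X x) - q (X x)) * p (X x))
     (fun x => (\1_A (X x) - p (X x)) * \1_A' (X x) + (\1_A' (X x) - q (X x)) * p (X x)).
  by apply: eq_ip => x _; rewrite /= indicI /=; ring.
move: pe qe; lra.
Qed.

Lemma unit_approximable_setU A A' :
  unit_approximable A -> unit_approximable A' -> unit_approximable (A `|` A').
Proof.
move=> gA gA'; rewrite -(setCK (_ `|` _)) setCU.
by apply/unit_approximable_setC/unit_approximable_setI; exact: unit_approximable_setC.
Qed.

Lemma unit_approximable_set0 : unit_approximable set0.
Proof.
split => // e e0; exists (fun y => 1 - 1); first exact: AlgB.
split; first by move=> x _ /=; rewrite subrr lexx ler01.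
rewrite (_ : dist _ _ = 0) ?ltW // -[RHS](ip0l mu mD (fun=> 0)).
by apply: eq_ip => x _; rewrite /= indic0 /=; ring.
Qed.

Lemma unit_approximable_lim (A : set T') (p : (T' -> R)^nat) : measurable A ->
  (forall m, Alg (p m)) -> (forall m x, D x -> 0 <= p m (X x) <= 1) ->
  (forall x, D x -> p m (X x) @[m --> \oo] --> (\1_A (X x) : R)) -> unit_approximable A.
Proof.
move=> mA Ap p01 pA; split=> // e e0.
have : sqcvg mu D (fun m => p m \o X) (\1_A \o X).
  apply: (sqcvg_dominated mD (g := fun=> 1)).
  - by move=> m; case: (Alg_sqint (Ap m)).
  - by case: (sqint_indic mA).
  - exact: sqint_cst.
  - exact: pA.
  - move=> m x Dx; have := p01 m x Dx; rewrite normr1 ler_norml /= indicE.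
    by case: (_ \in _) => /=; lra.
move=> /cvgr0Pnorm_le /(_ _ e0) [m _ /(_ m (leqnn _)) /= pe].
exists (p m) => //; split; first exact: p01.
rewrite ger0_norm ?ip_ge0 // in pe; apply: le_trans pe.
by rewrite le_eqVlt; apply/orP; left; apply/eqP/eq_Rintegral => x _ /=; ring.
Qed.

Lemma unit_approximable_bigcup (F : (set T')^nat) :
  (forall k, unit_approximable (F k)) -> unit_approximable (\bigcup_k F k).
Proof.
move=> gF; pose U m := \big[setU/set0]_(k < m) F k.
have gU m : unit_approximable (U m).
  rewrite /U; elim: m => [|m IH]; first by rewrite big_ord0; exact: unit_approximable_set0.
  by rewrite big_ord_recr; exact: unit_approximable_setU.
have mU : measurable (\bigcup_k F k).
  by apply: bigcupT_measurable => k; case: (gF k).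
split=> // e e0; have e4 : 0 < e / 4 by rewrite divr_gt0.
have : sqcvg mu D (fun m => \1_(U m) \o X) (\1_(\bigcup_k F k) \o X : T -> R).
  apply: (sqcvg_dominated mD (g := fun=> 1)).
  - by move=> m; have [mUm _] := gU m; case: (sqint_indic mUm).
  - by case: (sqint_indic mU).
  - exact: sqint_cst.
  - move=> x Dx; rewrite /= indicE; have [/set_mem[k _ Fk]|xF] := boolP (_ \in _).
      apply: cvg_near_cst; exists k.+1 => // m /= km; rewrite indicE mem_set //.
      by rewrite /U -bigcup_mkord; exists k.
    apply: cvg_near_cst; apply: nearW => m; rewrite indicE memNset //.
    rewrite /U -bigcup_mkord => -[k _ Fk]; move/negP: xF; apply; apply/mem_set.
    by exists k.
  - move=> m x _; rewrite normr1 /= !indicE.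
    by case: (_ \in _); case: (_ \in _); rewrite /= ?subrr ?subr0 ?sub0r ?normrN ?normr1 ?normr0.
move=> /cvgr0Pnorm_le /(_ _ e4) [m _ /(_ m (leqnn _)) /= Ue].
have [mUm /(_ _ e4)[p Ap [p01 pe]]] := gU m.
exists p => //; split=> //; rewrite ger0_norm ?ip_ge0 // in Ue.
have := dist_triangle (sqint_indic mU) (sqint_indic mUm) (Alg_sqint Ap).
have -> : dist (\1_(\bigcup_k F k) \o X) (\1_(U m) \o X) =
          dist (\1_(U m) \o X) (\1_(\bigcup_k F k) \o X).
  by apply: eq_Rintegral => x _ /=; ring.
by move: pe Ue => /= pe Ue; lra.
Qed.

Lemma unit_approximable_sigma_algebra : sigma_algebra setT unit_approximable.
Proof.
split; first exact: unit_approximable_set0.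
  by move=> A gA; rewrite setTD; exact: unit_approximable_setC.
exact: unit_approximable_bigcup.
Qed.

(** The polynomial steps of s approximate the indicator. *)
Lemma unit_approximable_sublevel s : Alg s -> (forall x, D x -> 0 <= s (X x) <= 1) ->
  unit_approximable [set y | s y < 2^-1].
Proof.
move=> As s01; apply: (@unit_approximable_lim _ (fun m y => pstep m (s y))).
- rewrite (_ : [set y | _] = s @^-1` `]-oo, 2^-1[); last first.
    by apply/seteqP; split => y /=; rewrite in_itv.
  by rewrite -[X in measurable X]setTI; apply: (Alg_meas As).
- by move=> m; apply: Alg_exp; apply: AlgB => //; exact: Alg_exp.
- by move=> m x /s01/andP[s0 s1]; exact: pstep_itv.
move=> x /s01/andP[s0 s1]; rewrite indicE (_ : (_ \in _) = (s (X x) < 2^-1)).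
  exact: pstep_cvg.
by apply/idP/idP => [/set_mem|/mem_set].
Qed.

Definition approximable (g : T' -> R) := sqint (g \o X) /\
  forall e, 0 < e -> exists2 p, Alg p & dist (g \o X) (p \o X) <= e.

Lemma approximableD g h : approximable g -> approximable h ->
  approximable (fun y => g y + h y).
Proof.
move=> [g2 ga] [h2 ha]; split; first exact: sqintD.
move=> e e0; have e4 : 0 < e / 4 by rewrite divr_gt0.
have [p Ap pe] := ga _ e4; have [q Aq qe] := ha _ e4.
exists (fun y => p y + q y); first exact: AlgD.
have := ip_sqrDle mD (sqintB mD g2 (Alg_sqint Ap)) (sqintB mD h2 (Alg_sqint Aq)).
have -> : dist ((fun y => g y + h y) \o X) ((fun y => p y + q y) \o X) =
  ip (fun x => (g (X x) - p (X x)) + (h (X x) - q (X x)))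
     (fun x => (g (X x) - p (X x)) + (h (X x) - q (X x))).
  by apply: eq_Rintegral => x _ /=; ring.
by move: pe qe => /=; lra.
Qed.

Lemma approximableZ a g : approximable g -> approximable (fun y => a * g y).
Proof.
move=> [g2 ga]; split; first exact: sqintZ.
move=> e e0; have aa : 0 < a ^+ 2 + 1 by rewrite ltr_wpDl // sqr_ge0.
have [p Ap pe] := ga _ (divr_gt0 e0 aa).
exists (fun y => a * p y); first exact: AlgZ.
have gp := sqintB mD g2 (Alg_sqint Ap).
have -> : dist ((fun y => a * g y) \o X) ((fun y => a * p y) \o X) =
  a ^+ 2 * dist (g \o X) (p \o X).
  transitivity (ip (fun x => a * (g (X x) - p (X x))) (fun x => a * (g (X x) - p (X x)))).
    by apply: eq_Rintegral => x _ /=; ring.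
  by rewrite ipZl ?ipZr ?mulrA //; exact: sqintZ.
apply: le_trans (_ : (a ^+ 2 + 1) * dist (g \o X) (p \o X) <= _).
  by rewrite ler_wpM2r ?ip_ge0 // lerDl.
by rewrite mulrC -ler_pdivlMr.
Qed.

Lemma approximable_lim (gn : (T' -> R)^nat) g : (forall m, approximable (gn m)) ->
  sqint (g \o X) -> sqcvg mu D (fun m => gn m \o X) (g \o X) -> approximable g.
Proof.
move=> gna g2 gng; split=> // e e0; have e4 : 0 < e / 4 by rewrite divr_gt0.
move/cvgr0Pnorm_le : gng => /(_ _ e4) [m _ /(_ m (leqnn _)) /= Ue].
have [gn2 /(_ _ e4)[p Ap pe]] := gna m; exists p => //.
rewrite ger0_norm ?ip_ge0 // in Ue.
have := dist_triangle g2 gn2 (Alg_sqint Ap).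
have -> : dist (g \o X) (gn m \o X) = dist (gn m \o X) (g \o X).
  by apply: eq_Rintegral => x _ /=; ring.
by move: pe Ue => /= pe Ue; lra.
Qed.

(* To be verified in each instance on generators of the sigma-algebra, thanks
   to [unit_approximable_sigma_algebra]. *)
Hypothesis all_unit_approximable : forall A : set T', measurable A -> unit_approximable A.

Lemma approximable_indic A : measurable A -> approximable \1_A.
Proof.
move=> mA; split; first exact: sqint_indic.
by move=> e e0; have [_ /(_ _ e0)[p Ap [_ pe]]] := all_unit_approximable mA; exists p.
Qed.

Lemma approximable_sum k (F : nat -> T' -> R) : (forall i, approximable (F i)) ->
  approximable (fun y => \sum_(i < k) F i y).
Proof.
move=> Fa; elim: k => [|k IH].
  under [X in approximable X]eq_fun do rewrite big_ord0.
  by have := approximableZ 0 (Fa 0%N); under [X in approximable X]eq_fun do rewrite mul0r.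
under [X in approximable X]eq_fun do rewrite big_ord_recr /=.
exact: approximableD.
Qed.

Lemma approximable_sfun (h : {nnsfun T' >-> R}) : approximable h.
Proof.
have key k (c : nat -> R) :
    approximable (fun y => \sum_(i < k) c i * \1_((fun y => h y) @^-1` [set c i]) y).
  apply: (@approximable_sum k (fun i y => c i * \1_((fun y => h y) @^-1` [set c i]) y)).
  by move=> i; apply: approximableZ; apply: approximable_indic.
change (approximable (fun y => h y)).
under [X in approximable X]eq_fun do rewrite fimfunEord.
exact: key.
Qed.

(** Increasing simple approximations, dominated by g itself. *)
Lemma approximable_ge0 (g : T' -> R) : measurable_fun setT g -> (forall y, 0 <= g y) ->
  sqint (g \o X) -> approximable g.
Proof.
move=> mg g0 g2.
have mg' : measurable_fun setT (EFin \o g) by exact/measurable_EFinP.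
have g0' y : [set: T'] y -> (0 <= (EFin \o g) y)%E by rewrite lee_fin.
pose gn := nnsfun_approx measurableT mg'.
have gng y : gn m y @[m --> \oo] --> g y.
  have := cvg_nnsfun_approx measurableT mg' g0' (x := y) I.
  by move/fine_cvg.
have gnle m y : gn m y <= g y.
  rewrite -lee_fin /gn nnsfun_approxE.
  by apply: le_approx.
apply: (approximable_lim (gn := fun m => gn m)) => //.
  by move=> m; exact: approximable_sfun.
apply: (sqcvg_dominated mD (g := g \o X)) => //.
- by move=> m; have [[]] := approximable_sfun (gn m).
- by case: g2.
- by move=> x _; exact: gng.
move=> m x _ /=; have := gnle m (X x); have h0 : 0 <= gn m (X x) by [].
by move=> h1; rewrite distrC !ger0_norm //; lra.
Qed.

Lemma approximable_all (g : T' -> R) : measurable_fun setT g -> sqint (g \o X) -> approximable g.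
Proof.
move=> mg g2.
have gE : g = fun y => Num.max (g y) 0 + (-1) * Num.max (- g y) 0.
  apply/funext => y; rewrite /Num.max; case: ltP => h1; case: ltP => h2; lra.
have half (h : T' -> R) : measurable_fun setT h -> sqint (h \o X) ->
    approximable (fun y => Num.max (h y) 0).
  move=> mh h2; have mm : measurable_fun setT (fun y => Num.max (h y) 0).
    by apply: measurable_maxr.
  apply: approximable_ge0 => //; first by move=> y; rewrite le_max lexx orbT.
  apply: sqint_le h2 => //.
    by apply: measurableT_comp mX.
  move=> x _ /=; rewrite /Num.max; case: ltP => // h0; by rewrite normr0.
rewrite gE; apply: approximableD; first exact: half.
apply: approximableZ; apply: (half (fun y => - g y)).
  exact: measurableT_comp.
by apply: sqint_ext (sqintZ mD (-1) g2) => x _ /=; rewrite mulN1r.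
Qed.

End density.

(** * Density of polynomials *)

Lemma half_lines_measurable (R : realType) (C : set (set R)) :
  sigma_algebra setT C -> (forall a, C `]-oo, a[%classic) ->
  forall A : set R, measurable A -> C A.
Proof.
move=> sC hC A.
have -> : measurable A = (@RGenInftyO.G R).-sigma.-measurable A.
  by rewrite -RGenInftyO.measurableE.
by apply: smallest_sub => // _ [x ->]; exact: hC.
Qed.

Section affine_step.
Context (R : realType).

(** An affine function of t with values in [0, 1] for |t| <= M, equal to 1/2 at
    t = a: it puts half-lines in the form required by
    [unit_approximable_sublevel]. *)
Definition affstep (M a : R) : R -> R :=
  fun t => (2 * (`|M| + `|a| + 1))^-1 * (t - a) + 2^-1.

Lemma affstep_itv M a t : `|t| <= M -> 0 <= affstep M a t <= 1.
Proof.
move=> tM; rewrite /affstep; set L := `|M| + `|a| + 1.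
have L0 : 0 < L by rewrite ltr_wpDl // addr_ge0.
have : `|t - a| <= L.
  by have := ler_normB t a; have := ler_norm M; rewrite /L; lra.
rewrite ler_norml => /andP[h1 h2].
have -> : (2 * L)^-1 * (t - a) + 2^-1 = (t - a + L) / (2 * L).
  by field; rewrite gt_eqF.
by apply/andP; split; [rewrite divr_ge0|rewrite ler_pdivrMr]; lra.
Qed.

Lemma affstep_lt M a t : (affstep M a t < 2^-1) = (t < a).
Proof.
rewrite /affstep; set L := `|M| + `|a| + 1.
have L0 : 0 < (2 * L)^-1 by rewrite invr_gt0 mulr_gt0 // ltr_wpDl // addr_ge0.
by rewrite gtrDr pmulr_rlt0 // subr_lt0.
Qed.

End affine_step.

Section density_line.
Context d (T : measurableType d) (R : realType) (mu : {measure set T -> \bar R}).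
Context (D : set T) (mD : measurable D) (Dfin : (mu D < +oo)%E).
Context (X : T -> R) (mX : measurable_fun D X) (M : R).
Hypothesis XM : forall x, D x -> `|X x| <= M.

Let Alg : set (R -> R) := [set f | exists p : {poly R}, f = horner p].

Lemma density_line (k : R -> R) : measurable_fun setT k -> sqint mu D (k \o X) ->
  forall e, 0 < e -> exists p : {poly R},
    ip mu D (fun x => k (X x) - p.[X x]) (fun x => k (X x) - p.[X x]) <= e.
Proof.
move=> mk k2.
have Alg1 : Alg (fun=> 1).
  by exists 1; apply/funext => y; rewrite hornerC.
have AlgD f g : Alg f -> Alg g -> Alg (fun y => f y + g y).
  by move=> [p ->] [q ->]; exists (p + q); apply/funext => y; rewrite hornerD.
have AlgM f g : Alg f -> Alg g -> Alg (fun y => f y * g y).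
  by move=> [p ->] [q ->]; exists (p * q); apply/funext => y; rewrite hornerM.
have AlgZ a f : Alg f -> Alg (fun y => a * f y).
  by move=> [p ->]; exists (a *: p); apply/funext => y; rewrite hornerZ.
have Alg_meas f : Alg f -> measurable_fun setT f.
  by move=> [p ->]; apply: continuous_measurable_fun; exact: continuous_horner.
have Alg_sq f : Alg f -> sqint mu D (f \o X).
  move=> Af; have [p fE] := Af.
  have [C hC] : exists C, forall x, D x -> `|p.[X x]| <= C.
    elim/poly_ind: p {fE} => [|p c [C hC]].
      by exists 0 => x _; rewrite horner0 normr0.
    exists (C * M + `|c|) => x Dx; rewrite !hornerE.
    apply: le_trans (ler_normD _ _) _; rewrite lerD2r normrM.
    by apply: ler_pM => //; [exact: hC|exact: XM].
  apply: (sqint_bounded mD Dfin (M := C)); last by move=> x /hC; rewrite fE.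
  by apply: measurableT_comp mX; exact: Alg_meas.
have gd A : measurable A -> unit_approximable mu D X Alg A.
  apply: half_lines_measurable; first exact: unit_approximable_sigma_algebra.
  move=> a; rewrite (_ : `]-oo, a[%classic = [set y | affstep M a y < 2^-1]); last first.
    by apply/seteqP; split => y /=; rewrite in_itv /= affstep_lt.
  apply: unit_approximable_sublevel => //; last by move=> x Dx; apply/affstep_itv/XM.
  exists ((2 * (`|M| + `|a| + 1))^-1 *: ('X - a%:P) + (2^-1)%:P).
  by apply/funext => y; rewrite !hornerE.
have [_ h] := approximable_all mD Dfin mX AlgD AlgZ Alg_sq gd mk k2.
by move=> e /h[_ [p ->] pe]; exists p.
Qed.

End density_line.

Section density_space.
Context (R : realType) (n : nat).
Local Notation lambda := (lebesgue_rV R n).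
Context (D : set 'rV[R]_n) (mD : measurable D) (M : R).
Hypothesis DM : D `<=` ball 0 M.

Let Alg : set ('rV[R]_n -> R) := [set f | exists p, f = peval p].

Lemma density_space (f : 'rV[R]_n -> R) : sqint lambda D f ->
  forall e, 0 < e -> exists p : mpoly n R,
    ip lambda D (fun x => f x - peval p x) (fun x => f x - peval p x) <= e.
Proof.
move=> f2; have bD : exists M, D `<=` ball 0 M by exists M.
have Dfin := bounded_finite mD bD.
have mX : measurable_fun D (@id 'rV[R]_n) by exact: measurable_id.
have Alg1 : Alg (fun=> 1).
  by exists 1; apply/funext => y; rewrite peval1.
have AlgD h g : Alg h -> Alg g -> Alg (fun y => h y + g y).
  by move=> [p ->] [q ->]; exists (p + q); apply/funext => y; rewrite pevalD.
have AlgM h g : Alg h -> Alg g -> Alg (fun y => h y * g y).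
  by move=> [p ->] [q ->]; exists (p * q); apply/funext => y; rewrite pevalM.
have AlgZ a h : Alg h -> Alg (fun y => a * h y).
  by move=> [p ->]; exists (a *: p); apply/funext => y; rewrite pevalZ.
have Alg_meas h : Alg h -> measurable_fun setT h.
  by move=> [p ->]; exact: measurable_peval.
have Alg_sq h : Alg h -> sqint lambda D (h \o id).
  by move=> [p ->]; exact: sqint_peval.
have sG := unit_approximable_sigma_algebra mD Dfin mX Alg1 AlgD AlgM AlgZ Alg_sq.
have gd A : measurable A -> unit_approximable lambda D id Alg A.
  apply: smallest_sub => //; rewrite -bigcup_seq => _ [i _ [Y mY <-]].
  move: Y mY; apply: (half_lines_measurable (C := image_set_system setT
    (fun x : 'rV[R]_n => x ord0 i) (unit_approximable lambda D id Alg))).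
    exact: sigma_algebra_image.
  move=> a; rewrite /image_set_system /= setTI.
  rewrite (_ : _ @^-1` _ = [set y : 'rV[R]_n | affstep M a (y ord0 i) < 2^-1]); last first.
    by apply/seteqP; split => y /=; rewrite in_itv /= affstep_lt.
  apply: (unit_approximable_sublevel mD Dfin mX Alg1 AlgD AlgM AlgZ Alg_sq Alg_meas
    (s := fun y => affstep M a (y ord0 i))); last first.
    move=> x /DM[_ /(_ ord0 i)]; rewrite /ball /= mxE sub0r normrN => xM.
    by apply: affstep_itv; exact: ltW.
  exists ((2 * (`|M| + `|a| + 1))^-1 *: (mpolyX R (mnm1 i) - mpolyC n a) + mpolyC n (2^-1)).
  by apply/funext => y; rewrite pevalD pevalZ pevalB pevalX !pevalC.
(* The general density result is for functions measurable on the whole space. *)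
pose g := f \_ D.
have gf x : D x -> g x = f x by move=> Dx; rewrite /g patchE mem_set.
have mg : measurable_fun setT g.
  by apply/(measurable_restrictT _ _).1 => //; case: f2.
have g2 : sqint lambda D (g \o id).
  by apply: sqint_ext f2 => x Dx; rewrite /= gf.
have [_ h] := approximable_all mD Dfin mX AlgD AlgZ Alg_sq gd mg g2.
move=> e /h[_ [p ->] pe]; exists p; apply: le_trans pe.
by rewrite le_eqVlt; apply/orP; left; apply/eqP; apply: eq_ip => x Dx; rewrite /= gf.
Qed.

End density_space.

(** * Integrals of polynomials over the ball *)

Section polynomial_integral.
Context (R : realType) (n : nat).
Local Notation e i := (delta_mx ord0 i : 'rV[R]_n).
Local Notation B := (unit_ball R n).
Local Notation lambda := (lebesgue_rV R n).
Local Notation rho := (rho R n).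
Local Notation sqint := (sqint lambda B).
Local Notation ip := (ip lambda B).
Implicit Types (p q : mpoly n R) (x : 'rV[R]_n).

Let mB : measurable B := @unit_ball_measurable R n.

Lemma unit_ball_bdd : exists M : R, B `<=` ball 0 M.
Proof. by exists 1; exact: unit_ball_bounded. Qed.

Let bB := unit_ball_bdd.

Let p2 p : sqint (peval p). Proof. exact: sqint_peval. Qed.

Definition pint p : R := \int[lambda]_(x in B) peval p x.

Lemma pintM p q : pint (p * q) = ip (peval p) (peval q).
Proof. by apply: eq_Rintegral => x _; rewrite pevalM. Qed.

Lemma pint_linear : linear (pint : mpoly n R -> R^o).
Proof.
move=> a p q.
have i1 r : lambda.-integrable B (EFin \o peval r).
  by apply: sqint_integrable => //; exact: bounded_finite.
have h : pint (a *: p + q) = \int[lambda]_(x in B) (a * peval p x + peval q x).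
  by apply: eq_Rintegral => x _; rewrite pevalD pevalZ.
rewrite [LHS]h RintegralD // ?RintegralZl //.
rewrite (_ : _ \o _ = (fun x => a%:E * (EFin \o peval p) x)%E) //.
exact: integrableZl.
Qed.

HB.instance Definition _ := GRing.isLinear.Build R (mpoly n R) R^o _ pint pint_linear.

(** A continuous function that is nonzero at a point is nonzero on a ball, which
    has positive measure. *)
Lemma ae_eq0_continuous (Omega : set 'rV[R]_n) (f : 'rV[R]_n -> R) : open Omega ->
  continuous f -> {ae lambda, forall x, Omega x -> f x = 0} ->
  forall x, Omega x -> f x = 0.
Proof.
move=> oO cf f0 x Ox; apply: contrapT => fx.
have : nbhs x (Omega `&` [set y | f y != 0]).
  apply: filterI; first exact: open_nbhs_nbhs.
  have : nbhs (f x) [set t : R | t != 0].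
    by apply: open_nbhs_nbhs; split; [exact: open_neq|exact/eqP].
  exact: cf.
move=> /nbhs_ballP[r /= r0 hr].
have : lambda.-negligible (ball x r).
  by apply: negligibleS f0 => y /hr[Oy fy] /(_ Oy) /eqP; rewrite (negPf fy).
move=> /(negligibleP lambda (measurable_ball_rV x r0)).
move=> /eqP; rewrite [X in X == _](lebesgue_ball_rV x r0) eqe => /eqP h.
have : 0 < (r *+ 2) ^+ n by rewrite exprn_gt0 // mulrn_wgt0.
by rewrite h ltxx.
Qed.

(** All partial derivatives vanish on the ball as well, so they are zero
    polynomials by induction on the degree, and the polynomial is a constant,
    evaluated at 0. *)
Lemma peval_eq0 p : (forall x, B x -> peval p x = 0) -> p = 0.
Proof.
have dB q i : (forall x, B x -> peval q x = 0) -> forall x, B x -> peval (mderiv i q) x = 0.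
  move=> q0 x Bx; have [_ <-] := is_derive_peval i q x.
  have f0 : \forall y \near x, peval q y = 0.
    have : nbhs x B by apply: open_nbhs_nbhs; split => //; exact: unit_ball_open.
    by apply: filterS => y; exact: q0.
  by have [] := is_derive_near0 (e i) f0.
have [k pk] : exists k, (mmeasure (@mdeg n) p <= k)%N by exists (mmeasure (@mdeg n) p).
elim: k p pk => [|k IH] p pk p0.
  by apply/eqP; rewrite -(mmeasure_poly_eq0 (@mdeg n)) -leqn0.
have dp i : mderiv i p = 0.
  apply: IH; last exact: dB.
  by apply: leq_trans (msize_d i p) _; rewrite -subn1 leq_subLR add1n.
have pE : p = mpolyC n (mcoeff mnm0 p).
  apply/mpolyP => m; rewrite mcoeffC.
  have [->|m0] := eqVneq m mnm0; first by rewrite mulr1.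
  have [i mi] : exists i, m i != 0%N.
    apply/existsP; apply: contraNT m0 => /existsPn m0; apply/eqP/mnmP => i.
    by rewrite mnm0E; apply/eqP/negbNE/m0.
  have mE : mnm_add (mnm_sub m (mnm1 i)) (mnm1 i) = m.
    rewrite submK //; apply/mnm_lepP => j; rewrite mnm1E.
    by case: eqP => //= <-; rewrite lt0n.
  have := congr1 (mcoeff (mnm_sub m (mnm1 i))) (dp i).
  rewrite mcoeff_deriv mcoeff0 mE => /eqP; rewrite mulrn_eq0 /= => /eqP ->.
  by rewrite mulr0.
have := p0 0 (@unit_ball0 R n); rewrite pE pevalC => ->.
by rewrite mpolyC0.
Qed.

Lemma pint_sqr_eq0 p : pint (p * p) = 0 -> p = 0.
Proof.
rewrite pintM => /(ip_eq0_ae mB (p2 p)) p0; apply: peval_eq0.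
by apply: ae_eq0_continuous p0; [exact: unit_ball_open|exact: continuous_peval].
Qed.

Lemma pint_sqr_ge0 p : 0 <= pint (p * p).
Proof. by rewrite pintM ip_ge0. Qed.

(** Integration by parts in H^1_0 against the constant 1. *)
Lemma pint_mderiv_rho i p : pint (mderiv i (rho * p)) = 0.
Proof.
have := H10_by_parts mB bB 1 i (H10_rho p).
have -> : ip (peval (rho * p)) (peval (mderiv i 1)) = 0.
  rewrite ipC -[RHS](ip0l lambda mB (peval (rho * p))); apply: eq_ip => // x _.
  by rewrite mderiv_one peval0.
rewrite oppr0 => <-; apply: eq_Rintegral => x _.
by rewrite mxE peval1 mulr1.
Qed.

Hypothesis n_ge2 : (2 <= n)%N.

(** Expand 0 <= |grad u + u x|^2 with u = rho p: the cross term is 2 (u, E u),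
    equal to - n |u|^2 by [I_poincare], and the last term is |u|^2 minus the
    integral of rho u^2. *)
Lemma pint_poincare p : pint ((rho * p) * (rho * p)) <=
  \sum_i pint (mderiv i (rho * p) * mderiv i (rho * p)).
Proof.
set u := rho * p.
have pr := @I_poincare R n pint pint_mderiv_rho p; rewrite -/u in pr.
have rg : 0 <= pint (rho * (u * u)).
  apply: Rintegral_ge0 => x /unit_ballE r0.
  by rewrite (pevalM rho) (pevalM u) mulr_ge0 ?(ltW r0) // -expr2 sqr_ge0.
have : 0 <= \sum_i pint ((mderiv i u + mpolyX R (mnm1 i) * u) *
    (mderiv i u + mpolyX R (mnm1 i) * u)).
  by apply: sumr_ge0 => i _; exact: pint_sqr_ge0.
have -> : \sum_i pint ((mderiv i u + mpolyX R (mnm1 i) * u) *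
    (mderiv i u + mpolyX R (mnm1 i) * u)) =
  \sum_i pint (mderiv i u * mderiv i u) + 2 * pint (u * euler u) + pint (u * u) -
  pint (rho * (u * u)).
  have sX : \sum_i mpolyX R (mnm1 i) ^+ 2 = 1 - rho :> mpoly n R.
    exact/esym/subKr.
  rewrite -linear_sum /=.
  transitivity (pint (\sum_i mderiv i u * mderiv i u + 2%:R * (u * euler u) + u * u -
      rho * (u * u))).
    congr (pint _).
    transitivity (\sum_i mderiv i u * mderiv i u + 2%:R * (u * euler u) +
        (\sum_i mpolyX R (mnm1 i) ^+ 2) * (u * u)).
      rewrite /euler !mulr_sumr mulr_suml -!big_split /=.
      by apply: eq_bigr => i _; ring.
    by rewrite sX; ring.
  by rewrite !(linearD, linearN) /= linear_sum (@I_natmul R n pint).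
have n2 : 2 <= n%:R :> R by rewrite ler_nat.
have a0 : 0 <= pint (u * u) by exact: pint_sqr_ge0.
have ka : 0 <= (n%:R - 2) * pint (u * u) by rewrite mulr_ge0 // subr_ge0.
by move: pr rg ka; rewrite mulrBl; lra.
Qed.

End polynomial_integral.

(** * Approximation by polynomials of mean zero *)

Section bogovskii_on_ball.
Context (R : realType) (n : nat).
Hypothesis n_ge2 : (2 <= n)%N.
Local Notation B := (unit_ball R n).
Local Notation lambda := (lebesgue_rV R n).
Local Notation rho := (rho R n).
Local Notation sqint := (sqint lambda B).
Local Notation ip := (ip lambda B).
Local Notation sqcvg := (sqcvg lambda B).
Implicit Types (p q : mpoly n R) (f : 'rV[R]_n -> R).

Let mB : measurable B := @unit_ball_measurable R n.
Let bB := @unit_ball_bdd R n.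
Let p2 p : sqint (peval p). Proof. exact: sqint_peval. Qed.

Lemma pint1_gt0 : 0 < pint (1 : mpoly n R).
Proof.
rewrite lt_def -{2}[1]mulr1 pint_sqr_ge0 andbT; apply/negP => /eqP.
by rewrite -{1}[1]mulr1 => /pint_sqr_eq0/eqP; rewrite oner_eq0.
Qed.

Lemma pint_ip1 p : pint p = ip (peval p) (fun=> 1).
Proof. by apply: eq_Rintegral => x _; rewrite mulr1. Qed.

(** Subtracting its mean from an approximating polynomial is a projection along
    the constants, to which f is orthogonal, so the distance to f does not grow. *)
Lemma density_mean0 f : sqint f -> ip f (fun=> 1) = 0 -> forall t, 0 < t ->
  exists2 p, pint p = 0 & ip (fun x => f x - peval p x) (fun x => f x - peval p x) <= t.
Proof.
move=> f2 f0 t t0; have [p pt] := density_space mB (@unit_ball_bounded R n) f2 t0.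
have v0 := pint1_gt0; set v := pint 1 in v0; have vn0 : v != 0 by rewrite gt_eqF.
pose m := pint p / v.
have mE : pint (mpolyC n m) = m * v.
  by rewrite -[mpolyC n m]mulr1 mul_mpolyC linearZ.
exists (p - mpolyC n m); first by rewrite linearB /= mE divfK // subrr.
apply: le_trans pt.
have one2 : sqint (fun=> 1) by apply: sqint_cst => //; exact: bounded_finite.
have fp2 := sqintB mB f2 (p2 p).
have -> : ip (fun x => f x - peval (p - mpolyC n m) x) (fun x => f x - peval (p - mpolyC n m) x)
  = ip (fun x => (f x - peval p x) - (- m) * 1) (fun x => (f x - peval p x) - (- m) * 1).
  by apply: eq_ip => x _; rewrite (pevalB p) pevalC; ring.
have h1 : ip (fun x => f x - peval p x) (fun=> 1) = - pint p.
  by rewrite ipBl // f0 -pint_ip1 sub0r.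
rewrite ip_subZ_sqr // h1.
have -> : ip (fun=> 1) (fun=> 1) = v.
  by rewrite /v pint_ip1; apply: eq_ip => // x _; rewrite peval1.
have -> : pint p = m * v by rewrite divfK.
by have := sqr_ge0 m; nra.
Qed.

Lemma polynomial_solution q : pint q = 0 -> exists V : 'I_n -> mpoly n R,
  [/\ \sum_i mderiv i (rho * V i) = q,
     \sum_i \sum_j ip (peval (mderiv j (rho * V i))) (peval (mderiv j (rho * V i))) <=
       n%:R * ip (peval q) (peval q) &
     forall i, ip (peval (rho * V i)) (peval (rho * V i)) <=
       n%:R * ip (peval q) (peval q)].
Proof.
move=> q0.
have [V [VE Vn]] := polynomial_bogovskii (I := @pint R n) (@pint_sqr_ge0 R n)
  (@pint_sqr_eq0 R n) (@pint_mderiv_rho R n) n_ge2 q0.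
have en : \sum_i \sum_j ip (peval (mderiv j (rho * V i))) (peval (mderiv j (rho * V i))) <=
       n%:R * ip (peval q) (peval q).
  rewrite -pintM; apply: le_trans Vn.
  rewrite le_eqVlt; apply/orP; left; apply/eqP.
  by apply: eq_bigr => i _; apply: eq_bigr => j _; rewrite -pintM.
exists V; split => // i; apply: le_trans en; rewrite -pintM.
apply: le_trans (pint_poincare n_ge2 _) _.
rewrite [leRHS](bigD1 i) //=; apply: ler_wpDr; last first.
  by apply: ler_sum => j _; rewrite -pintM.
by apply: sumr_ge0 => k _; apply: sumr_ge0 => j _; exact: ip_ge0.
Qed.

(** The approximants p_k are at squared distance at most eta^2 / 8^k from f, and
    q_k = p_k - p_(k-1).  Giving q_0 the weight 1 - eta and q_k the weight
    eta / 2^k, the terms with k > 0 contribute a multiple of eta in total,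
    whatever f is. *)
Section telescoping.
Variables (f : 'rV[R]_n -> R) (eta : R).
Hypothesis f2 : sqint f.
Hypothesis f0 : ip f (fun=> 1) = 0.
Hypothesis eta_gt0 : 0 < eta.
Hypothesis eta_le : eta <= 4^-1.

Let w (k : nat) : R := if k is 0 then 1 - eta else eta / 2 ^+ k.
Local Notation F := (ip f f).
Local Notation S := (F + (3 * F + 8) * eta).

Let w_gt0 k : 0 < w k.
Proof. by case: k => [|k]; rewrite /w ?divr_gt0 ?exprn_gt0 // subr_gt0; move: eta_le; lra. Qed.

Let w_sum m : \sum_(k < m) w k <= 1.
Proof.
case: m => [|m]; first by rewrite big_ord0.
suff : \sum_(k < m.+1) w k = 1 - eta / 2 ^+ m.
  by move=> ->; rewrite gerBl divr_ge0 ?exprn_ge0 // ltW.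
elim: m => [|m IH]; first by rewrite big_ord1 expr0 divr1.
have h : (2 : R) ^+ m != 0 by rewrite expf_neq0.
by rewrite big_ord_recr /= IH /w exprS; field.
Qed.

Let tau (k : nat) : R := eta ^+ 2 / 8 ^+ k.

Lemma telescoping_approximation : exists (q : (mpoly n R)^nat) (c : R^nat),
  [/\ forall k, pint (q k) = 0, forall k, 0 < c k, forall m, \sum_(k < m) c k <= 1,
     forall m, \sum_(k < m) ip (peval (q k)) (peval (q k)) / c k <= S &
     sqcvg (fun m x => \sum_(k < m) peval (q k) x) f].
Proof.
have tau_gt0 k : 0 < tau k by rewrite divr_gt0 ?exprn_gt0.
have /choice[p hp] : forall k, exists p, pint p = 0 /\
    ip (fun x => f x - peval p x) (fun x => f x - peval p x) <= tau k.
  by move=> k; have [p p0 pt] := density_mean0 f2 f0 (tau_gt0 k); exists p.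
have p0 k := (hp k).1; have pt k := (hp k).2.
pose q k := if k is k'.+1 then p k - p k' else p 0%N.
have qsum m : \sum_(k < m.+1) q k = p m.
  elim: m => [|m IH]; first by rewrite big_ord1.
  by rewrite big_ord_recr /= IH addrC subrK.
have q_le k : ip (peval (q k.+1)) (peval (q k.+1)) <= 18 * eta ^+ 2 / 8 ^+ k.+1.
  have := ip_sqrDle mB (sqintB mB (p2 (p k.+1)) f2) (sqintB mB f2 (p2 (p k))).
  have -> : ip (fun x => peval (p k.+1) x - f x + (f x - peval (p k) x))
     (fun x => peval (p k.+1) x - f x + (f x - peval (p k) x)) =
     ip (peval (q k.+1)) (peval (q k.+1)).
    by apply: eq_ip => x _; rewrite /q (pevalB (p k.+1)); ring.
  have -> : ip (fun x => peval (p k.+1) x - f x) (fun x => peval (p k.+1) x - f x) =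
     ip (fun x => f x - peval (p k.+1) x) (fun x => f x - peval (p k.+1) x).
    by apply: eq_Rintegral => x _; ring.
  have := pt k; have := pt k.+1.
  have h : (8 : R) ^+ k != 0 by rewrite expf_neq0.
  have -> : 18 * eta ^+ 2 / 8 ^+ k.+1 = 2 * tau k.+1 + 2 * tau k.
    by rewrite /tau (exprS 8); field.
  lra.
have F0 : 0 <= F by exact: ip_ge0.
(* |p_0|^2 <= (1 + eta) |f|^2 + (1 + 1/eta) |f - p_0|^2. *)
have q0_le : ip (peval (q 0%N)) (peval (q 0%N)) <= (1 + eta) * F + eta ^+ 2 + eta.
  rewrite /q /=; have := pt 0%N; rewrite /tau expr0 divr1.
  have p02 := p2 (p 0%N); have d2 := sqintB mB f2 p02.
  have := ip_ge0 lambda B (fun x => f x - (- eta^-1) * (f x - peval (p 0%N) x)).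
  rewrite ip_subZ_sqr //.
  have -> : ip (peval (p 0%N)) (peval (p 0%N)) =
      ip (fun x => f x - 1 * (f x - peval (p 0%N) x)) (fun x => f x - 1 * (f x - peval (p 0%N) x)).
    by apply: eq_ip => x _; ring.
  rewrite ip_subZ_sqr //.
  set d := fun x => f x - peval (p 0%N) x.
  move: (ip d d) (ip f d) => a b h1 h2.
  have en0 : eta != 0 by rewrite gt_eqF.
  have h3 : 0 <= eta * F + 2 * b + eta^-1 * a.
    rewrite (_ : _ + _ = eta * (F - 2 * - eta^-1 * b + (- eta^-1) ^+ 2 * a)).
      by rewrite mulr_ge0 // ltW.
    by field.
  have h4 : eta^-1 * a <= eta.
    by rewrite mulrC ler_pdivrMr // -expr2.
  lra.
have gw m : \sum_(k < m) ip (peval (q k)) (peval (q k)) / w k <= S.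
  case: m => [|m].
    by rewrite big_ord0 addr_ge0 // mulr_ge0 ?(ltW eta_gt0) //; lra.
  suff : \sum_(k < m.+1) ip (peval (q k)) (peval (q k)) / w k <=
      ip (peval (q 0%N)) (peval (q 0%N)) / w 0%N + 6 * eta * (1 - (4 ^+ m)^-1).
    move=> /le_trans; apply.
    have h1 : 6 * eta * (1 - (4 ^+ m)^-1) <= 6 * eta.
      rewrite ler_piMr ?mulr_ge0 ?(ltW eta_gt0) // gerBl invr_ge0 exprn_ge0 //.
    have h2 : ip (peval (q 0%N)) (peval (q 0%N)) / w 0%N <= (1 + 3 * eta) * F + 2 * eta.
      rewrite ler_pdivrMr //; apply: le_trans q0_le _; rewrite /w.
      have h3 : 0 <= eta * (1 - 3 * eta).
        by rewrite mulr_ge0 ?(ltW eta_gt0) // subr_ge0; move: eta_le; lra.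
      by have := mulr_ge0 h3 F0; lra.
    by lra.
  elim: m => [|m IH]; first by rewrite big_ord1 expr0 invr1 subrr mulr0 addr0.
  rewrite big_ord_recr /=.
  have h1 : ip (peval (q m.+1)) (peval (q m.+1)) / w m.+1 <= 18 * eta / 4 ^+ m.+1.
    rewrite ler_pdivrMr //; apply: le_trans (q_le m) _; rewrite /w.
    rewrite le_eqVlt; apply/orP; left; apply/eqP.
    rewrite (_ : (8 : R) = 4 * 2); last by rewrite -natrM.
    rewrite exprMn; have h4 : (4 : R) ^+ m.+1 != 0 by rewrite expf_neq0.
    have h2 : (2 : R) ^+ m.+1 != 0 by rewrite expf_neq0.
    by field; rewrite h4 h2.
  have h2 : 6 * eta * (1 - (4 ^+ m)^-1) + 18 * eta / 4 ^+ m.+1 = 6 * eta * (1 - (4 ^+ m.+1)^-1).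
    rewrite exprS; have h4 : (4 : R) ^+ m != 0 by rewrite expf_neq0.
    by field.
  by rewrite -h2 addrA; exact: lerD.
exists q, w; split => //.
  by case=> [|k]; rewrite /q ?linearB /= !p0 ?subrr.
rewrite /sqcvg -cvg_shiftS.
have t0 : eta ^+ 2 * (8^-1) ^+ m @[m --> \oo] --> (eta ^+ 2 * 0 : R).
  by apply: cvgMl_tmp; apply: cvg_expr; rewrite ger0_norm ?invf_lt1 // ltr1n.
rewrite mulr0 in t0; move: t0; apply: squeeze_cvgr (cvg_cst 0).
apply: nearW => m; rewrite ip_ge0 /=.
apply: le_trans (_ : tau m <= _); last by rewrite /tau exprVn.
apply: le_trans (pt m); rewrite le_eqVlt; apply/orP; left; apply/eqP.
apply: eq_Rintegral => x _; rewrite -peval_sum qsum; ring.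
Qed.

End telescoping.

End bogovskii_on_ball.

(** * The divergence equation on the ball *)

Section bogovskii_solution.
Context (R : realType) (n : nat).
Hypothesis n_ge2 : (2 <= n)%N.
Local Notation B := (unit_ball R n).
Local Notation lambda := (lebesgue_rV R n).
Local Notation rho := (rho R n).
Local Notation sqint := (sqint lambda B).
Local Notation ip := (ip lambda B).
Local Notation sqcvg := (sqcvg lambda B).
Implicit Types (p q : mpoly n R) (f : 'rV[R]_n -> R).

Let mB : measurable B := @unit_ball_measurable R n.
Let bB := @unit_ball_bdd R n.
Let p2 p : sqint (peval p). Proof. exact: sqint_peval. Qed.

(** Sum the polynomial solutions for the terms of the telescoping series.  The
    components and the entries of the gradient form series of the same weighted
    type, so they converge; the trace and the energy bound pass to the limit. *)
Lemma bogovskii_solution f e : sqint f -> ip f (fun=> 1) = 0 -> 0 < e ->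
  exists (v : 'rV[R]_n -> 'rV[R]_n) (Dv : 'rV[R]_n -> 'M[R]_n),
  [/\ H10vec B v Dv, {ae lambda, forall x, B x -> \tr (Dv x) = f x} &
     \sum_i \sum_j ip (fun x => Dv x i j) (fun x => Dv x i j) <= n%:R * ip f f + e].
Proof.
move=> f2 f0 e0; have F0 : 0 <= ip f f by exact: ip_ge0.
have n0 : 0 < n%:R :> R by rewrite ltr0n; apply: leq_trans n_ge2.
pose eta := Num.min 4^-1 (e / (n%:R * (3 * ip f f + 8))).
have c0 : 0 < n%:R * (3 * ip f f + 8) by rewrite mulr_gt0 // ltr_wpDl // mulr_ge0.
have eta0 : 0 < eta by rewrite lt_min invr_gt0 ltr0n /= divr_gt0.
have eta4 : eta <= 4^-1 by rewrite ge_min lexx.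
have eta_e : n%:R * ((3 * ip f f + 8) * eta) <= e.
  by rewrite mulrA mulrC -ler_pdivlMr // ge_min lexx orbT.
have [q [w [q0 w0 w1 qS qf]]] := telescoping_approximation f2 f0 eta0 eta4.
set S := ip f f + _ in qS.
have /choice[V hV] := fun k => polynomial_solution n_ge2 (q0 k).
pose u k i := peval (rho * V k i).
pose du k i j := peval (mderiv j (rho * V k i)).
have du_le k : \sum_i \sum_j ip (du k i j) (du k i j) <= n%:R * ip (peval (q k)) (peval (q k)).
  by have [_ h _] := hV k.
have sum_le m (g : nat -> R) : (forall k, g k <= n%:R * ip (peval (q k)) (peval (q k))) ->
    \sum_(k < m) g k / w k <= n%:R * S.
  move=> gq; apply: (@le_trans _ _ (n%:R * \sum_(k < m) ip (peval (q k)) (peval (q k)) / w k)).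
    rewrite mulr_sumr; apply: ler_sum => k _; rewrite mulrA ler_pM2r ?invr_gt0 //.
  by rewrite ler_pM2l.
have /choice[v hv] : forall i, exists v, sqint v /\ sqcvg (fun m x => \sum_(k < m) u k i x) v.
  move=> i; have [||k|m|v v2 uv] :=
    @weighted_series_cvg _ _ _ lambda B mB (fun k => u k i) w (n%:R * S).
  - by move=> k; exact: p2.
  - exact: w0.
  - exact: w1.
  - by apply: (sum_le m (fun k => ip (u k i) (u k i))) => k; have [_ _] := hV k; exact.
  by exists v.
have /choice[dv hdv] : forall ij : 'I_n * 'I_n, exists v, sqint v /\
    sqcvg (fun m x => \sum_(k < m) du k ij.1 ij.2 x) v.
  move=> [i j] /=.
  have [||k|m|v' v2 uv] :=
    @weighted_series_cvg _ _ _ lambda B mB (fun k => du k i j) w (n%:R * S).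
  - by move=> k; exact: p2.
  - exact: w0.
  - exact: w1.
  - apply: (sum_le m (fun k => ip (du k i j) (du k i j))) => k; apply: le_trans (du_le k).
    rewrite (bigD1 i) //= (bigD1 j) //= -addrA lerDl addr_ge0 //.
      by apply: sumr_ge0 => *; exact: ip_ge0.
    by apply: sumr_ge0 => *; apply: sumr_ge0 => *; exact: ip_ge0.
  by exists v'.
pose v' x : 'rV[R]_n := \row_i v i x.
pose Dv x : 'M[R]_n := \matrix_(i, j) dv (i, j) x.
have DvE i j : (fun x => Dv x i j) = dv (i, j) by apply/funext => x; rewrite mxE.
have dv2 i j : sqint (dv (i, j)) := (hdv (i, j)).1.
have dvc i j : sqcvg (fun m x => \sum_(k < m) du k i j x) (dv (i, j)) := (hdv (i, j)).2.
have dus2 m i j : sqint (fun x => \sum_(k < m) du k i j x).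
  by apply: sqint_sum => // k; exact: p2.
exists v', Dv; split.
- move=> i; pose P m := rho * \sum_(k < m) V k i.
  have PE m : P m = \sum_(k < m) rho * V k i by rewrite /P mulr_sumr.
  have rE j : (fun x => row i (Dv x) ord0 j) = dv (i, j).
    by apply/funext => x; rewrite !mxE.
  apply: (H10_closed mB bB (un := fun m => peval (P m)) (Dun := fun m => pgrad (P m))).
  + by move=> m; exact: H10_rho.
  + rewrite (_ : (fun x => v' x ord0 i) = v i); first by have [] := hv i.
    by apply/funext => x; rewrite mxE.
  + by move=> j; rewrite rE.
  + rewrite (_ : (fun x => v' x ord0 i) = v i); last by apply/funext => x; rewrite mxE.
    rewrite (_ : (fun m => peval (P m)) = fun m x => \sum_(k < m) u k i x).
      by have [] := hv i.
    by apply/funext => m; apply/funext => x; rewrite PE peval_sum.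
  move=> j; rewrite rE.
  rewrite (_ : (fun m x => pgrad (P m) x ord0 j) = fun m x => \sum_(k < m) du k i j x) //.
  by apply/funext => m; apply/funext => x; rewrite mxE PE mderiv_sum peval_sum.
- have tr2 : sqint (fun x => \sum_i dv (i, i) x) by exact: sqint_sum.
  have trc : sqcvg (fun m x => \sum_i \sum_(k < m) du k i i x) (fun x => \sum_i dv (i, i) x).
    exact: (@sqcvg_sum _ _ _ lambda B mB _ _ (fun i m x => \sum_(k < m) du k i i x)).
  have trE : (fun m x => \sum_i \sum_(k < m) du k i i x) =
      (fun m x => \sum_(k < m) peval (q k) x).
    apply/funext => m; apply/funext => x; rewrite exchange_big /=; apply: eq_bigr => k _.
    by have [<- _ _] := hV k; rewrite peval_sum.
  rewrite trE in trc.
  have q2 m : sqint (fun x => \sum_(k < m) peval (q k) x) by exact: sqint_sum.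
  have := ip_eq0_ae mB (sqintB mB tr2 f2) (sqcvg_unique mB q2 tr2 f2 trc qf).
  apply: filterS => x h Bx; apply/eqP; rewrite -subr_eq0; apply/eqP; rewrite -[RHS](h Bx).
  by congr (_ - _); apply: eq_bigr => i _; rewrite mxE.
have SE : n%:R * S <= n%:R * ip f f + e by rewrite /S mulrDr lerD2l.
apply: le_trans SE; under eq_bigr do under eq_bigr do rewrite !DvE.
have lim : \sum_i \sum_j ip (fun x => \sum_(k < m) du k i j x) (fun x => \sum_(k < m) du k i j x)
    @[m --> \oo] --> \sum_i \sum_j ip (dv (i, j)) (dv (i, j)).
  apply: cvg_big => [|i _]; first exact: add_continuous.
  apply: cvg_big => [|j _]; first exact: add_continuous.
  by apply: (ip_cvg_sqr mB _ (dv2 i j) (dvc i j)) => m; exact: dus2.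
apply: (cvgr_to_le lim); apply: nearW => m.
apply: le_trans (sum_le m _ du_le).
rewrite (_ : \sum_(k < m) _ = \sum_i \sum_j \sum_(k < m) ip (du k i j) (du k i j) / w k).
  apply: ler_sum => i _; apply: ler_sum => j _.
  exact: (weighted_series_le mB (g := fun k => du k i j) (fun k => p2 _) w0 w1).
rewrite [RHS](eq_bigr (fun i => \sum_(k < m) \sum_j ip (du k i j) (du k i j) / w k)); last first.
  by move=> i _; rewrite exchange_big.
rewrite [RHS]exchange_big /=; apply: eq_bigr => k _; rewrite mulr_suml; apply: eq_bigr => i _.
by rewrite mulr_suml.
Qed.

End bogovskii_solution.

(** * Bounds for the Bogovskii constant *)

Section bogovskii_bounds.
Context (R : realType) (n : nat).
Local Notation lambda := (lebesgue_rV R n).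
Implicit Types (Omega : set 'rV[R]_n) (v : 'rV[R]_n -> 'rV[R]_n) (Dv : 'rV[R]_n -> 'M[R]_n).

Lemma H10vec_sqint Omega v Dv : measurable Omega -> (exists M, Omega `<=` ball 0 M) ->
  H10vec Omega v Dv -> forall i j, sqint lambda Omega (fun x => Dv x i j).
Proof.
move=> mO bO hv i j; have [_ /(_ j)] := H10_elim mO bO (hv i).
rewrite (_ : (fun x => row i (Dv x) ord0 j) = fun x => Dv x i j) //.
by apply/funext => x; rewrite mxE.
Qed.

Lemma energyE Omega v Dv : measurable Omega -> (exists M, Omega `<=` ball 0 M) ->
  H10vec Omega v Dv ->
  (\int[lambda]_(x in Omega) (\sum_i \sum_j Dv x i j ^+ 2)%:E =
   (\sum_i \sum_j ip lambda Omega (fun x => Dv x i j) (fun x => Dv x i j))%:E)%E.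
Proof.
move=> mO bO hv; have D2 := H10vec_sqint mO bO hv.
under eq_integral do rewrite pair_big /=.
rewrite pair_big /=.
exact: (sum_sqint_ipE mO (F := fun ij x => Dv x ij.1 ij.2)).
Qed.

Lemma bogovskii_unit_ball_le : (2 <= n)%N -> (bogovskii (unit_ball R n) <= n%:R%:E)%E.
Proof.
move=> n_ge2; have mB := @unit_ball_measurable R n; have bB := @unit_ball_bdd R n.
apply: ge_ereal_sup => _ [f [f2 f0 f1] <-]; apply/lee_addgt0Pr => e e0.
have fE : ip lambda (unit_ball R n) f f = 1.
  by apply: EFin_inj; rewrite -f1 -sqint_ipE.
have f0' : ip lambda (unit_ball R n) f (fun=> 1) = 0.
  by rewrite -[RHS]f0; apply: eq_Rintegral => x _; rewrite mulr1.
have [v [Dv [hv divv]]] := bogovskii_solution n_ge2 f2 f0' e0.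
rewrite fE mulr1 -lee_fin => /(le_trans _); apply.
by apply: ereal_inf_lbound; exists v, Dv; split => //; rewrite (energyE mB bB hv).
Qed.

Section lower_bound.
Variable Omega : set 'rV[R]_n.
Hypotheses (n_gt0 : (0 < n)%N) (oO : open Omega) (O0 : Omega !=set0).
Hypothesis bO : exists M, Omega `<=` ball 0 M.
Local Notation sqint := (sqint lambda Omega).
Local Notation ip := (ip lambda Omega).
Local Notation X i := (mpolyX R (mnm1 i) : mpoly n R).

Let mO : measurable Omega := open_measurable_rV oO.
Let p2 p : sqint (peval p). Proof. exact: sqint_peval. Qed.

Let ip_gt0 p : (exists2 x, Omega x & peval p x != 0) -> 0 < ip (peval p) (peval p).
Proof.
move=> [x Ox px]; rewrite lt_def ip_ge0 andbT; apply: contra px => /eqP pp0.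
apply/eqP; have := ip_eq0_ae mO (p2 p) pp0.
by move/(ae_eq0_continuous oO (@continuous_peval _ _ p)); exact.
Qed.

Let centroid : exists c : 'I_n -> R, forall i, ip (peval (X i - mpolyC n (c i))) (fun=> 1) = 0.
Proof.
have V0 : 0 < ip (fun=> 1) (fun=> 1).
  have [x Ox] := O0; have -> : (fun=> 1) = peval 1 :> ('rV[R]_n -> R).
    by apply/funext => y; rewrite peval1.
  by apply: ip_gt0; exists x => //; rewrite peval1 oner_eq0.
have one2 : sqint (fun=> 1) by apply: sqint_cst => //; exact: bounded_finite.
exists (fun i => ip (peval (X i)) (fun=> 1) / ip (fun=> 1) (fun=> 1)) => i.
set c := _ / _.
have -> : ip (peval (X i - mpolyC n c)) (fun=> 1) =
    ip (fun x => peval (X i) x - c * 1) (fun=> 1).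
  by apply: eq_ip => // x _; rewrite pevalB pevalC mulr1.
rewrite ipBl // ?ipZl //; last exact: sqintZ.
by rewrite divfK ?subrr // gt_eqF.
Qed.

(** The linear function f = s (x_i - c_i) of norm 1 in the direction of largest
    inertia is the test datum: a field v with divergence f has
    |Dv_i - s (x - c)|^2 >= 0, and the cross term is known exactly. *)
Lemma bogovskii_ge : (n%:R%:E <= bogovskii Omega)%E.
Proof.
have [c c0] := centroid.
pose P i := X i - mpolyC n (c i).
pose J i := ip (peval (P i)) (peval (P i)).
have dP i j : mderiv j (P i) = (j == i)%:R.
  by rewrite mderivB mderivC subr0 mderiv_var.
have J_gt0 i : 0 < J i.
  apply: ip_gt0; have [x Ox] := O0; apply: contrapT => h.
  have f0 : \forall y \near x, peval (P i) y = 0.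
    have : nbhs x Omega by exact: open_nbhs_nbhs.
    by apply: filterS => y Oy; apply/eqP/negbNE/negP => Py; apply: h; exists y.
  have [_ h1] := is_derive_near0 (delta_mx ord0 i : 'rV[R]_n) f0.
  have [_ h2] := is_derive_peval i (P i) x.
  by move: h2; rewrite h1 dP eqxx peval1 => /esym/eqP; rewrite oner_eq0.
pose i := [arg max_(i > Ordinal n_gt0) J i]%O.
have Ji j : J j <= J i by rewrite /i; case: arg_maxP => // k _; exact.
pose s := (Num.sqrt (J i))^-1.
have s2 : s ^+ 2 * J i = 1.
  by rewrite /s exprVn sqr_sqrtr ?(ltW (J_gt0 i)) // mulVf // gt_eqF.
pose f x := s * peval (P i) x.
have f2 : sqint f by exact: sqintZ.
have ff : ip f f = 1 by rewrite ipZl // ipZr // mulrA -expr2.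
have one2 : sqint (fun=> 1) by apply: sqint_cst => //; exact: bounded_finite.
apply: (@le_trans _ _ (ereal_inf [set E | exists v Dv, [/\ H10vec Omega v Dv,
        {ae lambda, forall x, Omega x -> \tr (Dv x) = f x} &
        E = (\int[lambda]_(x in Omega) (\sum_i \sum_j Dv x i j ^+ 2)%:E)%E]])).
  apply: le_ereal_inf_tmp => _ [v [Dv [hv divv ->]]].
  rewrite (energyE mO bO hv) lee_fin.
  have D2 := H10vec_sqint mO bO hv.
  have parts k j p : ip (fun x => Dv x k j) (peval p) =
      - ip (fun x => v x ord0 k) (peval (mderiv j p)).
    rewrite -(H10_by_parts mO bO p j (hv k)); apply: eq_ip => // x _; by rewrite mxE.
  (* Test div v = f with x_i - c_i: only the component v_i contributes. *)
  have m0 : ip (fun x => v x ord0 i) (peval 1) = - (s * J i).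
    have v2 k : sqint (fun x => v x ord0 k) by have [] := H10_elim mO bO (hv k).
    have tr2 : sqint (fun x => \sum_k Dv x k k) by exact: sqint_sum.
    have := ae_eq_ip mO tr2 f2 (p2 (P i)) divv.
    rewrite ipZl // -/(J i) => <-; rewrite ip_suml //.
    rewrite (bigD1 i) //= parts dP eqxx big1 ?addr0 ?opprK // => k ki.
    rewrite parts dP (negPf ki) ipC.
    rewrite -[RHS]oppr0; congr (- _); rewrite -[RHS](ip0l lambda mO (fun x => v x ord0 k)).
    by apply: eq_ip => // x _; rewrite peval0.
  have : 0 <= \sum_j ip (fun x => Dv x i j - s * peval (P j) x)
      (fun x => Dv x i j - s * peval (P j) x).
    by apply: sumr_ge0 => j _; exact: ip_ge0.
  under eq_bigr => j _ do rewrite ip_subZ_sqr // parts dP eqxx m0 opprK.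
  rewrite big_split /= sumrB sumr_const card_ord.
  have h1 : \sum_j s ^+ 2 * ip (peval (P j)) (peval (P j)) <= n%:R.
    rewrite (_ : n%:R = \sum_(j < n) s ^+ 2 * J i); last first.
      by rewrite sumr_const card_ord s2.
    by apply: ler_sum => j _; rewrite ler_wpM2l ?sqr_ge0 // Ji.
  have -> : 2 * s * (s * J i) *+ n = 2 * n%:R.
    by transitivity (2 * n%:R * (s ^+ 2 * J i)); [ring|rewrite s2 mulr1].
  move=> h2.
  have : \sum_j ip (fun x => Dv x i j) (fun x => Dv x i j) <=
      \sum_i \sum_j ip (fun x => Dv x i j) (fun x => Dv x i j).
    rewrite [leRHS](bigD1 i) //= lerDl; apply: sumr_ge0 => k _.
    by apply: sumr_ge0 => j _; exact: ip_ge0.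
  by lra.
apply: ereal_sup_ubound; exists f => //; split => //.
- transitivity (ip f (fun=> 1)); first by apply: eq_Rintegral => x _; rewrite mulr1.
  by rewrite ipZl // c0 mulr0.
- by rewrite /sqnormL2 sqint_ipE // ff.
Qed.

End lower_bound.

End bogovskii_bounds.

(** * Ridge functions and the Dirichlet problem *)

Section ridge_polynomial.
Context (R : realType) (n : nat) (a : 'I_n -> R).

(** A ridge function is a function of this linear form alone. *)
Definition linform : mpoly n R := \sum_i a i *: mpolyX R (mnm1 i).
Local Notation L := linform.

Lemma peval_linform x : peval L x = \sum_i a i * x ord0 i.
Proof. by rewrite peval_sum; apply: eq_bigr => i _; rewrite pevalZ pevalX. Qed.

Lemma d_linform i : mderiv i L = mpolyC n (a i).
Proof.
rewrite mderiv_sum (bigD1 i) //= mderivZ mderiv_var eqxx big1 ?addr0.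
  by rewrite -[RHS]mulr1 mul_mpolyC.
by move=> j ji; rewrite mderivZ mderiv_var eq_sym (negPf ji) scaler0.
Qed.

Lemma d_linformX i k : mderiv i (L ^+ k.+1) = (a i * k.+1%:R) *: L ^+ k.
Proof.
elim: k => [|k IH]; first by rewrite expr1 d_linform mulr1 expr0 -mul_mpolyC mulr1.
rewrite exprS mderivM IH d_linform -mul_mpolyC -[RHS]mul_mpolyC (exprS L k).
by rewrite !mpolyCM !mpolyC_nat; ring.
Qed.

(** Integrate q termwise with respect to the linear form. *)
Lemma ridge_primitive (q : {poly R}) : exists Q G : mpoly n R,
  (forall x, peval G x = q.[peval L x]) /\ forall i, mderiv i Q = a i *: G.
Proof.
exists (\sum_(k < size q) (q`_k / k.+1%:R) *: L ^+ k.+1), (\sum_(k < size q) q`_k *: L ^+ k).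
split => [x|i].
  by rewrite horner_coef peval_sum; apply: eq_bigr => k _; rewrite pevalZ pevalXn.
rewrite mderiv_sum scaler_sumr; apply: eq_bigr => k _.
rewrite mderivZ d_linformX !scalerA; congr (_ *: _).
by rewrite mulrCA divfK // pnatr_eq0.
Qed.

End ridge_polynomial.

Section dirichlet.
Context (R : realType) (n : nat).
Hypothesis n_ge2 : (2 <= n)%N.
Local Notation B := (unit_ball R n).
Local Notation lambda := (lebesgue_rV R n).
Local Notation sqint := (sqint lambda B).
Local Notation ip := (ip lambda B).

Let mB : measurable B := @unit_ball_measurable R n.
Let bB := @unit_ball_bdd R n.
Let p2 p : sqint (peval p). Proof. exact: sqint_peval. Qed.

Section ridge_data.
Variables (a : 'I_n -> R) (k : R -> R).
Hypothesis mk : measurable_fun setT k.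
Local Notation L := (linform a).
Local Notation A := (\sum_i a i ^+ 2).
Local Notation g := (fun x => k (peval L x)).
Hypothesis g2 : sqint g.

(** Both w a and v have trace a . grad w, so w a - v is divergence-free; tested
    against a primitive Q of a polynomial ridge function G it gives that
    U = |a|^2 w - a . v is orthogonal to G.  Polynomials in the linear form are
    dense among its square-integrable functions. *)
Lemma ip_ridge w Dw v Dv : H10 B w Dw -> H10vec B v Dv ->
  {ae lambda, forall x, B x -> \tr (Dv x) = \sum_i a i * Dw x ord0 i} ->
  A * ip w g = \sum_i a i * ip (fun x => v x ord0 i) g.
Proof.
move=> hw hv divv; have [w2 Dw2 _] := H10_elim mB bB hw.
have D2 := H10vec_sqint mB bB hv.
have v2 i : sqint (fun x => v x ord0 i) by have [] := H10_elim mB bB (hv i).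
pose U x := A * w x - \sum_i a i * v x ord0 i.
have av2 : sqint (fun x => \sum_i a i * v x ord0 i).
  by apply: sqint_sum => // i; exact: sqintZ.
have U2 : sqint U by apply: sqintB => //; exact: sqintZ.
have UE h : sqint h -> ip U h = A * ip w h - \sum_i a i * ip (fun x => v x ord0 i) h.
  move=> h2; rewrite ipBl // ?ipZl ?ip_suml //; try exact: sqintZ.
    by congr (_ - _); apply: eq_bigr => i _; rewrite ipZl.
  by move=> i; exact: sqintZ.
suff U0 : ip U g = 0 by apply/eqP; rewrite -subr_eq0 -UE // U0.
have UP (q : {poly R}) : ip U (fun x => q.[peval L x]) = 0.
  have [Q [G [GE dQ]]] := ridge_primitive a q.
  have -> : ip U (fun x => q.[peval L x]) = ip U (peval G).
    by apply: eq_ip => // x _; rewrite GE.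
  rewrite UE //.
  have h1 i : ip (fun x => Dw x ord0 i) (peval Q) = - (a i * ip w (peval G)).
    rewrite (H10_by_parts mB bB Q i hw) dQ -ipZr //; congr (- _).
    by apply: eq_ip => // x _; rewrite pevalZ.
  have h2 i : ip (fun x => Dv x i i) (peval Q) = - (a i * ip (fun x => v x ord0 i) (peval G)).
    transitivity (ip (fun x => row i (Dv x) ord0 i) (peval Q)).
      by apply: eq_ip => // x _; rewrite mxE.
    rewrite (H10_by_parts mB bB Q i (hv i)) dQ -ipZr //; congr (- _).
    by apply: eq_ip => // x _; rewrite pevalZ.
  have aDw2 : sqint (fun x => \sum_i a i * Dw x ord0 i).
    by apply: sqint_sum => // i; exact: sqintZ.
  have tr2 : sqint (fun x => \sum_i Dv x i i) by exact: sqint_sum.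
  have S1 : ip (fun x => \sum_i a i * Dw x ord0 i) (peval Q) = - (A * ip w (peval G)).
    rewrite ip_suml //; last by move=> i; exact: sqintZ.
    rewrite mulr_suml -sumrN; apply: eq_bigr => i _.
    by rewrite ipZl // h1 mulrN mulrA -expr2.
  have S2 : ip (fun x => \sum_i Dv x i i) (peval Q) =
      - \sum_i a i * ip (fun x => v x ord0 i) (peval G).
    by rewrite ip_suml // -sumrN; apply: eq_bigr => i _; rewrite h2.
  have := ae_eq_ip mB tr2 aDw2 (p2 Q) divv; rewrite S1 S2 => /oppr_inj ->.
  by rewrite subrr.
apply/eqP; rewrite -sqrf_eq0 eq_le sqr_ge0 andbT; apply/ler_addgt0Pl => e e0; rewrite addr0.
have [C LC] := peval_bounded L 1.
have UU : 0 < ip U U + 1 by rewrite ltr_wpDl // ip_ge0.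
have [q qe] : exists q : {poly R}, ip (fun x => k (peval L x) - q.[peval L x])
    (fun x => k (peval L x) - q.[peval L x]) <= e / (ip U U + 1).
  have LB x : B x -> `|peval L x| <= C by move=> /unit_ball_bounded; exact: LC.
  apply: (density_line mB (bounded_finite mB bB) (measurable_peval L) LB mk g2).
  exact: divr_gt0.
have q2 : sqint (fun x => q.[peval L x]).
  by have [Q [G [GE _]]] := ridge_primitive a q; apply: sqint_ext (p2 G).
have -> : ip U g = ip U (fun x => k (peval L x) - q.[peval L x]).
  by rewrite ipBr // UP subr0.
apply: le_trans (cauchy_schwarz mB U2 (sqintB mB g2 q2)) _.
apply: le_trans (ler_wpM2l (ip_ge0 _ _ _) qe) _.
by rewrite mulrA ler_pdivrMr // mulrC ler_pM2l // lerDl.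
Qed.

(** Take v with divergence a . grad w and almost optimal energy E.  The weak
    equation tested with w and with the v_i, together with [ip_ridge], computes
    the cross term of 0 <= |A grad w - a . Dv|^2, where A = |a|^2, and
    Cauchy-Schwarz bounds |a . Dv|^2 by A E. *)
Lemma dirichlet_energy w Dw : 0 < A -> dirichlet_solution B g w Dw ->
  A * \sum_j ip (fun x => Dw x ord0 j) (fun x => Dw x ord0 j) <=
  n%:R * ip (fun x => \sum_i a i * Dw x ord0 i) (fun x => \sum_i a i * Dw x ord0 i).
Proof.
move=> A0 [hw weak]; have [w2 Dw2 _] := H10_elim mB bB hw.
set f := fun x => \sum_i a i * Dw x ord0 i.
have f2 : sqint f by apply: sqint_sum => // i; exact: sqintZ.
have one2 : sqint (fun=> 1) by apply: sqint_cst => //; exact: bounded_finite.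
have f0 : ip f (fun=> 1) = 0.
  rewrite ip_suml //; last by move=> i; exact: sqintZ.
  apply: big1 => i _; rewrite ipZl //.
  rewrite (_ : ip _ _ = ip (fun x => Dw x ord0 i) (peval 1)); last first.
    by apply: eq_ip => // x _; rewrite peval1.
  rewrite (H10_by_parts mB bB 1 i hw) mderiv_one.
  have -> : ip w (peval 0) = ip (fun=> 0) w.
    by rewrite ipC; apply: eq_ip => // x _; rewrite peval0.
  by rewrite ip0l // oppr0 mulr0.
set W := (X in _ * X <= _).
have WE : ip w g = W.
  by rewrite ipC -[LHS](weak _ _ hw) (Rintegral_sum_ip mB).
apply/ler_addgt0Pr => e e0.
have [v [Dv [hv divv en]]] := bogovskii_solution n_ge2 f2 f0 e0.
apply: le_trans en; set E := (X in _ <= X).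
have D2 := H10vec_sqint mB bB hv.
have ridge := ip_ridge hw hv divv.
have vg i : ip (fun x => v x ord0 i) g = \sum_j ip (fun x => Dv x i j) (fun x => Dw x ord0 j).
  rewrite ipC; apply: etrans (esym (weak _ _ (hv i))) _.
  rewrite (_ : \int[lambda]_(x in B) _ = \int[lambda]_(x in B) (\sum_j Dv x i j * Dw x ord0 j)).
    by rewrite Rintegral_sum_ip.
  by apply: eq_Rintegral => x _; apply: eq_bigr => j _; rewrite mxE mulrC.
pose Z j x := \sum_i a i * Dv x i j.
have Z2 j : sqint (Z j) by apply: sqint_sum => // i; exact: sqintZ.
have : 0 <= \sum_j ip (fun x => Z j x - A * Dw x ord0 j) (fun x => Z j x - A * Dw x ord0 j).
  by apply: sumr_ge0 => j _; exact: ip_ge0.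
under eq_bigr do rewrite ip_subZ_sqr //.
rewrite big_split sumrB /= -!mulr_sumr -/W.
have -> : \sum_j ip (Z j) (fun x => Dw x ord0 j) = A * W.
  rewrite -WE ridge; under [RHS]eq_bigr do rewrite vg mulr_sumr.
  rewrite exchange_big /=; apply: eq_bigr => j _; rewrite ip_suml //.
    by apply: eq_bigr => i _; rewrite ipZl.
  by move=> i; exact: sqintZ.
have ZE : \sum_j ip (Z j) (Z j) <= A * E.
  rewrite /E exchange_big mulr_sumr; apply: ler_sum => j _.
  exact: (ip_lincomb_le mB a (fun i => D2 i j)).
move=> h; have : A * (A * W) <= A * E by lra.
by rewrite ler_pM2l.
Qed.

End ridge_data.

End dirichlet.

(** * The corollary *)

Section unit_ball_data.
Context (R : realType) (n : nat).
Local Notation B := (unit_ball R n).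
Local Notation lambda := (lebesgue_rV R n).
Local Notation sqint := (sqint lambda B).
Local Notation ip := (ip lambda B).

Let mB : measurable B := @unit_ball_measurable R n.
Let bB := @unit_ball_bdd R n.

Lemma bounded_set_ball (Omega : set 'rV[R]_n) : bounded_set Omega ->
  exists M, Omega `<=` ball 0 M.
Proof.
move=> [M [_ OM]]; exists (`|M| + 2) => x Ox.
rewrite -ball_normE /= sub0r normrN.
have h : M < `|M| + 1 by rewrite ltr_pwDr // ler_norm.
by apply: le_lt_trans (OM _ h x Ox) _; rewrite ltrD2l ltr1n.
Qed.

(** The profile k is recovered from g along the i-th axis, which also makes it
    measurable; it is cut off outside the axis segment contained in the ball. *)
Lemma depends_only_on_measurable (i : 'I_n) g : depends_only_on B i g -> measurable_fun B g ->
  exists2 k : R -> R, measurable_fun setT k & forall x, B x -> g x = k (x ord0 i).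
Proof.
move=> [k gk] mg; pose iota (t : R) : 'rV[R]_n := t *: delta_mx ord0 i.
have miota : measurable_fun setT iota.
  apply/measurable_fun_rVP => j; rewrite /iota.
  under eq_fun do rewrite mxE mulrC.
  exact: measurable_funM.
pose D := iota @^-1` B.
have mD : measurable D by rewrite -[D]setTI; exact: miota.
exists ((g \o iota) \_ D).
  apply: (measurable_restrictT _ mD).1; apply: (measurable_comp mB _ mg).
    by move=> _ [t Dt <-].
  exact: measurable_funTS.
move=> x Bx; have iE t : \sum_j iota t ord0 j ^+ 2 = t ^+ 2.
  rewrite (bigD1 i) //= big1 ?addr0 => [|j ji]; first by rewrite !mxE !eqxx mulr1.
  by rewrite !mxE (negPf ji) andbF mulr0 expr0n.
have Dx : B (iota (x ord0 i)).
  rewrite /unit_ball /= iE; apply: le_lt_trans Bx.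
  by rewrite (bigD1 i) //= lerDl sumr_ge0 // => j _; exact: sqr_ge0.
rewrite patchE mem_set //= gk // [in RHS]gk //.
by rewrite !mxE !eqxx mulr1.
Qed.

Lemma sqint_ridge_continuous a (h : R -> R) : continuous h ->
  sqint (fun x => h (peval (linform a : mpoly n R) x)).
Proof.
move=> ch; have [C LC] := peval_bounded (linform a : mpoly n R) 1.
have [M [_ hM]] : bounded_set (h @` `[- C, C]).
  apply: compact_bounded; apply: continuous_compact.
    exact: continuous_subspaceT.
  exact: segment_compact.
apply: (sqint_bounded mB (bounded_finite mB bB) (M := `|M| + 1)).
  apply: measurable_funTS; apply: continuous_measurable_rV => x.
  by apply: continuous_comp; [exact: continuous_peval|exact: ch].
move=> x /unit_ball_bounded /LC xC; apply: hM; first by rewrite ltr_pwDr // ler_norm.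
by exists (peval (linform a) x) => //; rewrite /= in_itv /= -ler_norml.
Qed.

Lemma sum_symmetric (M : 'I_n -> 'I_n -> R) : (forall i j, M i j = M j i) ->
  \sum_i \sum_j M i j = \sum_i M i i + 2 * \sum_(i < n) \sum_(j < n | (i < j)%N) M i j.
Proof.
move=> Msym.
have -> : \sum_i \sum_j M i j = \sum_(i < n) (M i i + \sum_(j < n | (i < j)%N) M i j +
    \sum_(j < n | (j < i)%N) M i j).
  apply: eq_bigr => i _; rewrite (bigD1 i) //= (bigID (fun j : 'I_n => (i < j)%N)) /= addrA.
  congr (_ + _ + _); apply: eq_bigl => j; rewrite -val_eqE /=; lia.
rewrite !big_split /= mulr2n mulrDl !mul1r -addrA; congr (_ + (_ + _)).
rewrite (exchange_big_dep predT) //=; apply: eq_bigr => i _; apply: eq_bigr => j _.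
by rewrite Msym.
Qed.

End unit_ball_data.

Theorem corollary3p1 (R : realType) (n : nat) (hn : (2 <= n)%N) :
  let B := unit_ball R n in
  let lambda := lebesgue_rV R n in
  [/\ forall Omega : set 'rV[R]_n, bounded_lipschitz_domain Omega ->
        (bogovskii B <= bogovskii Omega)%E,
      bogovskii B = n%:R%:E,
      forall (i : 'I_n) (g : 'rV[R]_n -> R), depends_only_on B i g -> L2 B g ->
        forall (w : 'rV[R]_n -> R) (Dw : 'rV[R]_n -> 'rV[R]_n),
          dirichlet_solution B g w Dw ->
          ((n%:R^-1)%:E *
             \int[lambda]_(x in B) (\sum_j Dw x ord0 j ^+ 2)%:E <=
           \int[lambda]_(x in B) (Dw x ord0 i ^+ 2)%:E)%E
    & forall h : R -> R, continuous h ->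
        forall (w : 'rV[R]_n -> R) (Dw : 'rV[R]_n -> 'rV[R]_n),
          dirichlet_solution B (fun x => h (\sum_i x ord0 i)) w Dw ->
          0 <= \sum_(i < n) \sum_(j < n | (i < j)%N)
                 \int[lambda]_(x in B) (Dw x ord0 i * Dw x ord0 j)].
Proof.
move=> B lambda; have mB := @unit_ball_measurable R n; have bB := @unit_ball_bdd R n.
have n0 : (0 < n)%N by exact: ltnW.
have n0R : 0 < n%:R :> R by rewrite ltr0n.
have Bn : bogovskii B = n%:R%:E.
  apply/eqP; rewrite eq_le bogovskii_unit_ball_le //=.
  apply: bogovskii_ge => //; first exact: unit_ball_open.
  by exists 0; exact: unit_ball0.
split => //.
- move=> Omega [oO _ O0 /bounded_set_ball bO _]; rewrite Bn.
  exact: bogovskii_ge.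
- move=> i g gi g2 w Dw hw.
  have [k mk gk] := depends_only_on_measurable gi g2.1.
  have [w2 Dw2 _] := H10_elim mB bB hw.1.
  pose a (j : 'I_n) : R := (j == i)%:R.
  have aE (F : 'I_n -> R) : \sum_j a j * F j = F i.
    rewrite (bigD1 i) //= /a eqxx mul1r big1 ?addr0 // => j /negPf ->.
    by rewrite mul0r.
  have a1 : \sum_j a j ^+ 2 = 1.
    by under eq_bigr do rewrite expr2; rewrite aE /a eqxx.
  have gL x : B x -> g x = k (peval (linform a) x).
    by move=> Bx; rewrite peval_linform aE gk.
  have k2 : sqint lambda B (fun x => k (peval (linform a) x)) by exact: sqint_ext g2.
  have hk : dirichlet_solution B (fun x => k (peval (linform a) x)) w Dw.
    split; first exact: hw.1.
    move=> u Du hu; rewrite (hw.2 u Du hu); apply: eq_Rintegral => x /set_mem Bx.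
    by rewrite gL.
  have := dirichlet_energy hn mk k2 _ hk.
  rewrite a1 mul1r => /(_ ltr01).
  rewrite (sum_sqint_ipE mB (F := fun j x => Dw x ord0 j)) // sqint_ipE // -EFinM lee_fin.
  under [X in ip _ _ X _]eq_fun do rewrite aE.
  under [X in ip _ _ _ X]eq_fun do rewrite aE.
  by move=> h; rewrite mulrC ler_pdivrMr // mulrC.
move=> h ch w Dw hw.
have [w2 Dw2 _] := H10_elim mB bB hw.1.
pose a (j : 'I_n) : R := 1.
have aE (F : 'I_n -> R) : \sum_j a j * F j = \sum_j F j.
  by apply: eq_bigr => j _; rewrite mul1r.
have aA : \sum_j a j ^+ 2 = n%:R.
  by under eq_bigr do rewrite expr1n; rewrite sumr_const card_ord.
have hL : (fun x : 'rV[R]_n => h (\sum_i x ord0 i)) = fun x => h (peval (linform a) x).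
  by apply/funext => x; rewrite peval_linform aE.
rewrite hL in hw.
have := dirichlet_energy hn (continuous_measurable_fun ch) (sqint_ridge_continuous a ch) _ hw.
rewrite aA => /(_ n0R); rewrite ler_pM2l //.
under [X in ip _ _ X _]eq_fun do rewrite aE.
under [X in ip _ _ _ X]eq_fun do rewrite aE.
rewrite ip_suml //; last exact: sqint_sum.
under [leRHS]eq_bigr do rewrite ip_sumr //.
rewrite sum_symmetric; last by move=> i j; exact: ipC.
by rewrite lerDl pmulr_rge0.
Qed.
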